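(* Let $S:\mathbb R^n\to\mathbb R^n$, $S(x)=aRx+x_0$ with $a>0$, $R\in O(n)$, $x_0\in\mathbb R^n$, and let $S_\#$ be its pushforward on $\mathcal P_2(\mathbb R^n)$. Then: (i) $H(S_\#p)=H(p)+n\ln a$, $J(S_\#p)=J(p)/a^2$ and $\mathcal W_2(S_\#p,S_\#q)=a\,\mathcal W_2(p,q)$ for all $p,q\in\mathcal P_2(\mathbb R^n)$. (ii) For $U=cJ$ ($c>0$): $U\circ S_\#=U/a^2$; for every $e\ge0$ and every $AC^2$ curve $\gamma$, $\ell_e(S_\#\gamma)=\ell_{a^2e}(\gamma)$, so $d_e(S_\#p,S_\#q)=d_{a^2e}(p,q)$, and at $e=0$ the cost geometry is isometric under similarities: $d_0(S_\#p,S_\#q)=d_0(p,q)$. The following are unchanged by $S_\#$: that $\partial_\infty$ lies at infinite distance, the eikonal proportionality $U=cJ$, hyperbolicity (negative Gauss curvature of the location-scale leaves) and the extremality of the Gaussian leaf in curvature; for $n=1$, $S_\#$ maps a location-scale leaf onto the leaf of the same base up to reflection, and reflection leaves $J_0$ unchanged. (iii) For $U=cJ^\alpha$ ($c>0$, $\alpha\in\mathbb R$), $\ell_0(S_\#\gamma)=a^{1-\alpha}\ell_0(\gamma)$ for every $AC^2$ curve $\gamma$; the length structure at $e=0$ is invariant under all similarities if and only if $\alpha=1$.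
   Context: $\mathcal P_2(\mathbb R^n)$: Borel probability measures with finite second moment; $\mathcal W_2$ the quadratic Wasserstein distance. $H(p)=-\int p\ln p\,dx$ ($-\infty$ for measures without density), $J(p)=\int|\nabla p|^2/p\in[0,\infty]$ (with $+\infty$ if there is no density with $\sqrt p\in W^{1,2}$), $\partial_\infty=\{H=-\infty\}$. A curve $\gamma:[0,T]\to\mathcal P_2(\mathbb R^n)$ is $AC^2$ if $\mathcal W_2(\gamma_s,\gamma_t)\le\int_s^tm$ for some $m\in L^2$; $|\dot\gamma|$ is its metric speed; $S_\#\gamma$ is the curve $t\mapsto S_\#\gamma_t$. For $U:\mathcal P_2(\mathbb R^n)\to[0,\infty]$ and $e\ge0$, $\ell_e(\gamma)=\int_0^T\sqrt{2(e+U(\gamma_t))}\,|\dot\gamma|\,dt$ is the length of the cost metric $\tilde g_{e,U}=2(e+U)g_{\mathcal W_2}$, and $d_e=\inf\ell_e$ over $AC^2$ curves with given endpoints. For $n=1$, a location-scale leaf is $\mathcal L_{\varphi_0}=\{\sigma^{-1}\varphi_0((\cdot-\mu)/\sigma):\mu\in\mathbb R,\sigma>0\}$ for a standardized base density $\varphi_0$ (mean $0$, variance $1$), with $J_0=\int(\varphi_0')^2/\varphi_0<\infty$; it is $\mathcal W_2$-isometric to the half-plane $\{\sigma>0\}$ with metric $d\mu^2+d\sigma^2$, and with $U=cJ$, $e=0$ it has constant Gauss curvature $-1/(2cJ_0)$, most negative exactly for the Gaussian base ($J_0=1$, the minimum). Eikonal proportionality means $U=cJ$ for some $c>0$. *)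

(* Defs.v *)
From HB Require Import structures.
From mathcomp Require Import all_boot all_order all_algebra.
From mathcomp Require Import all_classical all_reals all_analysis.
From mathcomp Require Import measurable_realfun.
From mathcomp Require Import ring lra.
Import Order.TTheory GRing.Theory Num.Theory.
Import numFieldNormedType.Exports.
Set Implicit Arguments.
Unset Strict Implicit.
Unset Printing Implicit Defensive.
Local Open Scope classical_set_scope.
Local Open Scope ring_scope.

HB.instance Definition _ (R : realType) (m n : nat) :=
  @isMeasurable.Build (sigma_display (@open 'M[R]_(m, n))) 'M[R]_(m, n)
    <<s @open 'M[R]_(m, n) >> (@sigma_algebra0 _ setT _)
    (@sigma_algebraC 'M[R]_(m, n) _) (@sigma_algebra_bigcup _ setT _).

Lemma measurable_fun_continuous (R : realType) (m n : nat)
    (f : 'M[R]_(m, n) -> R) :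
  continuous f -> measurable_fun setT f.
Proof.
move=> /continuousP cf; apply: (measurability _ (RGenOpens.measurableE R)).
move=> _ [_ [a [b ->] <-]]; rewrite setTI; apply: sub_sigma_algebra.
exact/cf/interval_open.
Qed.

Lemma continuous_mxP (R : realType) (T : topologicalType) (m n : nat)
    (f : T -> 'M[R]_(m, n)) :
  (forall i j, continuous (fun x => f x i j)) -> continuous f.
Proof.
move=> cf x A [P fP PA].
have : \forall y \near x, forall ij : 'I_m * 'I_n, P ij.1 ij.2 (f y ij.1 ij.2).
  by apply: filter_forall => -[i j]; exact: (cf i j x _ (fP i j)).
apply: filterS => y Py; apply: PA => i j; exact: (Py (i, j)).
Qed.

Section lebesgue_tuple.
Context {R : realType}.
Local Notation R' := (measurableTypeR R).

Let cons_tuple n (x : R' * n.-tuple R') : n.+1.-tuple R' := [tuple of x.1 :: x.2].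

Let measurable_cons_tuple n : measurable_fun setT (@cons_tuple n).
Proof. exact: measurable_cons. Qed.

Definition lebesgue_cons n (mu : {sigma_finite_measure set (n.-tuple R') -> \bar R})
    : set (n.+1.-tuple R') -> \bar R :=
  pushforward (lebesgue_measure \x mu)%E (@cons_tuple n).

Section instances.
Variables (n : nat) (mu : {sigma_finite_measure set (n.-tuple R') -> \bar R}).

HB.instance Definition _ := Measure.copy (lebesgue_cons mu)
  (measure_function_pushforward__canonical__measure_function_Measure
    (lebesgue_measure \x mu)%E (@measurable_cons_tuple n)).

Let lebesgue_cons_sigma_finite : sigma_finite setT (lebesgue_cons mu).
Proof.
have /sigma_finiteP[F [FT Fnd Foo]] := sigma_finiteT (@lebesgue_measure R).
have /sigma_finiteP[G [GT Gnd Goo]] := sigma_finiteT mu.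
exists (fun k => [set t | F k (thead t) /\ G k [tuple of behead t]]).
  apply/esym; rewrite -subTset => t _.
  have : [set: R'] (thead t) by [].
  have : [set: n.-tuple R'] [tuple of behead t] by [].
  rewrite FT GT => -[j _ Gj] [i _ Fi]; exists (maxn i j) => //; split.
    by move: Fi; exact/subsetPset/Fnd/leq_maxl.
  by move: Gj; exact/subsetPset/Gnd/leq_maxr.
move=> k; have [mF Fo] := Foo k; have [mG Go] := Goo k; split.
  apply: measurableI.
    by rewrite -[X in measurable X]setTI; exact: measurable_tnth.
  by rewrite -[X in measurable X]setTI; exact: measurable_behead.
rewrite /lebesgue_cons /pushforward (_ : _ @^-1` _ = F k `*` G k).
  by rewrite product_measure1E// lte_mul_pinfty// ge0_fin_numE.
have tE (x : R') (t : n.-tuple R') : [tuple of behead [tuple of x :: t]] = t.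
  exact: val_inj.
by apply/funext => -[x t]; rewrite /= theadE tE.
Qed.

HB.instance Definition _ := @Measure_isSigmaFinite.Build _ _ _
  (lebesgue_cons mu) lebesgue_cons_sigma_finite.
End instances.

Fixpoint lebesgue_tuple n : {sigma_finite_measure set (n.-tuple R') -> \bar R} :=
  match n with
  | 0%N => \d_[tuple]
  | n'.+1 => lebesgue_cons (lebesgue_tuple n')
  end.

End lebesgue_tuple.

Section lebesgue_cV.
Context {R : realType} (n : nat).
Local Notation R' := (measurableTypeR R).

Definition col_tuple (t : n.-tuple R') : 'cV[R]_n := \col_i tnth t i.

Lemma measurable_col_tuple : measurable_fun setT col_tuple.
Proof.
apply: (@measurability _ _ _ _ _ _ (@open 'cV[R]_n)) => // _ [U oU <-].
rewrite setTI.
pose box (qk : 'cV[rat]_n * nat) : set 'cV[R]_n :=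
  [set x | forall i, `|ratr (qk.1 i ord0) - x i ord0| < qk.2.+1%:R^-1].
have -> : col_tuple @^-1` U =
    \bigcup_qk (col_tuple @^-1` [set x | box qk `<=` U /\ box qk x]).
  apply/seteqP; split=> [t Ut|t [qk _ [+]]]; last exact.
  set x := col_tuple t in Ut *.
  have /nbhs_ballP[e /= e0 eU] := open_nbhs_nbhs (conj oU Ut).
  have [k ke] : exists k, k.+1%:R^-1 < e / 2.
    have [//|k] := @ltr_add_invr R 0 (e / 2) _; first by rewrite divr_gt0.
    by rewrite add0r => ?; exists k.
  have /(_ _)/cid q_ i : exists q : rat, `|ratr q - x i ord0| < k.+1%:R^-1.
    have [|q] := @rat_in_itvoo R (x i ord0 - k.+1%:R^-1) (x i ord0 + k.+1%:R^-1).
      by rewrite ltrBlDr -addrA ltrDl addr_gt0.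
    by rewrite in_itv /= -ltr_distl => ?; exists q.
  exists (\col_i projT1 (q_ i), k) => //; split; last first.
    by move=> i /=; rewrite mxE; exact: (projT2 (q_ i)).
  move=> y /= By; apply: eU; split=> // i j; rewrite (ord1 j).
  have := By i; rewrite mxE => yi; have xi := projT2 (q_ i).
  rewrite /ball/= (splitr e) -(subrK (ratr (projT1 (q_ i))) (x i ord0)) -addrA.
  rewrite (le_lt_trans (ler_normD _ _))// ltrD//.
    by rewrite distrC (lt_trans _ ke).
  by rewrite (lt_trans _ ke).
apply: countable_bigcupT_measurable => // -[q k].
have [qU|qU] := pselect (box (q, k) `<=` U); last first.
  rewrite (_ : _ @^-1` _ = set0)//; apply/seteqP; split=> // t [].
  by move/qU.
rewrite (_ : _ @^-1` _ = \bigcap_(i in [set: 'I_n])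
    ((fun t : n.-tuple R' => tnth t i) @^-1`
      [set r | `|ratr (q i ord0) - r| < k.+1%:R^-1])).
  apply: fin_bigcap_measurable; first exact: finite_finset.
  move=> i _; rewrite -[X in measurable X]setTI; apply: measurable_tnth => //.
  rewrite (_ : [set r | _] = `](ratr (q i ord0) - k.+1%:R^-1), 
      (ratr (q i ord0) + k.+1%:R^-1)[%classic); first exact: measurable_itv.
  by apply/seteqP; split=> r /=; rewrite in_itv/= -ltr_distl distrC.
apply/seteqP; split=> t /=.
  by move=> [_ tq] i _ /=; have := tq i; rewrite mxE.
by move=> tq; split=> // i; rewrite mxE; exact: tq.
Qed.

Definition lebesgue_cV : set 'cV[R]_n -> \bar R :=
  pushforward (lebesgue_tuple n) col_tuple.

HB.instance Definition _ := Measure.copy lebesgue_cV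
  (measure_function_pushforward__canonical__measure_function_Measure
    (lebesgue_tuple n) measurable_col_tuple).

End lebesgue_cV.
Arguments lebesgue_cV {R n}.

Section wasserstein_space.
Context {R : realType} {n : nat}.
Implicit Types x y : 'cV[R]_n.

(* The canonical norm of ['cV[R]_n] is the sup norm, hence an explicit
   Euclidean square norm. *)
Definition sqnorm x : R := \sum_i x i ord0 ^+ 2.

Record P2 := MkP2 {
  P2_prob :> probability 'cV[R]_n R;
  P2_moment : (\int[P2_prob]_x (sqnorm x)%:E < +oo)%E }.

(* Library measures are functions on all sets, so Leibniz equality is finer
   than equality of measures. *)
Definition same_measure (p q : P2) :=
  forall A : set 'cV[R]_n, measurable A -> p A = q A.

Definition coupling (p q : P2) : set (probability ('cV[R]_n * 'cV[R]_n)%type R) :=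
  [set pi | forall A : set 'cV[R]_n, measurable A ->
     pi (fst @^-1` A) = p A /\ pi (snd @^-1` A) = q A].

(* The infimum is finite, because the product coupling has finite cost. *)
Definition W2 (p q : P2) : R :=
  Num.sqrt (fine (ereal_inf
    [set (\int[pi]_z (sqnorm (z.1 - z.2))%:E)%E | pi in coupling p q])).

Definition is_density (p : P2) (f : 'cV[R]_n -> R) :=
  [/\ measurable_fun setT f, forall x, 0 <= f x &
      forall A, measurable A -> p A = (\int[lebesgue_cV]_(x in A) (f x)%:E)%E].

(* All densities of [p] give the same integral; without density,
   [ereal_sup set0 = -oo]. *)
Definition H (p : P2) : \bar R :=
  ereal_sup [set (- \int[lebesgue_cV]_x (f x * ln (f x))%:E)%E
            | f in is_density p].

Definition boundary : set P2 := [set p | H p = -oo%E].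

Definition partial (i : 'I_n) (f : 'cV[R]_n -> R) : 'cV[R]_n -> R :=
  'D_(delta_mx i ord0) f.

Fixpoint Ck (k : nat) (f : 'cV[R]_n -> R) : Prop :=
  match k with
  | 0%N => continuous f
  | k'.+1 => (forall x, differentiable f x) /\ forall i, Ck k' (partial i f)
  end.

Definition test_function (phi : 'cV[R]_n -> R) :=
  (forall k, Ck k phi) /\
  exists2 K : set 'cV[R]_n, compact K & forall x, ~ K x -> phi x = 0.

Definition loc_integrable (f : 'cV[R]_n -> R) :=
  measurable_fun setT f /\
  forall K : set 'cV[R]_n, compact K -> lebesgue_cV.-integrable K (EFin \o f).

Definition weak_gradient (f : 'cV[R]_n -> R) (g : 'cV[R]_n -> 'cV[R]_n) :=
  loc_integrable f /\
  forall i, loc_integrable (fun x => g x i ord0) /\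
    forall phi, test_function phi ->
      \int[lebesgue_cV]_x (f x * partial i phi x) =
      - \int[lebesgue_cV]_x (g x i ord0 * phi x).

Definition sobolev_W12 (f : 'cV[R]_n -> R) :=
  f \in Lfun lebesgue_cV 2%:E /\
  exists2 g, weak_gradient f g &
    forall i, (fun x => g x i ord0) \in Lfun lebesgue_cV 2%:E.

(* [\int |nabla f|^2 / f], where [0 / 0 = 0]; the weak gradient is unique up
   to a null set, so the infimum is over a singleton when [sqrt f] is in
   [W^{1,2}] and over the empty set ([+oo]) otherwise. *)
Definition fisher (f : 'cV[R]_n -> R) : \bar R :=
  ereal_inf [set (\int[lebesgue_cV]_x (sqnorm (g x) / f x)%:E)%E
            | g in [set g | sobolev_W12 (fun x => Num.sqrt (f x)) /\
                            weak_gradient f g]].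

(* [ereal_inf set0 = +oo]. *)
Definition J (p : P2) : \bar R := ereal_inf [set fisher f | f in is_density p].

Definition AC2 (T : R) (gamma : R -> P2) :=
  exists m : R -> R,
    [/\ measurable_fun `[0, T] m,
        (\int[lebesgue_measure]_(t in `[0%R, T]) (m t ^+ 2)%:E < +oo)%E &
        forall s t, 0 <= s -> s <= t -> t <= T ->
          ((W2 (gamma s) (gamma t))%:E <=
             \int[lebesgue_measure]_(r in `[s, t]) (m r)%:E)%E].

Definition metric_speed (gamma : R -> P2) (t : R) : R :=
  lim ((fun h => W2 (gamma t) (gamma (t + h)) / `|h|) @ 0^').

(* [0 * +oo = 0]; the speed is two-sided, hence the open interval. *)
Definition cost_length (U : P2 -> \bar R) (e T : R) (gamma : R -> P2) : \bar R :=
  (\int[lebesgue_measure]_(t in `]0%R, T[)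
     (sqrte (2%:E * (e%:E + U (gamma t))) * (metric_speed gamma t)%:E))%E.

Definition cost_dist (U : P2 -> \bar R) (e : R) (p q : P2) : \bar R :=
  ereal_inf [set l | exists T gamma,
    [/\ 0 < T, AC2 T gamma, same_measure (gamma 0) p, same_measure (gamma T) q &
        l = cost_length U e T gamma]].

(* Extended real powers of nonnegative numbers with [+oo^a = 0] and
   [0^a = +oo] for [a < 0], unlike the library's [poweR]. *)
Definition epow (x : \bar R) (alpha : R) : \bar R :=
  match x with
  | r%:E => if (r == 0) && (alpha < 0) then +oo%E else (r `^ alpha)%:E
  | +oo%E => if 0 < alpha then +oo%E else if alpha == 0 then 1%E else 0%E
  | -oo%E => 0%E
  end.

Definition eikonal (U : P2 -> \bar R) :=
  exists2 c : R, 0 < c & forall p, U p = (c%:E * J p)%E.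

Definition boundary_at_infinity (d : P2 -> P2 -> \bar R) :=
  forall p q, ~ boundary p -> boundary q -> d p q = +oo%E.

End wasserstein_space.
Arguments P2 : clear implicits.

Section similarity.
Context {R : realType} {n : nat}.

Record similarity := MkSimilarity {
  sim_scale : R;
  sim_rot : 'M[R]_n;
  sim_shift : 'cV[R]_n;
  sim_scale_gt0 : 0 < sim_scale;
  sim_rot_orth : sim_rot^T *m sim_rot = 1%:M }.

Definition sim_fun (S : similarity) (x : 'cV[R]_n) : 'cV[R]_n :=
  sim_scale S *: (sim_rot S *m x) + sim_shift S.
Coercion sim_fun : similarity >-> Funclass.

Lemma continuous_coord_mul (M : 'M[R]_n) i :
  continuous (fun x : 'cV[R]_n => (M *m x) i ord0).
Proof.
rewrite (_ : (fun x => _) = fun x : 'cV[R]_n => \sum_j M i j * x j ord0); last first.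
  by apply/funext => x; rewrite mxE.
apply: (continuous_big (@add_continuous R)) => j _ x.
by apply: (@cvgMl_tmp R _ _ (nbhs_filter x)); exact: coord_continuous.
Qed.

Lemma continuous_sim (S : similarity) : continuous S.
Proof.
apply: continuous_mxP => i j; rewrite (ord1 j).
rewrite (_ : (fun x => _) = fun x =>
    sim_scale S * (sim_rot S *m x) i ord0 + sim_shift S i ord0); last first.
  by apply/funext => x; rewrite /sim_fun mxE; congr (_ + _); rewrite mxE.
move=> x; apply: (@cvgD R R^o _ _ (nbhs_filter x)); last exact: cvg_cst.
by apply: (@cvgMl_tmp R _ _ (nbhs_filter x)); exact: continuous_coord_mul.
Qed.

Lemma continuous_sqnorm : continuous (@sqnorm R n).
Proof.
apply: (continuous_big (@add_continuous R)) => i _ x.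
by apply: (@cvgM R _ _ (nbhs_filter x)); exact: coord_continuous.
Qed.

Lemma measurable_sim (S : similarity) : measurable_fun setT S.
Proof.
apply: (@measurability _ _ _ _ _ _ (@open 'cV[R]_n)) => // _ [U oU <-].
rewrite setTI; apply: sub_sigma_algebra; move/continuousP: (@continuous_sim S).
exact.
Qed.

HB.instance Definition _ (S : similarity) :=
  isMeasurableFun.Build _ _ _ _ S (measurable_sim S).

Lemma sqnorm_sim_le (S : similarity) x :
  sqnorm (S x) <= 2 * (sim_scale S ^+ 2) * sqnorm x + 2 * sqnorm (sim_shift S).
Proof.
have rotE : sqnorm (sim_rot S *m x) = sqnorm x.
  have sqnormE (y : 'cV[R]_n) : sqnorm y = (y^T *m y) ord0 ord0.
    by rewrite mxE; apply: eq_bigr => i _; rewrite mxE expr2.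
  by rewrite !sqnormE trmx_mul mulmxA -[_ *m _ *m sim_rot S]mulmxA sim_rot_orth mulmx1.
rewrite -rotE /sqnorm !mulr_sumr -big_split/=; apply: ler_sum => i _.
rewrite 2!mxE; set a := sim_scale S; set u := (sim_rot S *m x) i ord0.
rewrite -subr_ge0 (_ : _ - _ = (a * u - sim_shift S i ord0) ^+ 2) ?sqr_ge0//.
by ring.
Qed.

Lemma sim_moment (S : similarity) (p : P2 R n) :
  (\int[distribution p S]_x (sqnorm x)%:E < +oo)%E.
Proof.
have msq : measurable_fun setT (fun x : 'cV[R]_n => (sqnorm x)%:E).
  apply/measurable_EFinP; apply: measurable_fun_continuous.
  exact: continuous_sqnorm.
have sq0 (x : 'cV[R]_n) : (0 <= (sqnorm x)%:E)%E.
  by rewrite lee_fin sumr_ge0// => i _; rewrite sqr_ge0.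
rewrite ge0_integral_distribution//.
pose k : R := 2 * sim_scale S ^+ 2; pose l : R := 2 * sqnorm (sim_shift S).
have k0 : 0 <= k by rewrite mulr_ge0// sqr_ge0.
have l0 : 0 <= l by rewrite mulr_ge0//; rewrite -lee_fin.
apply: (@le_lt_trans _ _ (\int[p]_x (k%:E * (sqnorm x)%:E + l%:E))%E).
  apply: ge0_le_integral => //.
  - by move=> x _; exact: sq0.
  - exact: (measurableT_comp msq (measurable_sim S)).
  - by apply: emeasurable_funD => //; exact: measurable_funeM.
  - by move=> x _; rewrite /= -EFinM -EFinD lee_fin sqnorm_sim_le.
rewrite ge0_integralD//=; last 2 first.
- by move=> x _; rewrite mule_ge0.
- exact: measurable_funeM.
rewrite ge0_integralZl// integral_cst// [X in (l%:E * X)%E]probability_setT mule1.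
by rewrite lte_add_pinfty ?ltry// lte_mul_pinfty// P2_moment.
Qed.

Definition push (S : similarity) (p : P2 R n) : P2 R n :=
  MkP2 (P2_prob := distribution p S) (sim_moment S p).

End similarity.
Arguments similarity : clear implicits.

(* The length structure of [2 U g_W2], [e = 0]: admissible curves and lengths. *)
Definition similarity_invariant_length {R : realType} {n : nat}
    (U : P2 R n -> \bar R) :=
  forall (S : similarity R n) (T : R) (gamma : R -> P2 R n),
    0 < T -> AC2 T gamma ->
    AC2 T (fun t => push S (gamma t)) /\
    cost_length U 0 T (fun t => push S (gamma t)) = cost_length U 0 T gamma.

Section curvature.
Context {R : realType} {n : nat}.

Definition du (f : R -> R -> R) (u v : R) : R := derive1 (fun s => f s v) u.
Definition dv (f : R -> R -> R) (u v : R) : R := derive1 (fun s => f u s) v.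

Definition det3 (a b c d e f g h i : R) : R :=
  \det (\matrix_(k < 3, l < 3)
          nth 0 (nth [::] [:: [:: a; b; c]; [:: d; e; f]; [:: g; h; i]] k) l).

(* Brioschi formula for the Gauss curvature of the Riemannian metric
   [E du^2 + 2 F du dv + G dv^2]. *)
Definition brioschi (E F G : R -> R -> R) (u v : R) : R :=
  (det3 (- dv (dv E) u v / 2 + du (dv F) u v - du (du G) u v / 2)
          (du E u v / 2) (du F u v - dv E u v / 2)
        (dv F u v - du G u v / 2) (E u v) (F u v)
        (dv G u v / 2) (F u v) (G u v)
   - det3 0 (dv E u v / 2) (du G u v / 2)
          (dv E u v / 2) (E u v) (F u v)
          (du G u v / 2) (F u v) (G u v))
  / (E u v * G u v - F u v ^+ 2) ^+ 2.

(* [2 (e + U) g_W2] evaluated at the tangent vector [(a, b)] of the surface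
   [P], where [g_W2] is the square of the W2 metric speed. *)
Definition cost_form (U : P2 R n -> \bar R) (e : R) (P : R -> R -> P2 R n)
    (a b u v : R) : R :=
  2 * fine (e%:E + U (P u v)) *
  metric_speed (fun t => P (u + t * a) (v + t * b)) 0 ^+ 2.

Definition gauss_curvature U e P (u v : R) : R :=
  let E := cost_form U e P 1 0 in
  let G := cost_form U e P 0 1 in
  let F u v := (cost_form U e P 1 1 u v - E u v - G u v) / 2 in
  brioschi E F G u v.

End curvature.

Section location_scale.
Context {R : realType}.
Implicit Types phi : R -> R.

Definition locscale phi (mu sigma : R) (x : 'cV[R]_1) : R :=
  sigma^-1 * phi ((x ord0 ord0 - mu) / sigma).

Definition J0 phi : \bar R := fisher (fun x : 'cV[R]_1 => phi (x ord0 ord0)).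

Definition base_density phi :=
  [/\ measurable_fun setT phi /\ (forall x, 0 <= phi x),
      (\int[lebesgue_measure]_x (phi x)%:E = 1)%E,
      (\int[lebesgue_measure]_x (x * phi x)%:E = 0)%E,
      (\int[lebesgue_measure]_x (x ^+ 2 * phi x)%:E = 1)%E &
      (J0 phi < +oo)%E].

Definition leaf phi : set (P2 R 1) :=
  [set p | exists mu sigma, 0 < sigma /\ is_density p (locscale phi mu sigma)].

Definition leaf_chart phi (P : R -> R -> P2 R 1) :=
  forall mu sigma, 0 < sigma -> is_density (P mu sigma) (locscale phi mu sigma).

Definition mirror phi : R -> R := fun x => phi (- x).

Definition gaussian : R -> R := normal_pdf 0 1.

(* In the next two definitions [F] transports the leaves: [F = id] is the
   geometry of [U] itself, [F = push S] its pullback under [S_#]. *)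
Definition hyperbolic_leaves (U : P2 R 1 -> \bar R) (F : P2 R 1 -> P2 R 1) :=
  forall phi P, base_density phi -> leaf_chart phi P ->
  forall mu sigma, 0 < sigma ->
    gauss_curvature U 0 (fun m s => F (P m s)) mu sigma < 0.

Definition gaussian_extremal (U : P2 R 1 -> \bar R) (F : P2 R 1 -> P2 R 1) :=
  forall phi P Pg, base_density phi -> leaf_chart phi P ->
    leaf_chart gaussian Pg ->
  forall mu sigma mu' sigma', 0 < sigma -> 0 < sigma' ->
    let K := gauss_curvature U 0 (fun m s => F (P m s)) mu sigma in
    let Kg := gauss_curvature U 0 (fun m s => F (Pg m s)) mu' sigma' in
    Kg <= K /\
    (Kg = K <-> {ae lebesgue_measure, forall x, phi x = gaussian x}).

End location_scale.

(* Main.v *)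
Require Import Defs.
From HB Require Import structures.
From mathcomp Require Import all_boot all_order all_algebra.
From mathcomp Require Import all_classical all_reals all_analysis.
From mathcomp Require Import measurable_realfun ring lra.
Import Order.TTheory GRing.Theory Num.Theory.
Import numFieldNormedType.Exports.
Set Implicit Arguments.
Unset Strict Implicit.
Unset Printing Implicit Defensive.
Local Open Scope classical_set_scope.
Local Open Scope ring_scope.

(** Lebesgue measure on column vectors is, up to a factor, the only translation
    invariant measure, so a similarity of ratio [a] multiplies it by [a^n].
    Hence the push-forward by [S] acts bijectively on densities, weak gradients,
    couplings and curves, and [H], [J], [W2], the lengths and the distances
    scale. Conversely, if [c J^alpha] gives a similarity invariant length, then
    [a^(1 - alpha) = 1] as soon as some curve has a finite nonzero length: take
    the translates of a compactly supported smooth density, whose Fisher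
    information is finite and nonzero. On a location-scale leaf the optimal map
    is affine, so [W2] is the Euclidean distance of [(mu, sigma)], [J] is
    proportional to [sigma^-2], and the cost metric is a multiple [k] of the
    hyperbolic metric of the half-plane, of curvature [-1/k]. The factor [k] is
    the same for a base density and for its mirror image. *)

(** * Lebesgue measure and similarities *)

(** The identities are claimed for all measures and curves, including the conventional values of
    extended arithmetic, [lim], [fine] and extrema of empty sets, so they cannot rest on finiteness
    or on the existence of limits. Hence positive factors are taken out of integrals of arbitrary
    functions (the weight along a curve is not known to be measurable), a divergent metric speed is
    compared through the default value of [lim], and the entropy shift is added to an integral that
    may be infinite.

    Infima are treated in one direction only: transporting competitors by [S] gives an inequality,
    and the same inequality for the inverse similarity gives the converse.

    Uniqueness of translation invariant measures leaves an unknown factor, found on a test set: a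
    box for dilations, and for orthogonal maps the Euclidean ball, which they preserve.

    For the converse in (iii), positivity of the Fisher information needs a bound over all weak
    gradients of all densities, because [J] is an infimum over them. It comes from one integration
    by parts against a single test function. *)

Definition pushforward_measure d d' (T : measurableType d)
    (T' : measurableType d') (R : realType) (m : {measure set T -> \bar R})
    (f : T -> T') (mf : measurable_fun setT f) : {measure set T' -> \bar R} :=
  measure_function_pushforward__canonical__measure_function_Measure m mf.

Section lebesgue_line.
Context {R : realType}.
Local Notation R' := (measurableTypeR R).
Local Notation leb := (@lebesgue_measure R).

(** Lebesgue measure is determined by its values on the intervals []a, b]], and a translation
    preserves their shape and length. *)
Lemma lebesgue_measure_translate (c : R) (A : set R') : measurable A ->
  leb ((fun x => c + x) @^-1` A) = leb A.
Proof.
move=> mA.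
have mf : measurable_fun [set: R'] (fun x : R' => c + x : R').
  exact: measurable_funD.
apply/esym; apply: (@lebesgue_measure_unique _ (pushforward_measure leb mf)) => //.
move=> X [[a b] _ <-] /=; rewrite /pushforward_measure/= /pushforward.
rewrite (_ : _ @^-1` _ = `](a - c), (b - c)]%classic); last first.
  by apply/seteqP; split => x /=; rewrite !in_itv/= ltrBlDl lerBrDl.
rewrite !lebesgue_measure_itv/= !lte_fin ltrD2r.
by case: ifPn => // _; rewrite -!EFinB; congr EFin; ring.
Qed.

(** Negation turns []a, b]] into [[-b, -a[], half-open at the other end but of the same length. *)
Lemma lebesgue_measure_opp (A : set R') : measurable A ->
  leb (-%R @^-1` A) = leb A.
Proof.
move=> mA.
have mf : measurable_fun [set: R'] (-%R : R' -> R').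
  exact: oppr_measurable.
apply/esym; apply: (@lebesgue_measure_unique _ (pushforward_measure leb mf)) => //.
move=> X [[a b] _ <-] /=; rewrite /pushforward_measure/= /pushforward.
rewrite (_ : _ @^-1` _ = `[(- b), (- a)[%classic); last first.
  by apply/seteqP; split => x /=; rewrite !in_itv/= lerNl ltrNr andbC.
rewrite !lebesgue_measure_itv/= !lte_fin ltrN2.
by case: ifPn => // _; rewrite -!EFinB; congr EFin; ring.
Qed.

End lebesgue_line.

Section lebesgue_box.
Context {R : realType}.
Local Notation R' := (measurableTypeR R).
Local Notation leb := (@lebesgue_measure R).

Definition tuple_add n (v t : n.-tuple R') : n.-tuple R' :=
  [tuple tnth v i + tnth t i | i < n].

Lemma measurable_tuple_add n (v : n.-tuple R') :
  measurable_fun setT (tuple_add v).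
Proof.
apply/measurable_fun_tnthP => i.
rewrite (_ : _ \o _ = fun t => tnth v i + tnth t i).
  by apply: measurable_funD => //; exact: measurable_tnth.
by apply/funext => t /=; rewrite tnth_mktuple.
Qed.

(** The translation acts separately on the head and on the tail. The image of the product measure
    therefore agrees with it on rectangles, by the line case and the induction hypothesis, and a
    product measure is determined by rectangles. *)
Lemma lebesgue_tuple_translate n (v : n.-tuple R') (A : set (n.-tuple R')) :
  measurable A -> lebesgue_tuple n (tuple_add v @^-1` A) = lebesgue_tuple n A.
Proof.
elim: n v A => [|n IH] v A mA.
  congr (lebesgue_tuple 0 _); apply/funext => t.
  by rewrite /preimage/= (tuple0 t) (tuple0 (tuple_add _ _)).
rewrite /= /lebesgue_cons /pushforward.
set C := fun x : R' * n.-tuple R' => _.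
have mC : measurable_fun setT C by exact: measurable_cons.
pose v' : n.-tuple R' := [tuple of behead v].
pose F (x : R' * n.-tuple R') := (thead v + x.1 : R', tuple_add v' x.2).
have mF : measurable_fun setT F.
  apply/measurable_fun_pairP; split.
    by apply: measurable_funD => //; exact: measurable_fst.
  exact: (measurableT_comp (measurable_tuple_add v') measurable_snd).
rewrite (_ : C @^-1` _ = F @^-1` (C @^-1` A)); last first.
  apply/funext => -[x t] /=; rewrite /preimage/=; congr (A _).
  apply: eq_from_tnth => i; rewrite tnth_mktuple /C/F/=.
  case: (unliftP ord0 i) => [j ->|->].
    rewrite !tnthS tnth_mktuple; congr (_ + _).
    by rewrite [in LHS](tuple_eta v) tnthS.
  by rewrite !tnth0.
set m' := pushforward_measure (leb \x lebesgue_tuple n)%E mF.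
apply/esym; apply: (@product_measure_unique _ _ _ _ _ leb (lebesgue_tuple n) m').
  2: by rewrite -[C @^-1` A]setTI; exact: (mC measurableT _ mA).
move=> B D mB mD; rewrite /m'/= /pushforward.
rewrite (_ : _ @^-1` _ = ((fun x : R' => thead v + x) @^-1` B) `*`
    (tuple_add v' @^-1` D))//.
rewrite product_measure1E//; last 2 first.
- by rewrite -[X in measurable X]setTI; apply: measurable_funD.
- by rewrite -[X in measurable X]setTI; exact: measurable_tuple_add.
by congr (_ * _)%E; [exact: lebesgue_measure_translate|exact: IH].
Qed.

Lemma lebesgue_tuple_box n (r : R) : 0 <= r ->
  lebesgue_tuple n [set t : n.-tuple R' | forall i, `|tnth t i| <= r] =
  ((2 * r) ^+ n)%:E.
Proof.
move=> r0; elim: n => [|n IH].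
  rewrite /= expr0 diracE mem_set//= => i; by have := ltn_ord i.
rewrite /= /lebesgue_cons /pushforward.
rewrite (_ : _ @^-1` _ = `[(- r), r]%classic `*`
    [set t : n.-tuple R' | forall i, `|tnth t i| <= r]); last first.
  apply/seteqP; split => -[x t] /=; rewrite in_itv/= -ler_norml.
    move=> H; split; first by have := H ord0; rewrite tnth0.
    by move=> i; have := H (lift ord0 i); rewrite tnthS.
  by move=> [H1 H2] i; case: (unliftP ord0 i) => [j ->|->]; rewrite ?tnthS ?tnth0.
rewrite product_measure1E//; last first.
  rewrite (_ : [set t | _] = \bigcap_(i in [set: 'I_n])
     ((fun t : n.-tuple R' => tnth t i) @^-1` `[(- r), r]%classic)).
    apply: fin_bigcap_measurable; first exact: finite_finset.
    move=> i _; rewrite -[X in measurable X]setTI; apply: measurable_tnth => //.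
  apply/seteqP; split => t /=.
    by move=> H i _ /=; rewrite in_itv/= -ler_norml.
  by move=> H i; have := H i I; rewrite /= in_itv/= -ler_norml.
have lebE : leb `[(- r), r]%classic = (2 * r)%:E.
  rewrite lebesgue_measure_itv/= lte_fin; case: ltP => [_|?].
    by rewrite -EFinB; congr EFin; ring.
  by congr EFin; lra.
by rewrite exprS EFinM; congr (_ * _)%E; [exact: lebE|exact: IH].
Qed.

End lebesgue_box.

Section lebesgue_space.
Context {R : realType} {n : nat}.
Local Notation R' := (measurableTypeR R).
Local Notation V := 'cV[R]_n.

(** The sigma-algebra on column vectors is generated by open sets; coordinatewise measurability is
    transferred to it by factoring [f] through tuples and [col_tuple]. *)
Lemma measurable_fun_cV d (T : measurableType d) (f : T -> V) :
  (forall i, measurable_fun setT (fun x => f x i ord0)) -> measurable_fun setT f.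
Proof.
move=> mf.
rewrite (_ : f = @col_tuple R n \o fun x => [tuple (f x i ord0 : R') | i < n]).
  apply: measurableT_comp; first exact: (@measurable_col_tuple R n).
  apply/measurable_fun_tnthP => i.
  rewrite (_ : _ \o _ = fun x => f x i ord0); first exact: mf.
  by apply/funext => t /=; rewrite tnth_mktuple.
apply/funext => x; apply/colP => i; by rewrite /= mxE tnth_mktuple.
Qed.

Lemma measurable_coord d (T : measurableType d) (f : T -> V) i :
  measurable_fun setT f -> measurable_fun setT (fun x => f x i ord0).
Proof.
move=> mf; apply: (@measurableT_comp _ _ _ _ _ _ (fun x : V => x i ord0)) => //.
by apply: measurable_fun_continuous => x; exact: coord_continuous.
Qed.

Lemma measurable_addv d (T : measurableType d) (f g : T -> V) :
  measurable_fun setT f -> measurable_fun setT g ->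
  measurable_fun setT (fun x => f x + g x).
Proof.
move=> mf mg; apply: measurable_fun_cV => i.
rewrite (_ : (fun x => _) = fun x => f x i ord0 + g x i ord0); last first.
  by apply/funext => x; rewrite mxE.
by apply: measurable_funD; exact: measurable_coord.
Qed.

Lemma measurable_oppv d (T : measurableType d) (f : T -> V) :
  measurable_fun setT f -> measurable_fun setT (fun x => - f x).
Proof.
move=> mf; apply: measurable_fun_cV => i.
rewrite (_ : (fun x => _) = fun x => - f x i ord0); last first.
  by apply/funext => x; rewrite mxE.
apply: measurableT_comp => //; exact: measurable_coord.
Qed.

Lemma lebesgue_cV_translate (v : V) (A : set V) : measurable A ->
  lebesgue_cV ((fun x => v + x) @^-1` A) = lebesgue_cV A.
Proof.
move=> mA; rewrite /lebesgue_cV /pushforward.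
pose t : n.-tuple R' := [tuple v i ord0 | i < n].
rewrite -[RHS](lebesgue_tuple_translate t); last first.
  by rewrite -[X in measurable X]setTI; exact: (@measurable_col_tuple R n).
congr (lebesgue_tuple n _); apply/funext => u; rewrite /preimage/=; congr (A _).
by apply/colP => i; rewrite !mxE !tnth_mktuple.
Qed.

(** The closed ball of the sup norm: of explicit measure and compact, it serves to exhaust the
    space, to normalise measures and to dominate functions of compact support. *)
Definition box (r : R) : set V := [set x | forall i, `|x i ord0| <= r].

Lemma measurable_box r : measurable (box r).
Proof.
rewrite (_ : box r = \bigcap_(i in [set: 'I_n])
    ((fun x : V => x i ord0) @^-1` `[(- r), r]%classic)).
  apply: fin_bigcap_measurable; first exact: finite_finset.
  move=> i _; rewrite -[X in measurable X]setTI.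
  by apply: (@measurable_coord _ _ id i) => //; exact: measurable_id.
apply/seteqP; split => t /=.
  by move=> H i _ /=; rewrite in_itv/= -ler_norml.
by move=> H i; have := H i I; rewrite /= in_itv/= -ler_norml.
Qed.

Lemma lebesgue_cV_box r : 0 <= r -> lebesgue_cV (box r) = ((2 * r) ^+ n)%:E.
Proof.
move=> r0; rewrite -(lebesgue_tuple_box n r0) /lebesgue_cV /pushforward.
congr (lebesgue_tuple n _); apply/funext => u; rewrite /preimage/= /box/=.
by apply/propext; split => H i; have := H i; rewrite mxE.
Qed.

Lemma bigcup_box : [set: V] = \bigcup_k box k%:R.
Proof.
apply/esym; rewrite -subTset => x _.
exists (Num.truncn (\sum_i `|x i ord0|)).+1 => //= i.
apply: (@le_trans _ _ (\sum_i `|x i ord0|)).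
  by rewrite (bigD1 i)//= lerDl sumr_ge0.
exact/ltW/truncnS_gt.
Qed.

Lemma sigma_finite_lebesgue_cV : sigma_finite setT (@lebesgue_cV R n).
Proof.
exists (fun k => box k%:R); first exact: bigcup_box.
by move=> k; split; [exact: measurable_box|rewrite lebesgue_cV_box// ltry].
Qed.

HB.instance Definition _ := @Measure_isSigmaFinite.Build _ _ _
  (@lebesgue_cV R n) sigma_finite_lebesgue_cV.

(* Evaluate the integral of [1_A(x + y) 1_B(y)] against [mu(dx) lambda(dy)] in
   both orders. *)
Lemma translation_invariant_unique (mu : {sigma_finite_measure set V -> \bar R})
    (A B : set V) :
  (forall (v : V) (C : set V), measurable C -> mu ((fun x => v + x) @^-1` C) = mu C) ->
  measurable A -> measurable B ->
  (mu A * lebesgue_cV B = lebesgue_cV A * mu (-%R @^-1` B))%E.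
Proof.
move=> muT mA mB.
have mop (C : set V) : measurable C -> measurable (-%R @^-1` C).
  move=> mC; rewrite -[X in measurable X]setTI.
  by apply: (@measurable_oppv _ _ id) => //; exact: measurable_id.
pose f (z : V * V) : \bar R := (\1_A (z.1 + z.2) * \1_B z.2)%:E.
have mf : measurable_fun setT f.
  apply/measurable_EFinP; apply: measurable_funM.
    apply: (@measurableT_comp _ _ _ _ _ _ (\1_A : V -> R)); first exact: measurable_indic.
    by apply: measurable_addv; [exact: measurable_fst|exact: measurable_snd].
  apply: (@measurableT_comp _ _ _ _ _ _ (\1_B : V -> R)); first exact: measurable_indic.
  exact: measurable_snd.
pose g (z : V * V) : \bar R := (\1_A z.2 * \1_B (- z.1 + z.2))%:E.
have mg : measurable_fun setT g.
  apply/measurable_EFinP; apply: measurable_funM.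
    apply: (@measurableT_comp _ _ _ _ _ _ (\1_A : V -> R)); first exact: measurable_indic.
    exact: measurable_snd.
  apply: (@measurableT_comp _ _ _ _ _ _ (\1_B : V -> R)); first exact: measurable_indic.
  apply: measurable_addv; [|exact: measurable_snd].
  by apply: measurable_oppv; exact: measurable_fst.
have f0 z : (0 <= f z)%E by rewrite lee_fin mulr_ge0.
have g0 z : (0 <= g z)%E by rewrite lee_fin mulr_ge0.
have intE (m : {measure set V -> \bar R}) (C : set V) : measurable C ->
    (\int[m]_x (\1_C x)%:E = m C)%E.
  by move=> mC; rewrite integral_indic// setIT.
have intZ (m : {measure set V -> \bar R}) (k : \bar R) (C : set V) :
    (0 <= k)%E -> measurable C -> (\int[m]_x (k * (\1_C x)%:E) = k * m C)%E.
  move=> k0 mC; rewrite ge0_integralZl ?intE//.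
  exact/measurable_EFinP/measurable_indic.
have mtr v (C : set V) : measurable C -> measurable ((fun x => v + x) @^-1` C).
  move=> mC; rewrite -[X in measurable X]setTI.
  exact: (@measurable_addv _ _ (cst v) id).
(* Integrating over [x] first gives [mu (A - y) 1_B(y)], and [mu (A - y) = mu A] by invariance. *)
transitivity (\int[mu \x lebesgue_cV]_z f z)%E.
  rewrite (fubini_tonelli2 _ mf f0).
  transitivity (\int[lebesgue_cV]_y (mu A * (\1_B y)%:E))%E.
    by rewrite intZ.
  apply: eq_integral => y _; rewrite /fubini_G /f/=.
  under eq_integral do rewrite mulrC EFinM.
  have E : (fun x => (\1_A (x + y))%:E) =
           (fun x => (\1_((fun x => y + x) @^-1` A) x)%:E) :> (V -> \bar R).
    by apply/funext => x; rewrite addrC !indicE.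
  rewrite (eq_integral (fun x => (\1_B y)%:E *
      (\1_((fun x => y + x) @^-1` A) x)%:E)%E); last first.
    by move=> x _; congr (_ * _)%E; exact: (congr1 (@^~ x) E).
  by rewrite intZ; [rewrite muleC; congr (_ * _)%E; exact/esym/muT|rewrite lee_fin|exact: mtr].
(* For fixed [x], the substitution of [-x + y] for [y] in the inner Lebesgue integral turns [f] into
   [g]. *)
transitivity (\int[mu \x lebesgue_cV]_z g z)%E.
  rewrite (fubini_tonelli1 _ mf f0) (fubini_tonelli1 _ mg g0); apply: eq_integral => x _; rewrite /fubini_F /f/g/=.
  have E : (fun y => (\1_A (x + y) * \1_B y)%:E) =
           (fun y => (\1_((fun y => x + y) @^-1` A `&` B) y)%:E) :> (V -> \bar R).
    by apply/funext => y; rewrite indicI !indicE.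
  have E' : (fun y => (\1_A y * \1_B (- x + y))%:E) =
           (fun y => (\1_(A `&` (fun y => - x + y) @^-1` B) y)%:E) :> (V -> \bar R).
    by apply/funext => y; rewrite indicI !indicE.
  rewrite E E' !intE; last 2 first.
  - by apply: measurableI => //; exact: mtr.
  - by apply: measurableI => //; exact: mtr.
  rewrite -[RHS](lebesgue_cV_translate x); last first.
    by apply: measurableI => //; exact: mtr.
  congr (lebesgue_cV _); apply/seteqP.
  by split => y /=; rewrite /preimage/= addrA addNr add0r.
(* Now [x] is integrated first: the points [x] with [y - x] in [B] form the translate by [y] of
   [-B], so invariance of [mu] applies again. *)
rewrite (fubini_tonelli2 _ mg g0).
transitivity (\int[lebesgue_cV]_y (mu (-%R @^-1` B) * (\1_A y)%:E))%E; last first.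
  by rewrite intZ// muleC.
apply: eq_integral => y _; rewrite /fubini_G /g/=.
under eq_integral do rewrite EFinM.
have E : (fun x => (\1_B (- x + y))%:E) =
   (fun x => (\1_((fun x => - y + x) @^-1` (-%R @^-1` B)) x)%:E) :> (V -> \bar R).
  apply/funext => x; have -> : - x + y = - (- y + x) by rewrite opprD opprK addrC.
  by rewrite !indicE.
rewrite (eq_integral (fun x => (\1_A y)%:E *
    (\1_((fun x => - y + x) @^-1` (-%R @^-1` B)) x)%:E)%E); last first.
  by move=> x _; congr (_ * _)%E; exact: (congr1 (@^~ x) E).
rewrite intZ; [|by rewrite lee_fin|by apply: mtr; apply: mop].
rewrite muleC; congr (_ * _)%E.
by apply: muT; apply: mop.
Qed.

End lebesgue_space.

(** * Positive factors in integrals of arbitrary functions *)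

Section integral_scaling.
Local Open Scope ereal_scope.
Context d (T : measurableType d) (R : realType) (mu : {measure set T -> \bar R}).
Import HBNNSimple.

(** This covers [+oo - +oo] as well: its conventional value is infinite and is fixed by a positive
    factor. *)
Lemma pmuleBr (k : R) (x y : \bar R) : (0 < k)%R ->
  k%:E * (x - y) = k%:E * x - k%:E * y.
Proof.
move=> k0; have kE : 0 < k%:E by rewrite lte_fin.
move: x y => [x| |] [y| |]; rewrite /= ?gt0_muley ?gt0_muleNy//=;
  rewrite ?(addeNy, addNye, addye, addey, addeNy)//= ?gt0_muley ?gt0_muleNy//.
by rewrite -EFinB -!EFinM -EFinB mulrBr.
Qed.

(* The integral of a nonnegative function, measurable or not, is a supremum over
   the simple functions below it. *)
Lemma ge0_le_integral_sup (D : set T) (f g : T -> \bar R) :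
  (forall x, D x -> 0 <= f x) -> (forall x, D x -> f x <= g x) ->
  \int[mu]_(x in D) f x <= \int[mu]_(x in D) g x.
Proof.
move=> f0 fg; rewrite !ge0_integralE//; last first.
  by move=> x Dx; exact: le_trans (f0 _ Dx) (fg _ Dx).
apply: ereal_sup_le => _ [h hf <-]; exists h => // x.
by apply: le_trans (hf x) _; exact: lee_restrict.
Qed.

(** Scaling a simple function below [f] yields one below [k f], which gives one inequality; the
    other is this inequality for the factor [k^-1] and the function [k f]. *)
Lemma ge0_integralZl_sup (D : set T) (k : R) (f : T -> \bar R) : (0 < k)%R ->
  (forall x, D x -> 0 <= f x) ->
  \int[mu]_(x in D) (k%:E * f x) = k%:E * \int[mu]_(x in D) f x.
Proof.
have main (c : R) (g : T -> \bar R) : (0 < c)%R -> (forall x, D x -> 0 <= g x) ->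
    c%:E * \int[mu]_(x in D) g x <= \int[mu]_(x in D) (c%:E * g x).
  move=> c0 g0; rewrite -lee_pdivlMl// [leLHS]ge0_integralE//.
  apply: ge_ereal_sup => _ [h /= hg <-].
  rewrite lee_pdivlMl// -sintegralrM ge0_integralE; last first.
    by move=> x Dx; apply: mule_ge0; [rewrite lee_fin ltW|exact: g0].
  apply: ereal_sup_ubound; exists (scale_nnsfun h (ltW c0)) => //= x.
  have := hg x; rewrite !patchE; case: ifPn => _ hgx.
    by rewrite EFinM; apply: lee_wpmul2l => //; rewrite lee_fin ltW.
  rewrite EFinM; apply: mule_ge0_le0 => //; by rewrite lee_fin ltW.
move=> k0 f0; apply/eqP; rewrite eq_le main// andbT.
rewrite -lee_pdivrMl//; apply: le_trans (main _ _ _ _) _ => //.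
- by rewrite invr_gt0.
- by move=> x Dx; apply: mule_ge0; [rewrite lee_fin ltW|exact: f0].
- apply: ge0_le_integral_sup => x Dx.
    by rewrite muleA -EFinM mulVf ?gt_eqF// mul1e f0.
  by rewrite muleA -EFinM mulVf ?gt_eqF// mul1e.
Qed.

(** Meant for cost lengths, whose integrand along a general curve comes with no measurability;
    positive and negative parts scale separately. *)
Lemma integral_pZl (D : set T) (k : R) (f : T -> \bar R) : (0 < k)%R ->
  \int[mu]_(x in D) (k%:E * f x) = k%:E * \int[mu]_(x in D) f x.
Proof.
move=> k0; rewrite integralE [in RHS]integralE pmuleBr//.
have kmax (y z : \bar R) : k%:E * maxe y z = maxe (k%:E * y) (k%:E * z).
  by rewrite maxe_pMr// lee_fin ltW.
rewrite -!ge0_integralZl_sup//.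
congr (_ - _); apply: eq_integral => x _.
  by rewrite !funeposE kmax mule0.
by rewrite !funenegE kmax mule0 muleN.
Qed.

End integral_scaling.

Section similarity_inverse.
Context {R : realType} {n : nat}.
Implicit Types S : similarity R n.

Lemma sim_scale_neq0 S : sim_scale S != 0.
Proof. by rewrite gt_eqF// sim_scale_gt0. Qed.

Lemma sim_rot_orthC S : sim_rot S *m (sim_rot S)^T = 1%:M.
Proof. exact/mulmx1C/sim_rot_orth. Qed.

Lemma sim_inv_orth S : (sim_rot S)^T^T *m (sim_rot S)^T = 1%:M.
Proof. by rewrite trmxK sim_rot_orthC. Qed.

Lemma sim_inv_gt0 S : 0 < (sim_scale S)^-1.
Proof. by rewrite invr_gt0 sim_scale_gt0. Qed.

Definition sim_inv S : similarity R n :=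
  MkSimilarity (- (sim_scale S)^-1 *: ((sim_rot S)^T *m sim_shift S))
    (sim_inv_gt0 S) (sim_inv_orth S).

Lemma simK S : cancel S (sim_inv S).
Proof.
move=> x; rewrite /sim_fun/= mulmxDr -scalemxAr mulmxA sim_rot_orth mul1mx.
by rewrite scalerDr scalerA mulVf ?sim_scale_neq0// scale1r scaleNr addrK.
Qed.

Lemma sim_invK S : cancel (sim_inv S) S.
Proof.
move=> x; rewrite /sim_fun/= mulmxDr -!scalemxAr !mulmxA sim_rot_orthC !mul1mx.
rewrite scalerDr !scalerA mulfV ?sim_scale_neq0// scale1r mulrN.
by rewrite mulfV ?sim_scale_neq0// scaleN1r subrK.
Qed.

Lemma sqnorm_ge0 (x : 'cV[R]_n) : 0 <= sqnorm x.
Proof. by rewrite sumr_ge0// => i _; rewrite sqr_ge0. Qed.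

Lemma sqnormE (x : 'cV[R]_n) : sqnorm x = (x^T *m x) ord0 ord0.
Proof. by rewrite mxE; apply: eq_bigr => i _; rewrite mxE expr2. Qed.

Lemma sqnorm_orth (M : 'M[R]_n) (x : 'cV[R]_n) : M^T *m M = 1%:M ->
  sqnorm (M *m x) = sqnorm x.
Proof. by move=> MM; rewrite !sqnormE trmx_mul mulmxA -[_ *m _ *m M]mulmxA MM mulmx1. Qed.

Lemma sqnormZ (c : R) (x : 'cV[R]_n) : sqnorm (c *: x) = c ^+ 2 * sqnorm x.
Proof. by rewrite /sqnorm mulr_sumr; apply: eq_bigr => i _; rewrite mxE exprMn. Qed.

Lemma sqnormN (x : 'cV[R]_n) : sqnorm (- x) = sqnorm x.
Proof. by rewrite -scaleN1r sqnormZ sqrrN expr1n mul1r. Qed.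

Lemma sqnorm_simB S (x y : 'cV[R]_n) :
  sqnorm (S x - S y) = sim_scale S ^+ 2 * sqnorm (x - y).
Proof.
rewrite /sim_fun opprD addrACA subrr addr0 -scalerBr sqnormZ -mulmxBr.
by rewrite sqnorm_orth// sim_rot_orth.
Qed.

(** The fields besides the set function are proofs, hence irrelevant. Leibniz equality, finer than
    [same_measure], is what allows [push_simK] to be used as a rewriting rule inside [W2], [J] and
    distances. *)
Lemma probability_ext (p q : probability 'cV[R]_n R) :
  (p : set _ -> _) = q -> p = q.
Proof.
case: p q => [p cp] [q cq] /= pq; move: cp cq; rewrite {}pq => cp cq.
congr Probability.Pack.
case: cp => -[p1 p2] [p3] [p4] [p5] [p6] [p7] [p8].
case: cq => -[q1 q2] [q3] [q4] [q5] [q6] [q7] [q8].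
by move: (Prop_irrelevance p1 q1) (Prop_irrelevance p2 q2) (Prop_irrelevance p3 q3)
  (Prop_irrelevance p4 q4) (Prop_irrelevance p5 q5) (Prop_irrelevance p6 q6)
  (Prop_irrelevance p7 q7) (Prop_irrelevance p8 q8) => *; subst.
Qed.

Lemma P2_ext (p q : P2 R n) : (p : set _ -> _) = q -> p = q.
Proof.
case: p q => p Ip [q Iq] /= /probability_ext pq; subst.
by congr MkP2; exact: Prop_irrelevance.
Qed.

Lemma push_simK S (p : P2 R n) : push (sim_inv S) (push S p) = p.
Proof.
apply: P2_ext; apply/funext => A; rewrite /push/= /distribution /pushforward.
by congr (P2_prob p _); apply/funext => x; rewrite /preimage/= simK.
Qed.

Lemma push_sim_invK S (p : P2 R n) : push S (push (sim_inv S) p) = p.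
Proof.
apply: P2_ext; apply/funext => A; rewrite /push/= /distribution /pushforward.
by congr (P2_prob p _); apply/funext => x; rewrite /preimage/= sim_invK.
Qed.

Lemma pushE S (p : P2 R n) (A : set 'cV[R]_n) : push S p A = p (S @^-1` A).
Proof. by []. Qed.

Lemma measurable_sim_preimage S (A : set 'cV[R]_n) :
  measurable A -> measurable (S @^-1` A).
Proof. by move=> mA; rewrite -[X in measurable X]setTI; exact: measurable_sim. Qed.

Lemma measurable_comp_sim S d (T : measurableType d) (f : 'cV[R]_n -> T) :
  measurable_fun setT f -> measurable_fun setT (f \o S).
Proof. by move=> mf; exact: (measurableT_comp mf (measurable_sim S)). Qed.

Lemma integral_push S (p : P2 R n) (f : 'cV[R]_n -> \bar R) :
  measurable_fun setT f -> (forall x, 0 <= f x)%E ->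
  (\int[push S p]_x f x = \int[p]_x f (S x))%E.
Proof. by move=> mf f0; rewrite ge0_integral_distribution. Qed.

End similarity_inverse.

Section lebesgue_similarity.
Context {R : realType} {n : nat}.
Local Notation V := 'cV[R]_n.

(** The image of Lebesgue measure under an additive bijection [f] is again translation invariant,
    since a shift by [v] corresponds to a shift by [g v] before applying [f]. The set [B] is left
    free: it is the test set that reveals the factor. *)
Lemma lebesgue_cV_additive (f g : V -> V) (A B : set V) :
  {morph f : x y / x + y} -> cancel f g -> cancel g f ->
  measurable_fun setT f -> measurable_fun setT g ->
  measurable A -> measurable B ->
  (lebesgue_cV (f @^-1` A) * lebesgue_cV B =
   lebesgue_cV A * lebesgue_cV (f @^-1` (-%R @^-1` B)))%E.
Proof.
move=> fD fK gK mf mg mA mB.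
pose mu := pushforward_measure (@lebesgue_cV R n) mf.
have sf : sigma_finite setT mu.
  exists (fun k => g @^-1` box k%:R).
    by rewrite -preimage_bigcup -bigcup_box preimage_setT.
  move=> k; split.
    by rewrite -[X in measurable X]setTI; apply: mg => //; exact: measurable_box.
  have -> : mu (g @^-1` box k%:R) = lebesgue_cV (box k%:R : set V).
    congr (lebesgue_cV _); apply/funext => x; rewrite /preimage/=.
    by congr (box _ _); exact: fK.
  by rewrite lebesgue_cV_box// ltry.
pose sf_mixin := @Measure_isSigmaFinite.Build _ _ _ mu sf.
pose mu' : {sigma_finite_measure set V -> \bar R} := HB.pack (mu : set V -> \bar R) mu sf_mixin.
apply: (@translation_invariant_unique _ _ mu') => // v C mC.
rewrite /mu'/= /pushforward -[RHS](lebesgue_cV_translate (g v)); last first.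
  by rewrite -[X in measurable X]setTI; exact (mf measurableT C mC).
by congr (lebesgue_cV _); apply/funext => x; rewrite /preimage/= fD gK.
Qed.

Lemma measurable_mulmx (M : 'M[R]_n) : measurable_fun setT (fun x : V => M *m x).
Proof.
apply: measurable_fun_cV => i; apply: measurable_fun_continuous.
exact: continuous_coord_mul.
Qed.

Lemma measurable_scalev (c : R) : measurable_fun setT (fun x : V => c *: x).
Proof.
rewrite (_ : (fun x => _) = fun x : V => c%:M *m x); first exact: measurable_mulmx.
by apply/funext => x; rewrite mul_scalar_mx.
Qed.

(** The test set is [box 1], symmetric and of measure [2^n]; its preimage is [box c^-1], of measure
    [(2/c)^n]. *)
Lemma lebesgue_cV_scale (c : R) (A : set V) : 0 < c -> measurable A ->
  lebesgue_cV ((fun x => c *: x) @^-1` A) = ((c ^- n)%:E * lebesgue_cV A)%E.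
Proof.
move=> c0 mA; have cN0 : c != 0 by rewrite gt_eqF.
have := @lebesgue_cV_additive (fun x => c *: x) (fun x => c^-1 *: x) A (box 1).
move=> /(_ _ _ _ _ _ mA (measurable_box _)).
rewrite lebesgue_cV_box//.
rewrite (_ : _ @^-1` (_ @^-1` box 1) = box c^-1); last first.
  apply/seteqP; split => x /= H i; have := H i;
  by rewrite !mxE normrN normrM (gtr0_norm c0) -[c^-1]mulr1 ler_pdivlMl.
rewrite lebesgue_cV_box ?invr_ge0 ?ltW// => E.
have : (lebesgue_cV ((fun x : V => c *: x) @^-1` A) * ((2 * 1) ^+ n)%:E =
  lebesgue_cV A * ((2 * c^-1) ^+ n)%:E)%E.
  apply: E.
  - by move=> x y; rewrite scalerDr.
  - by move=> x; rewrite scalerA mulVf// scale1r.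
  - by move=> x; rewrite scalerA mulfV// scale1r.
  - exact: measurable_scalev.
  - exact: measurable_scalev.
rewrite mulr1 exprMn exprVn [in RHS]EFinM [in RHS]muleCA [in RHS]muleC.
have p2 : (2 ^+ n : R) != 0 by rewrite expf_neq0.
have K (x : \bar R) : (x * (2 ^+ n)%:E * ((2 ^+ n : R)^-1)%:E = x)%E.
  by rewrite -muleA -EFinM mulfV// mule1.
by move=> /(congr1 (fun x => x * ((2 ^+ n : R)^-1)%:E)%E); rewrite !K muleC.
Qed.

Definition sqball : set V := [set x | sqnorm x <= 1].

Lemma measurable_sqball : measurable sqball.
Proof.
rewrite (_ : sqball = (@sqnorm R n) @^-1` `]-oo, 1]%classic).
  rewrite -[X in measurable X]setTI; apply: measurable_fun_continuous => //.
  exact: continuous_sqnorm.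
by apply/seteqP; split => x; rewrite /sqball/= in_itv.
Qed.

Lemma sqball_box : sqball `<=` box 1.
Proof.
move=> x; rewrite /sqball/= => xb i.
rewrite -(@ler_pXn2r _ 2)// ?nnegrE// expr1n real_normK ?num_real//.
by apply: le_trans xb; rewrite /sqnorm (bigD1 i)//= lerDl sumr_ge0// => j _; rewrite sqr_ge0.
Qed.

(** The radius [1/(n+1)] avoids a square root: [n / (n+1)^2 <= 1], for [n = 0] too. The two
    inclusions make the measure of the ball positive and finite. *)
Lemma box_sqball : box n.+1%:R^-1 `<=` sqball.
Proof.
move=> x xb; rewrite /sqball/=; apply: (@le_trans _ _ (\sum_(i < n) (n.+1%:R^-1) ^+ 2)).
  apply: ler_sum => i _; have := xb i; rewrite -real_normK ?num_real// => xi.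
  by rewrite ler_pXn2r ?nnegrE// invr_ge0.
rewrite sumr_const card_ord -[leLHS]mulr_natl expr2 mulrA.
have h : n%:R / n.+1%:R <= 1 :> R by rewrite ler_pdivrMr ?ltr0n// mul1r ler_nat.
have h' : (n.+1%:R^-1 : R) <= 1 by rewrite invf_le1 ?ltr0n// ler1n.
by rewrite mulr_ile1 ?divr_ge0 ?invr_ge0.
Qed.

(** The Euclidean ball is symmetric and equal to its preimage under [M], so the unknown factor is
    [1]; its measure may be cancelled because it lies between the measures of two boxes. *)
Lemma lebesgue_cV_orth (M : 'M[R]_n) (A : set V) : M^T *m M = 1%:M -> measurable A ->
  lebesgue_cV ((fun x => M *m x) @^-1` A) = lebesgue_cV A.
Proof.
move=> MM mA; have MM' := mulmx1C MM.
have := @lebesgue_cV_additive (fun x => M *m x) (fun x => M^T *m x) A sqball.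
move=> /(_ _ _ _ _ _ mA measurable_sqball).
rewrite (_ : _ @^-1` (_ @^-1` sqball) = sqball); last first.
  by apply/funext => x; rewrite /preimage/sqball/= sqnormN sqnorm_orth.
have [r r0 rE] : exists2 r : R, r != 0 & lebesgue_cV sqball = r%:E.
  have le1 : (lebesgue_cV sqball <= ((2 * 1 : R) ^+ n)%:E)%E.
    rewrite -lebesgue_cV_box//; apply: le_measure sqball_box; rewrite inE.
    - exact: measurable_sqball.
    - exact: measurable_box.
  have ge1 : (((2 * n.+1%:R^-1 : R) ^+ n)%:E <= lebesgue_cV sqball)%E.
    rewrite -lebesgue_cV_box ?invr_ge0//; apply: le_measure box_sqball; rewrite inE.
    - exact: measurable_box.
    - exact: measurable_sqball.
  have p0 : (0 < ((2 * n.+1%:R^-1 : R) ^+ n)%:E)%E.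
    by rewrite lte_fin exprn_gt0// mulr_gt0// invr_gt0.
  have b0 := lt_le_trans p0 ge1.
  have fb : lebesgue_cV sqball \is a fin_num.
    by rewrite ge0_fin_numE ?ltW// (le_lt_trans le1)// ltry.
  exists (fine (lebesgue_cV sqball)); last by rewrite fineK.
  by rewrite gt_eqF// fine_gt0// b0 ltey_eq fb.
rewrite rE => E.
have : (lebesgue_cV ((fun x : V => M *m x) @^-1` A) * r%:E = lebesgue_cV A * r%:E)%E.
  apply: E.
  - by move=> x y; rewrite mulmxDr.
  - by move=> x; rewrite mulmxA MM mul1mx.
  - by move=> x; rewrite mulmxA MM' mul1mx.
  - exact: measurable_mulmx.
  - exact: measurable_mulmx.
move=> /(congr1 (fun x => x * (r^-1)%:E)%E).
by rewrite -!muleA -!EFinM mulfV// !mule1.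
Qed.

Lemma lebesgue_cV_sim (S : similarity R n) (A : set V) : measurable A ->
  lebesgue_cV (S @^-1` A) = ((sim_scale S ^- n)%:E * lebesgue_cV A)%E.
Proof.
move=> mA.
pose A1 := (fun x => sim_shift S + x) @^-1` A.
have mA1 : measurable A1.
  rewrite -[A1]setTI; apply: measurable_addv => //; exact: measurable_id.
pose A2 := (fun x => sim_scale S *: x) @^-1` A1.
have mA2 : measurable A2 by rewrite -[A2]setTI; exact: measurable_scalev.
rewrite (_ : S @^-1` A = (fun x => sim_rot S *m x) @^-1` A2); last first.
  by apply/funext => x; rewrite /A2 /A1 /preimage/= addrC.
rewrite lebesgue_cV_orth ?sim_rot_orth//.
rewrite lebesgue_cV_scale ?sim_scale_gt0//; congr (_ * _)%E.
exact: lebesgue_cV_translate.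
Qed.

Lemma ge0_integral_sim_preimage (S : similarity R n) (A : set V) (h : V -> \bar R) :
  measurable A -> measurable_fun setT h -> (forall x, 0 <= h x)%E ->
  (\int[lebesgue_cV]_(x in S @^-1` A) h (S x) =
   (sim_scale S ^- n)%:E * \int[lebesgue_cV]_(x in A) h x)%E.
Proof.
move=> mA mh h0.
have k0 : 0 <= sim_scale S ^- n by rewrite invr_ge0 exprn_ge0 ?ltW ?sim_scale_gt0.
rewrite -(@ge0_integral_pushforward _ _ _ _ _ S (measurable_sim S) lebesgue_cV A h)//; last first.
  exact: measurable_funTS.
rewrite (@eq_measure_integral _ _ _ A (mscale (NngNum k0) lebesgue_cV)); last first.
  by move=> B mB _; exact: lebesgue_cV_sim.
by rewrite ge0_integral_mscale//; exact: measurable_funTS.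
Qed.

Lemma ge0_integral_sim (S : similarity R n) (h : V -> \bar R) :
  measurable_fun setT h -> (forall x, 0 <= h x)%E ->
  (\int[lebesgue_cV]_x h (S x) =
   (sim_scale S ^- n)%:E * \int[lebesgue_cV]_x h x)%E.
Proof. by move=> mh h0; rewrite -ge0_integral_sim_preimage. Qed.

Lemma integral_sim (S : similarity R n) (h : V -> \bar R) : measurable_fun setT h ->
  (\int[lebesgue_cV]_x h (S x) =
   (sim_scale S ^- n)%:E * \int[lebesgue_cV]_x h x)%E.
Proof.
move=> mh; rewrite integralE [in RHS]integralE pmuleBr; last first.
  by rewrite invr_gt0 exprn_gt0// sim_scale_gt0.
rewrite -!ge0_integral_sim//; last 2 first.
- exact: measurable_funeneg.
- exact: measurable_funepos.
by congr (_ - _)%E; apply: eq_integral => x _; rewrite ?funeposE ?funenegE.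
Qed.

Lemma integrable_sim (S : similarity R n) (h : V -> \bar R) :
  lebesgue_cV.-integrable setT h -> lebesgue_cV.-integrable setT (h \o S).
Proof.
move=> /integrableP[mh hoo]; apply/integrableP; split.
  exact: measurable_comp_sim.
rewrite (_ : (fun x => _) = fun x => (abse \o h) (S x))//.
rewrite ge0_integral_sim//; [|exact: measurableT_comp|by move=> x; exact: abse_ge0].
by rewrite lte_mul_pinfty// lee_fin invr_ge0 exprn_ge0 ?ltW ?sim_scale_gt0.
Qed.

End lebesgue_similarity.

(** * Adding an integrable function to a possibly non-integrable one *)

Section integral_add.
Local Open Scope ereal_scope.
Context d (T : measurableType d) (R : realType) (mu : {measure set T -> \bar R}).
Implicit Types f g h k : T -> R.

Definition integral_pos g := \int[mu]_x maxe (g x)%:E 0.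

Lemma integral_posE g : \int[mu]_x (g x)%:E = integral_pos g - integral_pos (fun x => - g x)%R.
Proof.
rewrite integralE; congr (_ - _); apply: eq_integral => x _; first by rewrite funeposE.
by rewrite funenegE EFinN.
Qed.

Lemma integral_pos_ge0 g : 0 <= integral_pos g.
Proof. by apply: integral_ge0 => x _; rewrite le_max lexx orbT. Qed.

(** From [f^+ <= g^+ + |k|]: an integrable perturbation does not change whether the positive part
    has finite integral. *)
Lemma integral_pos_pinfty f g k : measurable_fun setT f -> measurable_fun setT g ->
  mu.-integrable setT (EFin \o k) -> (forall x, `|f x - g x| = `|k x|)%R ->
  integral_pos g < +oo -> integral_pos f < +oo.
Proof.
move=> mf mg /integrableP[mk koo] fgk goo.
have mP (u : T -> R) : measurable_fun setT u ->
    measurable_fun setT (fun x => maxe (u x)%:E 0).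
  by move=> mu'; apply: measurable_maxe => //; exact/measurable_EFinP.
have mak : measurable_fun setT (fun x => `|(k x)%:E|).
  exact: (measurableT_comp (@abse_measurable R setT) mk).
apply: (@le_lt_trans _ _ (\int[mu]_x (maxe (g x)%:E 0 + `|(k x)%:E|))).
  apply: ge0_le_integral => //.
  - by move=> x _; rewrite le_max lexx orbT.
  - exact: mP.
  - by apply: emeasurable_funD; [exact: mP|exact: mak].
  - move=> x _; rewrite -!EFin_max abse_EFin -EFinD lee_fin ge_max -fgk.
    have := ler_norm (f x - g x); rewrite lerBlDl => fg.
    apply/andP; split; last by rewrite addr_ge0// le_max lexx orbT.
    by apply: le_trans fg _; rewrite lerD2r le_max lexx.
rewrite ge0_integralD//; last 2 first.
- by move=> x _; rewrite le_max lexx orbT.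
- exact: mP.
by rewrite lte_add_pinfty.
Qed.

Lemma integral_pos_integrable g : measurable_fun setT g ->
  integral_pos g < +oo -> integral_pos (fun x => - g x)%R < +oo ->
  mu.-integrable setT (EFin \o g).
Proof.
move=> mg Pg Ng; apply/integrableP; split; first exact/measurable_EFinP.
rewrite -[fun x => _]/(abse \o (EFin \o g)) fune_abse ge0_integralD//.
- rewrite lte_add_pinfty//; under eq_integral do rewrite ?funeposE ?funenegE -?EFinN.
    exact: Pg.
  exact: Ng.
- exact/measurable_funepos/measurable_EFinP.
- exact/measurable_funeneg/measurable_EFinP.
Qed.

(** Once one of the two parts is infinite, the difference depends only on which of them are
    infinite, and a finite summand does not alter it. *)
Let pinfty_sub (a b a' b' c : \bar R) : 0 <= a -> 0 <= b -> 0 <= a' -> 0 <= b' ->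
  c \is a fin_num -> (a < +oo) = (a' < +oo) -> (b < +oo) = (b' < +oo) ->
  ~~ ((a < +oo) && (b < +oo)) -> a' - b' = a - b + c.
Proof.
by case: a => [a| |]; case: b => [b| |]; case: a' => [a'| |]; case: b' => [b'| |];
  case: c => [c| |]//; rewrite ?ltry.
Qed.

(* Both sides agree also when the integral of [h] is infinite or of the form
   [+oo - oo]. *)
Lemma integral_add_integrable h k : measurable_fun setT h ->
  mu.-integrable setT (EFin \o k) ->
  \int[mu]_x (h x + k x)%:E = \int[mu]_x (h x)%:E + \int[mu]_x (k x)%:E.
Proof.
move=> mh ik; have /integrableP[/measurable_EFinP mk _] := ik.
pose f x := (h x + k x)%R.
have mf : measurable_fun setT f by exact: measurable_funD.
have fhk x : (`|f x - h x| = `|k x|)%R by rewrite /f addrC addKr.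
have hfk x : (`|h x - f x| = `|k x|)%R by rewrite distrC fhk.
have [/andP[hP hN]|] := boolP ((integral_pos h < +oo) && (integral_pos (fun x => - h x)%R < +oo)).
  by rewrite -integralD//; exact: integral_pos_integrable.
have kfin : \int[mu]_x (k x)%:E \is a fin_num by exact: integrable_fin_num ik.
rewrite (integral_posE f) (integral_posE h).
have mN g : measurable_fun setT g -> measurable_fun setT (fun x => - g x)%R.
  by move=> mg; exact: measurable_funN.
apply: (pinfty_sub _ _ _ _ kfin); try exact: integral_pos_ge0.
- apply/idP/idP.
    exact: integral_pos_pinfty ik fhk.
  exact: integral_pos_pinfty ik hfk.
- apply/idP/idP.
    by apply: (integral_pos_pinfty (mN _ mf) (mN _ mh) ik) => x; rewrite opprK addrC hfk.
  by apply: (integral_pos_pinfty (mN _ mh) (mN _ mf) ik) => x; rewrite opprK addrC fhk.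
Qed.

End integral_add.

(** * Entropy and Wasserstein distance of a push-forward *)

Section density_push.
Context {R : realType} {n : nat}.
Local Notation V := 'cV[R]_n.
Implicit Types (S : similarity R n) (p : P2 R n) (f : V -> R).

Definition push_density S f : V -> R :=
  fun y => sim_scale S ^- n * f (sim_inv S y).

Lemma push_densityK S : cancel (push_density S) (push_density (sim_inv S)).
Proof.
move=> f; apply/funext => x; rewrite /push_density/= exprVn invrK mulrA mulfV.
  by rewrite mul1r sim_invK.
by rewrite expf_neq0// sim_scale_neq0.
Qed.

Lemma push_density_invK S : cancel (push_density (sim_inv S)) (push_density S).
Proof.
move=> f; apply/funext => x; rewrite /push_density/= exprVn invrK mulrA mulVf.
  by rewrite mul1r simK.
by rewrite expf_neq0// sim_scale_neq0.
Qed.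

Lemma is_density_push S p f :
  is_density p f -> is_density (push S p) (push_density S f).
Proof.
move=> [mf f0 pf]; split.
- by apply: measurable_funM => //; exact: measurable_comp_sim.
- by move=> x; rewrite mulr_ge0// invr_ge0 exprn_ge0// ltW// sim_scale_gt0.
- move=> A mA; rewrite pushE pf; last exact: measurable_sim_preimage.
  have k0 : 0 < sim_scale S ^- n by rewrite invr_gt0 exprn_gt0// sim_scale_gt0.
  under [RHS]eq_integral do rewrite EFinM.
  rewrite integral_pZl// -(@ge0_integral_sim_preimage _ _ _ _ (EFin \o f \o sim_inv S))//.
  - by apply: eq_integral => x _ /=; rewrite simK.
  - by apply/measurable_EFinP; exact: measurable_comp_sim.
  - by move=> x; rewrite lee_fin.
Qed.

Lemma is_density_pushV S p g : is_density (push S p) g ->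
  is_density p (push_density (sim_inv S) g).
Proof. by move=> /(is_density_push (sim_inv S)); rewrite push_simK. Qed.

Lemma push_density_image S p :
  is_density (push S p) = push_density S @` is_density p.
Proof.
apply/seteqP; split => [g dg|_ [f df <-]]; last exact: is_density_push.
exists (push_density (sim_inv S) g); first exact: is_density_pushV.
exact: push_density_invK.
Qed.

Lemma is_density_integrable p f : is_density p f ->
  lebesgue_cV.-integrable setT (EFin \o f) /\ (\int[lebesgue_cV]_x (f x)%:E = 1)%E.
Proof.
move=> [mf f0 pf]; have I1 : (\int[lebesgue_cV]_x (f x)%:E = 1)%E.
  by rewrite -pf// probability_setT.
split => //; apply/integrableP; split; first exact/measurable_EFinP.
under eq_integral do rewrite /= ger0_norm//.
by rewrite I1 ltry.
Qed.

Lemma measurable_xlnx f : measurable_fun setT f ->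
  measurable_fun setT (fun x => f x * ln (f x)).
Proof.
move=> mf; apply: measurable_funM => //.
by apply: (measurableT_comp _ mf); exact: measurable_ln.
Qed.

(** After the change of variables the integrand is [f ln f - (n ln a) f]. The second term is
    integrable with integral [n ln a], whereas [f ln f] need not be integrable, hence the use of
    [integral_add_integrable]. *)
Lemma entropy_push_density S p f : is_density p f ->
  (- (\int[lebesgue_cV]_x (push_density S f x * ln (push_density S f x))%:E) =
   - (\int[lebesgue_cV]_x (f x * ln (f x))%:E) + (n%:R * ln (sim_scale S))%:E)%E.
Proof.
move=> df; have [mf f0 _] := df; have [intf f1] := is_density_integrable df.
set a := sim_scale S; have a0 : 0 < a by exact: sim_scale_gt0.
have k0 : 0 < a ^- n by rewrite invr_gt0 exprn_gt0.
have lnE x : f x * ln (a ^- n * f x) = f x * ln (f x) + - (n%:R * ln a) * f x.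
  (* The logarithm of a product splits only for positive factors; where [f] vanishes both sides are
     [0]. *)
  have [->|fx0] := eqVneq (f x) 0; first by rewrite !(mul0r, mulr0, addr0).
  rewrite lnM ?posrE// ?lt_neqAle ?f0 ?andbT 1?eq_sym//.
  by rewrite lnV ?posrE ?exprn_gt0// lnXn// -mulr_natl; ring.
pose h y : \bar R := ((a ^- n)%:E * (f y * ln (a ^- n * f y))%:E)%E.
have mh : measurable_fun setT h.
  apply: measurable_funeM; apply/measurable_EFinP/measurable_funM => //.
  apply: (@measurableT_comp _ _ _ _ _ _ (@ln R)); first exact: measurable_ln.
  exact: measurable_funM.
transitivity (- (\int[lebesgue_cV]_y h (sim_inv S y)))%E.
  by congr (- _)%E; apply: eq_integral => y _; rewrite /h -EFinM mulrA.
rewrite integral_sim// integral_pZl//= exprVn invrK muleA -EFinM mulfV; last first.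
  by rewrite expf_neq0// sim_scale_neq0.
rewrite mul1e; under eq_integral do rewrite lnE.
rewrite integral_add_integrable; last 2 first.
- exact: measurable_xlnx.
- rewrite (_ : _ \o _ = fun x => ((- (n%:R * ln a))%:E * (EFin \o f) x)%E).
    exact: integrableZl.
  by apply/funext => x; rewrite /= EFinM.
under [X in (- (_ + X))%E]eq_integral do rewrite EFinM.
rewrite integralZl// f1 mule1 EFinN fin_num_oppeD//.
by rewrite oppeK.
Qed.

Lemma ereal_sup_addr (A : set (\bar R)) (r : R) :
  ereal_sup [set (x + r%:E)%E | x in A] = (ereal_sup A + r%:E)%E.
Proof.
apply/eqP; rewrite eq_le; apply/andP; split.
  by apply: ge_ereal_sup => _ [x Ax <-]; rewrite leeD2r// ereal_sup_ubound.
rewrite -leeBrDr//; apply: ge_ereal_sup => x Ax.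
by rewrite leeBrDr//; apply: ereal_sup_ubound; exists x.
Qed.

(** The densities of [push S p] are exactly the pushed densities of [p], so one supremum runs over
    the shifted values of the other; without density both are [-oo]. *)
Lemma H_push S p : H (push S p) = (H p + (n%:R * ln (sim_scale S))%:E)%E.
Proof.
rewrite /H push_density_image -ereal_sup_addr; congr ereal_sup.
apply/seteqP; split => [_ [_ [f df <-] <-]|_ [_ [f df <-] <-]].
  eexists; first by exists f.
  by rewrite (entropy_push_density _ df).
eexists; first by exists f.
by rewrite (entropy_push_density _ df).
Qed.

Lemma boundary_push S p : boundary (push S p) <-> boundary p.
Proof.
rewrite /boundary/= H_push; split => [|->//].
by case: (H p).
Qed.

End density_push.

Section wasserstein_push.
Context {R : realType} {n : nat}.
Local Notation V := 'cV[R]_n.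
Implicit Types (S : similarity R n) (p q : P2 R n).

Definition prob_image d d' (T : measurableType d) (T' : measurableType d')
    (mu : probability T R) (f : T -> T') (mf : measurable_fun setT f) :
    probability T' R :=
  distribution mu (HB.pack_for {mfun T >-> T'} f (isMeasurableFun.Build _ _ _ _ f mf)).

Lemma ge0_integral_prob_image d d' (T : measurableType d) (T' : measurableType d')
    (mu : probability T R) (f : T -> T') (mf : measurable_fun setT f)
    (h : T' -> \bar R) :
  measurable_fun setT h -> (forall x, 0 <= h x)%E ->
  (\int[prob_image mu mf]_x h x = \int[mu]_x h (f x))%E.
Proof. by move=> mh h0; rewrite ge0_integral_distribution. Qed.

Definition transport_cost (pi : probability (V * V)%type R) : \bar R :=
  (\int[pi]_z (sqnorm (z.1 - z.2))%:E)%E.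

Lemma measurable_sqnormB : measurable_fun setT (fun z : V * V => (sqnorm (z.1 - z.2))%:E).
Proof.
apply/measurable_EFinP.
apply: (@measurableT_comp _ _ _ _ _ _ (@sqnorm R n)).
  by apply: measurable_fun_continuous; exact: continuous_sqnorm.
exact: (measurable_addv measurable_fst (measurable_oppv measurable_snd)).
Qed.

Lemma measurable_map2 S : measurable_fun setT (fun z : V * V => (S z.1, S z.2)).
Proof.
apply/measurable_fun_pairP; split.
- exact: (measurableT_comp (measurable_sim S) measurable_fst).
- exact: (measurableT_comp (measurable_sim S) measurable_snd).
Qed.

Lemma coupling_push S p q pi : coupling p q pi ->
  coupling (push S p) (push S q) (prob_image pi (measurable_map2 S)).
Proof.
move=> cpl A mA; have := cpl _ (measurable_sim_preimage S mA).
by rewrite !pushE.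
Qed.

Lemma transport_cost_push S pi :
  transport_cost (prob_image pi (measurable_map2 S)) =
  ((sim_scale S ^+ 2)%:E * transport_cost pi)%E.
Proof.
rewrite /transport_cost ge0_integral_prob_image; last 2 first.
- exact: measurable_sqnormB.
- by move=> z; rewrite lee_fin sqnorm_ge0.
rewrite -integral_pZl ?exprn_gt0 ?sim_scale_gt0//.
by apply: eq_integral => z _; rewrite sqnorm_simB EFinM.
Qed.

Lemma W2_push_le S p q :
  (ereal_inf (transport_cost @` coupling (push S p) (push S q)) <=
   (sim_scale S ^+ 2)%:E * ereal_inf (transport_cost @` coupling p q))%E.
Proof.
have a0 : 0 < sim_scale S ^+ 2 by rewrite exprn_gt0// sim_scale_gt0.
rewrite -lee_pdivrMl//; apply: le_ereal_inf_tmp => _ [pi cpl <-].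
rewrite lee_pdivrMl// -transport_cost_push; apply: ereal_inf_lbound.
by exists (prob_image pi (measurable_map2 S)) => //; exact: coupling_push.
Qed.

(** At an infinite [x] both sides are [0], the value of [fine] there. *)
Lemma fine_pM (k : R) (x : \bar R) : 0 < k -> fine (k%:E * x) = k * fine x.
Proof.
by move=> k0; case: x => [x| |]//=; rewrite ?gt0_muley ?gt0_muleNy ?lte_fin//= mulr0.
Qed.

Lemma W2_push S p q : W2 (push S p) (push S q) = sim_scale S * W2 p q.
Proof.
have a0 := sim_scale_gt0 S; have a20 : 0 < sim_scale S ^+ 2 by rewrite exprn_gt0.
rewrite /W2 -/transport_cost -[X in X * Num.sqrt _]gtr0_norm// -sqrtr_sqr.
rewrite -sqrtrM ?sqr_ge0// -fine_pM//; congr (Num.sqrt (fine _)).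
apply/eqP; rewrite eq_le W2_push_le/=.
(* Pulling couplings back by the inverse similarity gives the missing inequality. *)
have := W2_push_le (sim_inv S) (push S p) (push S q).
by rewrite !push_simK /= exprVn lee_pdivlMl.
Qed.

Lemma W2_ge0 p q : 0 <= W2 p q.
Proof. exact: sqrtr_ge0. Qed.

(** Scaling by [k != 0] preserves divergence, and a divergent limit has the default value [0]. The
    metric speed thus scales at times where it does not exist as well. *)
Lemma limZ_neq0 (T : Type) (F : set_system T) {FF : ProperFilter F} (k : R) (f : T -> R) :
  k != 0 -> lim (k * f x @[x --> F]) = k * lim (f @ F).
Proof.
move=> k0; have [cf|ncf] := pselect (cvg (f @ F)).
  exact: (@limZl_tmp R R^o T F FF k f cf).
rewrite [X in k * X]dvgP// mulr0 dvgP// => ckf; apply: ncf.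
by move: ckf; rewrite (@is_cvgZlE R R^o T F FF k f k0).
Qed.

Lemma metric_speed_push S (gamma : R -> P2 R n) t :
  metric_speed (fun t => push S (gamma t)) t = sim_scale S * metric_speed gamma t.
Proof.
have E : (fun h => W2 (push S (gamma t)) (push S (gamma (t + h))) / `|h|) =
    (fun h => sim_scale S * (W2 (gamma t) (gamma (t + h)) / `|h|)).
  by apply/funext => h; rewrite W2_push mulrA.
by rewrite /metric_speed E limZ_neq0// sim_scale_neq0.
Qed.

Lemma metric_speed_ge0 (gamma : R -> P2 R n) t : 0 <= metric_speed gamma t.
Proof.
rewrite /metric_speed; set f := fun h => _.
have [cf|ncf] := pselect (cvg (f @ 0^')); last by rewrite dvgP.
apply: limr_ge => //; apply: nearW => h.
by rewrite divr_ge0// W2_ge0.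
Qed.

Lemma AC2_push S T (gamma : R -> P2 R n) :
  AC2 T gamma -> AC2 T (fun t => push S (gamma t)).
Proof.
have a0 := sim_scale_gt0 S; have a20 : 0 < sim_scale S ^+ 2 by rewrite exprn_gt0.
move=> [m [mm moo W]]; exists (fun t => sim_scale S * m t); split.
- exact: measurable_funM.
- under eq_integral do rewrite exprMn EFinM.
  by rewrite integral_pZl// lte_mul_pinfty// lee_fin ltW.
- move=> s t s0 st tT; under eq_integral do rewrite EFinM.
  rewrite W2_push EFinM integral_pZl//.
  by apply: lee_wpmul2l; [rewrite lee_fin ltW|exact: W].
Qed.

End wasserstein_push.

(** * Optimality of affine maps *)

Section optimal_affine.
Context {R : realType} {n : nat}.
Local Notation V := 'cV[R]_n.
Implicit Types (S : similarity R n) (p q : P2 R n).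

Definition dotv (x y : V) : R := \sum_i x i ord0 * y i ord0.

(* A Kantorovich potential pair for the map [S x = a x + b]: by Young's
   inequality [u x + v y] bounds the cost [|x - y|^2] from below, with equality
   on the graph of [S]. *)
Definition potential S (x : V) : R :=
  (1 - sim_scale S) * sqnorm x - 2 * dotv x (sim_shift S).
Definition copotential S (y : V) : R :=
  sqnorm y - (sim_scale S)^-1 * sqnorm (y - sim_shift S).

Lemma sqnormB (x y : V) : sqnorm (x - y) = sqnorm x + sqnorm y - 2 * dotv x y.
Proof.
rewrite /sqnorm /dotv mulr_sumr -big_split -sumrB/=; apply: eq_bigr => i _.
by rewrite !mxE; ring.
Qed.

(** Completing the square, the gap is [a^-1 |a x - (y - b)|^2]. *)
Lemma potential_le S x y : potential S x + copotential S y <= sqnorm (x - y).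
Proof.
rewrite /potential /copotential; set a := sim_scale S; set b := sim_shift S.
have a0 : 0 < a := sim_scale_gt0 S.
rewrite -subr_ge0 (_ : _ - _ = a^-1 * sqnorm (a *: x - (y - b))).
  by apply: mulr_ge0; [rewrite invr_ge0 ltW|exact: sqnorm_ge0].
rewrite [sqnorm (x - y)]sqnormB [sqnorm (a *: x - _)]sqnormB sqnormZ.
have -> : dotv (a *: x) (y - b) = a * dotv x y - a * dotv x b.
  rewrite /dotv !mulr_sumr -sumrB; apply: eq_bigr => i _; rewrite !mxE; ring.
by field; rewrite gt_eqF.
Qed.

Lemma potential_eq S x : sim_rot S = 1%:M ->
  potential S x + copotential S (S x) = sqnorm (x - S x).
Proof.
move=> S1; rewrite /potential /copotential /sim_fun S1 mul1mx addrK.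
set a := sim_scale S; set b := sim_shift S.
have aN0 : a != 0 := sim_scale_neq0 S.
rewrite sqnormZ [in RHS]sqnormB.
have -> : dotv x (a *: x + b) = a * sqnorm x + dotv x b.
  rewrite /dotv /sqnorm mulr_sumr -big_split/=; apply: eq_bigr => i _; rewrite !mxE; ring.
by field.
Qed.

Lemma continuous_dotv (b : V) : continuous (fun x : V => dotv x b).
Proof.
apply: (continuous_big (@add_continuous R)) => i _ x.
by apply: (@cvgMr_tmp R _ _ (nbhs_filter x)); exact: coord_continuous.
Qed.

Lemma integrable_sqnorm p : p.-integrable setT (fun x => (sqnorm x)%:E).
Proof.
apply/integrableP; split.
  by apply/measurable_EFinP; apply: measurable_fun_continuous; exact: continuous_sqnorm.
by under eq_integral do rewrite gee0_abs ?lee_fin ?sqnorm_ge0//; exact: P2_moment.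
Qed.

(** At most quadratic growth is controlled by the second moment, so both potentials are integrable
    against every element of [P2]. *)
Lemma integrable_quadratic p (f : V -> R) (c d : R) : 0 <= c -> 0 <= d ->
  measurable_fun setT f -> (forall x, `|f x| <= c * sqnorm x + d) ->
  p.-integrable setT (EFin \o f).
Proof.
move=> c0 d0 mf fle; apply: (@le_integrable _ _ _ _ _ _ _
    (fun x => (c%:E * (sqnorm x)%:E + (cst d%:E) x)%E)) => //.
- exact/measurable_EFinP.
- move=> x _; rewrite -EFinM -EFinD /= lee_fin (le_trans (fle x))// ler_norm//.
- apply: integrableD => //; first by apply: integrableZl => //; exact: integrable_sqnorm.
  exact: finite_measure_integrable_cst.
Qed.

Lemma dotv_le (x b : V) : `|2 * dotv x b| <= sqnorm x + sqnorm b.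
Proof.
have h1 := sqnorm_ge0 (x - b); have h2 := sqnorm_ge0 (x - - b).
rewrite sqnormB in h1; rewrite sqnormB sqnormN in h2.
have E : dotv x (- b) = - dotv x b.
  by rewrite /dotv -sumrN; apply: eq_bigr => i _; rewrite mxE mulrN.
rewrite E in h2; rewrite ler_norml; apply/andP; split; lra.
Qed.

Lemma integrable_potential S p : p.-integrable setT (EFin \o potential S).
Proof.
apply: (@integrable_quadratic _ _ (`|1 - sim_scale S| + 1) (sqnorm (sim_shift S))).
- by rewrite addr_ge0.
- exact: sqnorm_ge0.
- apply: measurable_funB; apply: measurable_funM => //; apply: measurable_fun_continuous.
    exact: continuous_sqnorm.
  exact: continuous_dotv.
- move=> x; rewrite /potential; apply: le_trans (ler_normB _ _) _.
  rewrite normrM (ger0_norm (sqnorm_ge0 x)).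
  by have := dotv_le x (sim_shift S); lra.
Qed.

Lemma integrable_copotential S p : p.-integrable setT (EFin \o copotential S).
Proof.
have a0 : 0 < sim_scale S := sim_scale_gt0 S.
have ai0 : 0 < (sim_scale S)^-1 by rewrite invr_gt0.
apply: (@integrable_quadratic _ _ (1 + 2 * (sim_scale S)^-1)
  (2 * (sim_scale S)^-1 * sqnorm (sim_shift S))).
- by rewrite addr_ge0// mulr_ge0// ltW.
- by rewrite mulr_ge0 ?sqnorm_ge0// mulr_ge0// ltW.
- apply: measurable_funB.
    by apply: measurable_fun_continuous; exact: continuous_sqnorm.
  apply: measurable_funM => //.
  apply: (@measurableT_comp _ _ _ _ _ _ (@sqnorm R n)).
    by apply: measurable_fun_continuous; exact: continuous_sqnorm.
  by apply: measurable_addv => //; exact: measurable_id.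
- move=> x; rewrite /copotential; apply: le_trans (ler_normB _ _) _.
  rewrite normrM !ger0_norm ?sqnorm_ge0 ?(ltW ai0)//.
  have : sqnorm (x - sim_shift S) <= 2 * sqnorm x + 2 * sqnorm (sim_shift S).
    by rewrite sqnormB; have := dotv_le x (sim_shift S); rewrite ler_norml => /andP[]; lra.
  move=> /(ler_wpM2l (ltW ai0)); lra.
Qed.

Lemma measurable_graph S : measurable_fun setT (fun x : V => (x, S x)).
Proof. by apply/measurable_fun_pairP; split; [exact: measurable_id|exact: measurable_sim]. Qed.

(** The law of [f] is compared with [r] on measurable sets only, as [coupling] prescribes; the lemma
    serves both the projections of a coupling and the map [S] itself. *)
Lemma integral_image_law d (T : measurableType d) (mu : {measure set T -> \bar R})
    (r : P2 R n) (f : T -> V) (w : V -> R) : measurable_fun setT f ->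
  (forall A, measurable A -> mu (f @^-1` A) = r A) -> r.-integrable setT (EFin \o w) ->
  mu.-integrable setT (fun z => (w (f z))%:E) /\
  (\int[mu]_z (w (f z))%:E = \int[r]_x (w x)%:E)%E.
Proof.
move=> mf rE iw; have /integrableP[mw woo] := iw.
pose r' := pushforward_measure mu mf.
have r'E A : measurable A -> A `<=` setT -> r' A = r A by move=> mA _; exact: rE.
have ir : mu.-integrable setT (fun z => (w (f z))%:E).
  apply/integrableP; split; first exact: (measurableT_comp mw mf).
  have := @ge0_integral_pushforward _ _ _ _ _ _ mf mu setT (abse \o (EFin \o w)).
  move=> /(_ measurableT (measurableT_comp (@abse_measurable R setT) mw)).
  move=> /(_ (fun x _ => abse_ge0 _)) <-.
  by rewrite (eq_measure_integral r r'E).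
split => //; rewrite -(eq_measure_integral r r'E).
by rewrite (integral_pushforward mf mw).
Qed.

Lemma coupling_integral p q pi (u v : V -> R) : coupling p q pi ->
  p.-integrable setT (EFin \o u) -> q.-integrable setT (EFin \o v) ->
  pi.-integrable setT (fun z => (u z.1 + v z.2)%:E) /\
  (\int[pi]_z (u z.1 + v z.2)%:E = \int[p]_x (u x)%:E + \int[q]_y (v y)%:E)%E.
Proof.
move=> cpl iu iv.
have [i1 E1] : pi.-integrable setT (fun z => (u z.1)%:E) /\
    (\int[pi]_z (u z.1)%:E = \int[p]_x (u x)%:E)%E.
  by apply: integral_image_law => // A mA; have [] := cpl A mA.
have [i2 E2] : pi.-integrable setT (fun z => (v z.2)%:E) /\
    (\int[pi]_z (v z.2)%:E = \int[q]_x (v x)%:E)%E.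
  by apply: integral_image_law => // A mA; have [] := cpl A mA.
split; first by under eq_fun do rewrite EFinD; exact: integrableD.
under eq_integral do rewrite EFinD.
by rewrite integralD// E1 E2.
Qed.

Lemma coupling_graph S p : coupling p (push S p) (prob_image p (measurable_graph S)).
Proof. by move=> A mA; split. Qed.

(** Weak duality with explicit potentials. The graph coupling bounds the infimum from above; the
    integral of [potential + copotential] is the same for all couplings, bounds every cost from
    below and is attained on the graph. *)
Lemma W2_affine S p : sim_rot S = 1%:M ->
  W2 p (push S p) = Num.sqrt (fine (\int[p]_x (sqnorm (x - S x))%:E)).
Proof.
move=> S1; rewrite /W2 -/transport_cost; congr (Num.sqrt (fine _)).
have gE : transport_cost (prob_image p (measurable_graph S)) =
    (\int[p]_x (sqnorm (x - S x))%:E)%E.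
  rewrite /transport_cost ge0_integral_prob_image//; first exact: measurable_sqnormB.
  by move=> z; rewrite lee_fin sqnorm_ge0.
apply/eqP; rewrite eq_le; apply/andP; split.
  apply: ereal_inf_lbound; exists (prob_image p (measurable_graph S)); last exact: gE.
  exact: coupling_graph.
apply: le_ereal_inf_tmp => _ [pi cpl <-].
have [ipi piE] := coupling_integral cpl (integrable_potential S p) (integrable_copotential S (push S p)).
have [iS SE] := @integral_image_law _ _ p (push S p) _ _ (measurable_sim S) (fun A _ => erefl)
  (integrable_copotential S (push S p)).
have -> : (\int[p]_x (sqnorm (x - S x))%:E =
    \int[pi]_z (potential S z.1 + copotential S z.2)%:E)%E.
  rewrite piE -SE -integralD//; last exact: integrable_potential.
  by apply: eq_integral => x _ /=; rewrite -potential_eq// EFinD.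
(* Passing to the positive part of the potentials leaves two nonnegative integrands, comparable even
   if the cost of [pi] is infinite. *)
rewrite /transport_cost [leLHS]integralE.
apply: (@le_trans _ _ (\int[pi]_z (fun z => (potential S z.1 + copotential S z.2)%:E)^\+ z)%E).
  by rewrite -[leRHS]adde0 leeD2l// oppe_le0 integral_ge0.
apply: ge0_le_integral_sup => z _ //.
by rewrite funeposE ge_max !lee_fin potential_le sqnorm_ge0.
Qed.
End optimal_affine.

(** * Fisher information of a push-forward *)

Section Ck_calculus.
Context {R : realType} {n : nat}.
Local Notation V := 'cV[R]_n.
Implicit Types f g : V -> R.

Lemma CkS k f : Ck k.+1 f -> Ck k f.
Proof.
elim: k f => [|k IH] f [df pf] /=.
  by move=> x; exact/differentiable_continuous/df.
by split => // i; apply: IH; exact: pf.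
Qed.

Lemma Ck_continuous k f : Ck k f -> continuous f.
Proof. by elim: k => [|k IH]//= /CkS. Qed.

Lemma Ck_cst k (c : R) : Ck k (cst c : V -> R).
Proof.
elim: k c => [|k IH] c /=; first by move=> x; exact: cst_continuous.
split => [x|i]; first exact: differentiable_cst.
rewrite (_ : partial i _ = cst 0); first exact: IH.
by apply/funext => x; rewrite /partial derive_cst.
Qed.

Lemma CkD k f g : Ck k f -> Ck k g -> Ck k (fun x => f x + g x).
Proof.
elim: k f g => [|k IH] f g /=; first by move=> cf cg x; apply: (@cvgD R R^o _ _ (nbhs_filter x)); [exact: cf|exact: cg].
move=> [df pf] [dg pg]; split => [x|i]; first exact: differentiableD.
rewrite (_ : partial i _ = fun x => partial i f x + partial i g x); first exact: IH.
by apply/funext => x; rewrite /partial deriveD//; exact: diff_derivable.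
Qed.

Lemma CkM k f g : Ck k f -> Ck k g -> Ck k (fun x => f x * g x).
Proof.
elim: k f g => [|k IH] f g /=; first by move=> cf cg x; apply: (@cvgM R _ _ (nbhs_filter x)); [exact: cf|exact: cg].
move=> /[dup] cf [df pf] /[dup] cg [dg pg]; split => [x|i]; first exact: differentiableM.
rewrite (_ : partial i _ = fun x => f x * partial i g x + g x * partial i f x).
  by apply: CkD; apply: IH => //; exact: CkS.
by apply/funext => x; rewrite /partial deriveM//; exact: diff_derivable.
Qed.

Lemma Ck_sum k (I : Type) (r : seq I) (F : I -> V -> R) :
  (forall i, Ck k (F i)) -> Ck k (fun x => \sum_(i <- r) F i x).
Proof.
move=> cF; elim: r => [|i r IH].
  rewrite (_ : (fun x => _) = cst 0); first exact: Ck_cst.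
  by apply/funext => x; rewrite big_nil.
rewrite (_ : (fun x => _) = fun x => F i x + \sum_(i <- r) F i x); first exact: CkD.
by apply/funext => x; rewrite big_cons.
Qed.

Lemma derivable_coord i (x v : V) : is_derive x v (fun y : V => y i ord0) (v i ord0).
Proof.
have cvg_quot : (fun h : R => h^-1 *: ((h *: v + x) i ord0 - x i ord0)) @ 0^' --> v i ord0.
  apply: (@cvg_trans _ ((fun=> v i ord0) @ (0 : R)^')); last exact: cvg_cst.
  apply: near_eq_cvg; near=> h.
  have h0 : h != 0 by near: h; exact: nbhs_dnbhs_neq.
  by rewrite !mxE addrK /GRing.scale/= mulKf.
by split; [apply/cvg_ex; exists (v i ord0)|exact/cvg_lim].
Unshelve. all: by end_near. Qed.

Lemma Ck_coord k i : Ck k (fun x : V => x i ord0).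
Proof.
case: k => [|k] /=; first by move=> x; exact: coord_continuous.
split => [x|j]; first exact: differentiable_coord.
rewrite (_ : partial j _ = cst ((delta_mx j ord0 : V) i ord0)); first exact: Ck_cst.
apply/funext => x; rewrite /partial.
have := derivable_coord i x (delta_mx j ord0).
by move=> h; rewrite derive_val.
Qed.

Lemma derive_partial f (x v : V) : differentiable f x ->
  'D_v f x = \sum_i v i ord0 * partial i f x.
Proof.
move=> df; rewrite deriveE//.
have -> : v = \sum_i v i ord0 *: (delta_mx i ord0 : V).
  apply/colP => j; rewrite summxE (bigD1 j)//= big1 => [|i ij].
    by rewrite !mxE !eqxx mulr1 addr0.
  by rewrite !mxE eq_sym (negbTE ij) mulr0.
rewrite linear_sum; apply: eq_bigr => i _.
rewrite linearZ/= /partial deriveE//; congr (_ * _).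
rewrite summxE (bigD1 i)//= big1 => [|j ji].
  by rewrite !mxE !eqxx mulr1 addr0.
by rewrite !mxE eq_sym (negbTE ji) mulr0.
Qed.

(** The two difference quotients coincide, because [S (h v + x) = h (a R v) + S x]. *)
Lemma derive_sim (S : similarity R n) f (x v : V) :
  'D_v (f \o S) x = 'D_(sim_scale S *: (sim_rot S *m v)) f (S x).
Proof.
rewrite /derive; apply: (congr1 (fun F : R -> R^o => lim (F @ 0^'))).
apply/funext => h /=; congr (_ *: (f _ - _)); rewrite /sim_fun mulmxDr scalerDr addrA; congr (_ + _ + _).
by rewrite -scalemxAr !scalerA mulrC.
Qed.

Lemma differentiable_sim (S : similarity R n) (x : V) : differentiable S x.
Proof.
have lf : linear (fun y : V => sim_scale S *: (sim_rot S *m y)).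
  by move=> c u w; rewrite mulmxDr scalerDr -scalemxAr !scalerA mulrC.
pose L : {linear V -> V} := HB.pack (fun y : V => sim_scale S *: (sim_rot S *m y))
  (GRing.isLinear.Build _ _ _ _ _ lf).
have -> : sim_fun S = L \+ cst (sim_shift S) by apply/funext.
apply: differentiableD; last exact: differentiable_cst.
apply: linear_differentiable.
have -> : (L : V -> V) = fun y => S y - sim_shift S.
  by apply/funext => y; rewrite /sim_fun addrK.
move=> y; apply: (@cvgB R V _ _ (nbhs_filter y)); last exact: cvg_cst.
exact: continuous_sim.
Qed.

Lemma partial_sim (S : similarity R n) f i x : differentiable f (S x) ->
  partial i (f \o S) x =
  sim_scale S * \sum_j sim_rot S j i * partial j f (S x).
Proof.
move=> df; rewrite /partial derive_sim derive_partial// mulr_sumr.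
apply: eq_bigr => j _; rewrite mxE mulrA; congr (_ * _ * _).
rewrite mxE (bigD1 i)//= big1 ?addr0 => [|k ki].
  by rewrite !mxE !eqxx mulr1.
by rewrite !mxE (negbTE ki) mulr0.
Qed.

Lemma Ck_sim k (S : similarity R n) f : Ck k f -> Ck k (f \o S).
Proof.
elim: k f => [|k IH] f /=.
  by move=> cf x; apply: continuous_comp; [exact: continuous_sim|exact: cf].
move=> [df pf]; split => [x|i].
  by apply: differentiable_comp; [exact: differentiable_sim|exact: df].
rewrite (_ : partial i _ = fun x =>
    sim_scale S * \sum_j sim_rot S j i * (partial j f \o S) x).
  apply: CkM; first exact: Ck_cst.
  by apply: Ck_sum => j; apply: CkM; [exact: Ck_cst|exact/IH/pf].
by apply/funext => x; rewrite partial_sim.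
Qed.

End Ck_calculus.

Section weak_gradient_sim.
Context {R : realType} {n : nat}.
Local Notation V := 'cV[R]_n.
Implicit Types (f psi : V -> R) (g : V -> V) (S : similarity R n).

Lemma compact_measurable_cV (K : set V) : compact K -> measurable K.
Proof.
move=> /(compact_closed (@norm_hausdorff R V)) cK.
rewrite -[K]setCK; apply: measurableC; apply: sub_sigma_algebra.
exact: closed_openC.
Qed.

Lemma compact_sim_image S (K : set V) : compact K -> compact (S @` K).
Proof.
move=> cK; apply: continuous_compact => //; apply: continuous_subspaceT.
exact: continuous_sim.
Qed.

Lemma sim_preimage_image S (K : set V) : S @^-1` (S @` K) = K.
Proof.
apply/seteqP; split => [x [y Ky Sxy]|x Kx]; last by exists x.
by rewrite -(simK S x) -Sxy simK.
Qed.

Lemma continuous_bounded_on (K : set V) psi : compact K -> continuous psi ->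
  exists2 M : R, 0 <= M & forall x, K x -> `|psi x| <= M.
Proof.
move=> cK cpsi; have := @compact_bounded R R^o (psi @` K).
have cpK : compact (psi @` K : set R^o).
  by apply: continuous_compact => //; exact: continuous_subspaceT.
move=> /(_ cpK) [M [_ HM]]; exists (`|M| + 1); first by rewrite addr_ge0.
move=> x Kx; apply: HM; last by exists x.
by rewrite (le_lt_trans (ler_norm M))// ltrDl.
Qed.

Lemma integrable_mul_csupport f psi (K : set V) : loc_integrable f ->
  continuous psi -> compact K -> (forall x, ~ K x -> psi x = 0) ->
  lebesgue_cV.-integrable setT (EFin \o (fun x => f x * psi x)).
Proof.
move=> [mf fK] cpsi cK psi0; have mK := compact_measurable_cV cK.
have [M M0 psiM] := continuous_bounded_on cK cpsi.
have := fK _ cK => /(integrable_mkcond _ mK) intf.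
apply: (@le_integrable _ _ _ _ _ _ _
  (fun x => (M%:E * ((EFin \o f) \_ K) x)%E)) => //; last exact: integrableZl.
  apply/measurable_EFinP/measurable_funM => //.
  exact: measurable_fun_continuous.
move=> x _ /=; rewrite patchE; case: ifPn => [|]; rewrite (inE, notin_setE) => Kx.
  rewrite -EFinM lee_fin !normrM mulrC (ger0_norm M0).
  by apply: ler_wpM2r => //; exact: psiM.
by rewrite psi0// mulr0 normr0 mule0 abse0.
Qed.

Lemma loc_integrable_sim S f : loc_integrable f -> loc_integrable (f \o S).
Proof.
move=> [mf fK]; split; first exact: measurable_comp_sim.
move=> K cK; have cSK : compact (S @` K) by exact: compact_sim_image.
have /integrableP[_ foo] := fK _ cSK.
apply/integrableP; split.
  by apply/measurable_EFinP; apply: measurable_funTS; exact: measurable_comp_sim.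
have -> : (\int[lebesgue_cV]_(x in K) `|(EFin \o (f \o S)) x| =
    \int[lebesgue_cV]_(x in S @^-1` (S @` K)) (abse \o (EFin \o f)) (S x))%E.
  by rewrite sim_preimage_image.
rewrite ge0_integral_sim_preimage.
- by rewrite lte_mul_pinfty// lee_fin invr_ge0 exprn_ge0 ?ltW ?sim_scale_gt0.
- exact: compact_measurable_cV.
- by apply: measurableT_comp => //; exact/measurable_EFinP.
- by move=> x; exact: abse_ge0.
Qed.

Lemma loc_integrableZ (k : R) f : loc_integrable f -> loc_integrable (fun x => k * f x).
Proof.
move=> [mf fK]; split; first exact: measurable_funM.
move=> K cK; rewrite (_ : _ \o _ = fun x => (k%:E * (EFin \o f) x)%E).
  by apply: integrableZl; [exact: compact_measurable_cV|exact: fK].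
by apply/funext => x /=; rewrite EFinM.
Qed.

Lemma loc_integrable_sum (I : Type) (r : seq I) (F : I -> V -> R) :
  (forall i, loc_integrable (F i)) ->
  loc_integrable (fun x => \sum_(i <- r) F i x).
Proof.
move=> FK; split; first by apply: measurable_sum => i; have [] := FK i.
move=> K cK; rewrite (_ : _ \o _ = fun x => (\sum_(i <- r) (EFin \o F i) x)%E).
  apply: integrable_sum; first exact: compact_measurable_cV.
  by move=> i _; have [_] := FK i; exact.
by apply/funext => x /=; rewrite sumEFin.
Qed.

Lemma Rintegral_sum (I : Type) (r : seq I) (F : I -> V -> R) :
  (forall i, lebesgue_cV.-integrable setT (EFin \o F i)) ->
  \int[lebesgue_cV]_x (\sum_(i <- r) F i x) = \sum_(i <- r) \int[lebesgue_cV]_x F i x.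
Proof.
move=> iF; elim: r => [|i r IH].
  by rewrite big_nil; under eq_Rintegral do rewrite big_nil; rewrite Rintegral_cst// mul0r.
rewrite big_cons -IH -RintegralD//.
  by apply: eq_Rintegral => x _; rewrite big_cons.
rewrite (_ : _ \o _ = fun x => (\sum_(i <- r) (EFin \o F i) x)%E).
  exact: integrable_sum.
by apply/funext => x /=; rewrite sumEFin.
Qed.

Lemma Rintegral_sim S f : measurable_fun setT f ->
  \int[lebesgue_cV]_x f (S x) = sim_scale S ^- n * \int[lebesgue_cV]_x f x.
Proof.
move=> mf; rewrite /Rintegral (integral_sim S (h := EFin \o f)).
  by rewrite fine_pM// invr_gt0 exprn_gt0// sim_scale_gt0.
exact/measurable_EFinP.
Qed.

Lemma test_function_sim S psi : test_function psi -> test_function (psi \o S).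
Proof.
move=> [cpsi [K cK psi0]]; split => [k|]; first exact/Ck_sim/cpsi.
exists (sim_inv S @` K); first exact: compact_sim_image.
move=> x nK /=; apply: psi0 => KSx; apply: nK.
by exists (S x) => //; rewrite simK.
Qed.

Lemma partial_continuous psi i : test_function psi -> continuous (partial i psi).
Proof. by move=> [/(_ 1%N) [_ /(_ i)]]. Qed.

(** A compact [K] is closed, so [psi] vanishes on a whole neighbourhood of any point outside it. *)
Lemma partial_support psi i (K : set V) : compact K ->
  (forall x, ~ K x -> psi x = 0) -> forall x, ~ K x -> partial i psi x = 0.
Proof.
move=> cK psi0 x nKx.
have oK : open (~` K) by apply: closed_openC; apply: compact_closed => //; exact: norm_hausdorff.
rewrite /partial -(derive_cst (0 : R^o) x (delta_mx i ord0)).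
apply: near_eq_derive; have := open_nbhs_nbhs (conj oK nKx).
by apply: filterS => y nKy; rewrite psi0.
Qed.

(** The chain rule for [k f (S^-1 y)]: the linear part of [S^-1] is [a^-1 R^T], and gradients
    transform by its transpose. *)
Definition push_gradient S (k : R) (g : V -> V) : V -> V :=
  fun y => (k / sim_scale S) *: (sim_rot S *m g (sim_inv S y)).

Lemma push_gradientE S k g i y : push_gradient S k g y i ord0 =
  (k / sim_scale S) * \sum_j sim_rot S i j * g (sim_inv S y) j ord0.
Proof. by rewrite !mxE. Qed.

(** A test function [phi] is pulled back to [psi = phi \o S]; its [i]-th partial derivative becomes
    a constant combination of those of [psi], and the definition for [g] applies to each term. The
    factor [k] is free, so that densities and their square roots are both covered. *)
Lemma weak_gradient_sim S (k : R) f g : weak_gradient f g ->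
  weak_gradient (fun y => k * f (sim_inv S y)) (push_gradient S k g).
Proof.
move=> [lf wg]; have a0 := sim_scale_gt0 S; have aN0 := sim_scale_neq0 S.
split; first by apply: loc_integrableZ; exact: (loc_integrable_sim (sim_inv S) lf).
move=> i.
have gE : (fun x => push_gradient S k g x i ord0) = (fun y => (k / sim_scale S) *
    \sum_j sim_rot S i j * ((fun x => g x j ord0) \o sim_inv S) y).
  by apply/funext => y; rewrite push_gradientE.
have lg : loc_integrable (fun x => push_gradient S k g x i ord0).
  rewrite gE; apply: loc_integrableZ; apply: loc_integrable_sum => j.
  by apply: loc_integrableZ; apply: loc_integrable_sim; have [] := wg j.
split => // phi tphi; have [cphi [K cK phi0]] := tphi.
pose psi := phi \o S; have tpsi : test_function psi by exact: test_function_sim.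
have [cpsi [L cL psi0]] := tpsi.
have phiE : phi = psi \o sim_inv S.
  by apply/funext => y; rewrite /psi/= sim_invK.
have dpsi x : differentiable psi x by have [+ _] := cpsi 1%N; exact.
have ifp j : lebesgue_cV.-integrable setT (EFin \o (fun x => f x * partial j psi x)).
  by apply: (integrable_mul_csupport lf _ cL); [exact: partial_continuous|exact: partial_support].
have igp j : lebesgue_cV.-integrable setT (EFin \o (fun x => g x j ord0 * psi x)).
  have [lgj _] := wg j.
  by apply: (integrable_mul_csupport lgj _ cL) => //; exact: (Ck_continuous (cpsi 0%N)).
have mLHS : measurable_fun setT (fun y => k * f (sim_inv S y) * partial i phi y).
  apply: measurable_funM; last by apply: measurable_fun_continuous; exact: partial_continuous.
  by apply: measurable_funM => //; have [mf _] := lf; exact: measurable_comp_sim.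
have mRHS : measurable_fun setT (fun y => push_gradient S k g y i ord0 * phi y).
  apply: measurable_funM; first by have [] := lg.
  by apply: measurable_fun_continuous; exact: (Ck_continuous (cphi 0%N)).
have an0 : sim_scale S ^- n != 0 by rewrite invr_neq0// expf_neq0.
(* Multiplying both sides by the Jacobian [a^-n] turns them into integrals in the variable [x] with
   [y = S x]. *)
apply: (mulfI an0); rewrite mulrN -(Rintegral_sim S mLHS) -(Rintegral_sim S mRHS).
transitivity (\int[lebesgue_cV]_x (\sum_j (k / sim_scale S * sim_rot S i j) *
    (f x * partial j psi x))).
  apply: eq_Rintegral => x _; rewrite simK {1}phiE partial_sim//= simK.
  rewrite mulrA mulr_sumr; apply: eq_bigr => j _; rewrite mxE; ring.
rewrite Rintegral_sum; last first.
  move=> j; rewrite (_ : _ \o _ = fun x => ((k / sim_scale S * sim_rot S i j)%:E *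
     (EFin \o (fun x => f x * partial j psi x)%R) x)%E).
    exact: integrableZl.
  by apply/funext => x /=; rewrite EFinM.
transitivity (- \int[lebesgue_cV]_x (\sum_j (k / sim_scale S * sim_rot S i j) *
    (g x j ord0 * psi x))); last first.
  congr (- _); apply: eq_Rintegral => x _; rewrite push_gradientE simK.
  rewrite mulr_sumr mulr_suml; apply: eq_bigr => j _; rewrite /psi/=; ring.
rewrite Rintegral_sum; last first.
  move=> j; rewrite (_ : _ \o _ = fun x => ((k / sim_scale S * sim_rot S i j)%:E *
     (EFin \o (fun x => g x j ord0 * psi x)%R) x)%E).
    exact: integrableZl.
  by apply/funext => x /=; rewrite EFinM.
rewrite -sumrN; apply: eq_bigr => j _; rewrite !RintegralZl//.
have [_ /(_ psi tpsi) ->] := wg j.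
by rewrite mulrN.
Qed.

End weak_gradient_sim.

Section fisher_sim.
Context {R : realType} {n : nat}.
Local Notation V := 'cV[R]_n.
Implicit Types (f : V -> R) (g : V -> V) (S : similarity R n).

Lemma Lfun2P f : f \in Lfun (@lebesgue_cV R n) 2%:E <->
  measurable_fun setT f /\ lebesgue_cV.-integrable setT (EFin \o (fun x => f x ^+ 2)).
Proof.
split => [fL|[mf if2]].
  split; last exact: Lfun2_integrable_sqr.
  by move: fL; rewrite inE => /andP[]; rewrite inE.
rewrite inE; apply/andP; split; rewrite inE//=.
rewrite /finite_norm unlock poweR_lty//.
move: if2 => /integrableP[_]; congr (_ < _)%E; apply: eq_integral => x _ /=.
by rewrite normrX powR_mulrn.
Qed.

Lemma Lfun2_sim S (k : R) f : f \in Lfun lebesgue_cV 2%:E ->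
  (fun y => k * f (S y)) \in Lfun lebesgue_cV 2%:E.
Proof.
move=> /Lfun2P[mf if2]; apply/Lfun2P; split.
  by apply: measurable_funM => //; exact: measurable_comp_sim.
rewrite (_ : _ \o _ = fun x => ((k ^+ 2)%:E * ((EFin \o (fun x => (f x ^+ 2)%R)) \o S) x)%E).
  by apply: integrableZl => //; exact: integrable_sim.
by apply/funext => x /=; rewrite -EFinM exprMn.
Qed.

Lemma Lfun2Z (k : R) f : f \in Lfun lebesgue_cV 2%:E ->
  (fun y => k * f y) \in Lfun lebesgue_cV 2%:E.
Proof.
move=> /Lfun2P[mf if2]; apply/Lfun2P; split; first exact: measurable_funM.
rewrite (_ : _ \o _ = fun x => ((k ^+ 2)%:E * (EFin \o (fun x => (f x ^+ 2)%R)) x)%E).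
  exact: integrableZl.
by apply/funext => x /=; rewrite -EFinM exprMn.
Qed.

Lemma Lfun2D f f' : f \in Lfun lebesgue_cV 2%:E -> f' \in Lfun lebesgue_cV 2%:E ->
  (fun y => f y + f' y) \in Lfun lebesgue_cV 2%:E.
Proof.
move=> /Lfun2P[mf if2] /Lfun2P[mf' if2']; apply/Lfun2P.
have mD : measurable_fun setT (fun y => f y + f' y) by exact: measurable_funD.
split => //; apply: (@le_integrable _ _ _ _ _ _ _
  (fun x => (2%:E * (EFin \o (fun x => (f x ^+ 2)%R)) x +
             2%:E * (EFin \o (fun x => (f' x ^+ 2)%R)) x)%E)) => //.
- exact/measurable_EFinP/measurable_funX.
- move=> x _.
  have lefg : `|(f x + f' x) ^+ 2| <= `|2 * f x ^+ 2 + 2 * f' x ^+ 2|.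
    have h0 : 0 <= 2 * f x ^+ 2 + 2 * f' x ^+ 2.
      by rewrite addr_ge0// mulr_ge0// sqr_ge0.
    rewrite (ger0_norm h0) ger0_norm ?sqr_ge0//.
    have : 0 <= (f x - f' x) ^+ 2 by exact: sqr_ge0.
    by nra.
  by rewrite -lee_fin in lefg.
- by apply: integrableD => //; exact: integrableZl.
Qed.

Lemma Lfun2_sum (I : Type) (r : seq I) (F : I -> V -> R) :
  (forall i, F i \in Lfun lebesgue_cV 2%:E) ->
  (fun x => \sum_(i <- r) F i x) \in Lfun lebesgue_cV 2%:E.
Proof.
move=> FL; elim: r => [|i r IH].
  rewrite (_ : (fun x => _) = cst 0).
    apply/Lfun2P; split => //; rewrite (_ : _ \o _ = cst 0%E); first exact: integrable0.
    by apply/funext => x /=; rewrite expr0n.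
  by apply/funext => x; rewrite big_nil.
rewrite (_ : (fun x => _) = fun x => F i x + \sum_(i <- r) F i x); first exact: Lfun2D.
by apply/funext => x; rewrite big_cons.
Qed.

Lemma sobolev_W12_sim S (k : R) f : sobolev_W12 f ->
  sobolev_W12 (fun y => k * f (sim_inv S y)).
Proof.
move=> [fL [g wg gL]]; split; first exact: Lfun2_sim.
exists (push_gradient S k g); first exact: weak_gradient_sim.
move=> i; rewrite (_ : (fun x => _) = (fun y => (k / sim_scale S) *
    \sum_j sim_rot S i j * g (sim_inv S y) j ord0)).
  by apply: Lfun2Z; apply: Lfun2_sum => j; exact: (Lfun2_sim (sim_inv S) (sim_rot S i j) (gL j)).
by apply/funext => y; rewrite push_gradientE.
Qed.

(** From [1/f = f (f^2)^-1], where the inverse of a square is a real power; at zeros of [f] both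
    sides are [0]. *)
Lemma measurable_funV d (T : measurableType d) (D : set T) (f : T -> R) :
  measurable_fun D f -> measurable_fun D (fun x => (f x)^-1).
Proof.
move=> mf; rewrite (_ : (fun x => _) = fun x => f x * (f x ^+ 2) `^ (-1)).
  apply: measurable_funM => //.
  by apply: (measurableT_comp (measurable_powR (-1))); exact: measurable_funX.
apply/funext => x; rewrite powR_inv1 ?sqr_ge0//.
have [->|fx0] := eqVneq (f x) 0; first by rewrite mul0r invr0.
by rewrite expr2 invfM mulrA mulfV// mul1r.
Qed.

Lemma weak_gradient_measurable f g : weak_gradient f g ->
  measurable_fun setT f /\ measurable_fun setT (fun x => sqnorm (g x)).
Proof.
move=> [[mf _] wg]; split => //.
by apply: measurable_sum => i; apply: measurable_funX; have [[]] := wg i.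
Qed.

(** The quotient [|g|^2 / f] acquires [a^-2] from the gradient and [a^-n] from the density; the
    latter is cancelled by the change of variables. *)
Lemma fisher_push_le S f :
  (fisher (push_density S f) <= (sim_scale S ^- 2)%:E * fisher f)%E.
Proof.
have a0 := sim_scale_gt0 S; have aN0 := sim_scale_neq0 S.
have k0 : 0 < sim_scale S ^- n by rewrite invr_gt0 exprn_gt0.
have c0 : 0 < sim_scale S ^- 2 by rewrite invr_gt0 exprn_gt0.
rewrite -lee_pdivrMl//; apply: le_ereal_inf_tmp => _ [g [sf wg] <-].
rewrite lee_pdivrMl//; apply: ereal_inf_lbound.
exists (push_gradient S (sim_scale S ^- n) g).
  split; last exact: weak_gradient_sim.
  (* The square root of the pushed density is a multiple of the transported square root, hence again
     in [W^{1,2}]. *)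
  rewrite (_ : (fun x => _) = fun x =>
      Num.sqrt (sim_scale S ^- n) * Num.sqrt (f (sim_inv S x))).
    exact: (sobolev_W12_sim S (Num.sqrt (sim_scale S ^- n)) sf).
  by apply/funext => x; rewrite /push_density sqrtrM// ltW.
have [mf mg] := weak_gradient_measurable wg.
pose h x := ((sim_scale S ^- n * sim_scale S ^- 2) * (sqnorm (g x) / f x))%:E.
transitivity (\int[lebesgue_cV]_y h (sim_inv S y))%E.
  apply: eq_integral => y _; congr EFin.
  rewrite /push_gradient /push_density sqnormZ sqnorm_orth ?sim_rot_orth//.
  set a := sim_scale S; set G := sqnorm _; set F := f _.
  have [->|F0] := eqVneq F 0; first by rewrite mulr0 invr0 !mulr0.
  have an0 : a ^+ n != 0 by rewrite expf_neq0.
  by field; rewrite F0 an0 aN0.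
rewrite integral_sim; last first.
  apply/measurable_EFinP; apply: measurable_funM => //; apply: measurable_funM => //.
  exact: measurable_funV.
rewrite /= exprVn invrK /h; under eq_integral do rewrite EFinM.
rewrite integral_pZl ?mulr_gt0// muleA -EFinM mulrA mulfV ?expf_neq0//.
by rewrite mul1r.
Qed.

Lemma fisher_push S f :
  fisher (push_density S f) = ((sim_scale S ^- 2)%:E * fisher f)%E.
Proof.
apply/eqP; rewrite eq_le fisher_push_le/=.
have := fisher_push_le (sim_inv S) (push_density S f).
by rewrite push_densityK/= exprVn invrK -lee_pdivrMl// exprn_gt0// sim_scale_gt0.
Qed.

Lemma J_push S (p : P2 R n) : J (push S p) = ((sim_scale S ^- 2)%:E * J p)%E.
Proof.
have le (T : similarity R n) (q : P2 R n) :
    (J (push T q) <= (sim_scale T ^- 2)%:E * J q)%E.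
  have c0 : 0 < sim_scale T ^- 2 by rewrite invr_gt0 exprn_gt0// sim_scale_gt0.
  rewrite -lee_pdivrMl//; apply: le_ereal_inf_tmp => _ [f df <-].
  rewrite lee_pdivrMl// -fisher_push; apply: ereal_inf_lbound.
  by exists (push_density T f) => //; exact: is_density_push.
apply/eqP; rewrite eq_le le/=.
have := le (sim_inv S) (push S p).
by rewrite push_simK/= exprVn invrK -lee_pdivrMl// exprn_gt0// sim_scale_gt0.
Qed.

Lemma fisher_ge0 f : (forall x, 0 <= f x) -> (0 <= fisher f)%E.
Proof.
move=> f0; apply: le_ereal_inf_tmp => _ [g _ <-]; apply: integral_ge0 => x _.
by rewrite lee_fin divr_ge0// sqnorm_ge0.
Qed.

Lemma J_ge0 (p : P2 R n) : (0 <= J p)%E.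
Proof. by apply: le_ereal_inf_tmp => _ [f [_ f0 _] <-]; exact: fisher_ge0. Qed.

End fisher_sim.

(** * Lengths and distances of a push-forward *)

Section cost_push.
Context {R : realType} {n : nat}.
Implicit Types (S : similarity R n) (p q : P2 R n) (U : P2 R n -> \bar R).

Lemma cost_integrand_ge0 U e (gamma : R -> P2 R n) t :
  (0 <= sqrte (2%:E * (e%:E + U (gamma t))) * (metric_speed gamma t)%:E)%E.
Proof. by rewrite mule_ge0 ?sqrte_ge0// lee_fin metric_speed_ge0. Qed.

(** Homogeneity under similarities, shared by [c J] with [k a = a^-2] and by [c J^alpha] with
    [k a = (a^-2)^alpha]. *)
Definition scales_by U (k : R -> R) :=
  forall S p, U (push S p) = ((k (sim_scale S))%:E * U p)%E.

Lemma cost_length_push0 U (k : R -> R) S T gamma : scales_by U k ->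
  0 < k (sim_scale S) ->
  cost_length U 0 T (fun t => push S (gamma t)) =
  ((sim_scale S * Num.sqrt (k (sim_scale S)))%:E * cost_length U 0 T gamma)%E.
Proof.
move=> sU k0; have a0 := sim_scale_gt0 S.
rewrite /cost_length -integral_pZl ?mulr_gt0// ?sqrtr_gt0//.
apply: eq_integral => t _; rewrite metric_speed_push sU !add0e muleCA.
rewrite sqrteM ?lee_fin ?ltW// [in RHS]EFinM [X in _ = (X * _)%E]muleC -!muleA.
by congr (_ * _)%E; rewrite EFinM muleCA.
Qed.

(** Since [e + a^-2 U = a^-2 (a^2 e + U)], the square root contributes [a^-1], which cancels the
    factor [a] of the metric speed. *)
Lemma cost_length_push U S (e T : R) gamma : scales_by U (fun a => a ^- 2) ->
  (forall p, 0 <= U p)%E ->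
  cost_length U e T (fun t => push S (gamma t)) =
  cost_length U (sim_scale S ^+ 2 * e) T gamma.
Proof.
move=> sU U0; have a0 := sim_scale_gt0 S; have aN0 := sim_scale_neq0 S.
apply: eq_integral => t _; rewrite metric_speed_push sU.
have -> : (2%:E * (e%:E + (sim_scale S ^- 2)%:E * U (gamma t)) =
  (sim_scale S ^- 2)%:E * (2%:E * ((sim_scale S ^+ 2 * e)%:E + U (gamma t))))%E.
  rewrite muleCA [in RHS]muleDr//.
  by rewrite -EFinM mulrA mulVf ?mul1r// expf_neq0.
rewrite sqrteM ?lee_fin ?invr_ge0 ?sqr_ge0//= sqrtrV ?sqr_ge0// sqrtr_sqr gtr0_norm//.
rewrite (EFinM (sim_scale S) (metric_speed gamma t)) muleACA -EFinM.
by rewrite mulVf// mul1e.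
Qed.

Lemma cost_dist_push_le U S (e : R) p q : scales_by U (fun a => a ^- 2) ->
  (forall p, 0 <= U p)%E ->
  (cost_dist U e (push S p) (push S q) <= cost_dist U (sim_scale S ^+ 2 * e) p q)%E.
Proof.
move=> sU U0; apply: ereal_inf_le_tmp => _ [T [gamma [T0 AC g0 gT ->]]].
exists T, (fun t => push S (gamma t)); split.
- exact: T0.
- exact: AC2_push.
- by move=> A mA; rewrite !pushE g0//; exact: measurable_sim_preimage.
- by move=> A mA; rewrite !pushE gT//; exact: measurable_sim_preimage.
- by rewrite cost_length_push.
Qed.

Lemma cost_dist_push U S (e : R) p q : scales_by U (fun a => a ^- 2) ->
  (forall p, 0 <= U p)%E ->
  cost_dist U e (push S p) (push S q) = cost_dist U (sim_scale S ^+ 2 * e) p q.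
Proof.
move=> sU U0; apply/eqP; rewrite eq_le (cost_dist_push_le _ _ _ _ sU U0)/=.
(* The inverse similarity multiplies the energy by [a^-2], so it is started from [a^2 e]. *)
have := @cost_dist_push_le U (sim_inv S) (sim_scale S ^+ 2 * e) (push S p) (push S q) sU U0.
by rewrite !push_simK /= exprVn mulrA mulVf ?mul1r// expf_neq0// sim_scale_neq0.
Qed.

(** A similarity replaces [e] by [a^2 e], so infinite distance at one energy must be carried to the
    other: a curve of finite length for [e] has finite length for [k e]. *)
Lemma cost_dist_pinftyW U (k e : R) p q : (forall p, 0 <= U p)%E -> 0 <= k -> 0 <= e ->
  cost_dist U (k * e) p q = +oo%E -> cost_dist U e p q = +oo%E.
Proof.
move=> U0 k0 e0 doo; apply/eqP; rewrite -leye_eq; apply: le_ereal_inf_tmp.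
move=> _ [T [gamma [T0 AC g0 gT ->]]].
have : (cost_dist U (k * e) p q <= cost_length U (k * e) T gamma)%E.
  by apply: ereal_inf_lbound; exists T, gamma.
rewrite doo leye_eq => /eqP loo.
(* The constant comes from [k e + U <= (1 + k) (e + U)]. *)
have K0 : 0 < Num.sqrt (1 + k) by rewrite sqrtr_gt0 ltr_pwDl.
have : (cost_length U (k * e) T gamma <=
    (Num.sqrt (1 + k))%:E * cost_length U e T gamma)%E.
  rewrite /cost_length -integral_pZl//; apply: ge0_le_integral_sup => t _.
    exact: cost_integrand_ge0.
  rewrite muleA; apply: lee_wpmul2r; first by rewrite lee_fin metric_speed_ge0.
  have k1 : 0 <= 1 + k by rewrite addr_ge0.
  have := @sqrteM R (1 + k)%:E (2%:E * (e%:E + U (gamma t))).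
  rewrite lee_fin => /(_ k1) <-; rewrite lee_sqrt; last first.
    by rewrite mule_ge0 ?lee_fin// mule_ge0 ?lee_fin// adde_ge0 ?lee_fin.
  rewrite muleCA; apply: lee_wpmul2l; first by rewrite lee_fin.
  case: (U (gamma t)) (U0 (gamma t)) => [u| |]//= u0.
    rewrite -EFinD -EFinM lee_fin; rewrite lee_fin in u0.
    by have := mulr_ge0 k0 u0; nra.
  by rewrite !addey// gt0_muley// lte_fin ltr_pwDl.
rewrite loo leye_eq => /eqP h; move: h.
case: (cost_length U e T gamma) => [l| |]//=.
by rewrite gt0_muleNy// lte_fin.
Qed.

Lemma cost_dist_pinfty U (k e : R) p q : (forall p, 0 <= U p)%E -> 0 < k -> 0 <= e ->
  cost_dist U (k * e) p q = +oo%E <-> cost_dist U e p q = +oo%E.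
Proof.
move=> U0 k0 e0; split; first by apply: cost_dist_pinftyW => //; exact: ltW.
rewrite -{1}[e]mul1r -{1}(mulVf (lt0r_neq0 k0)) -mulrA.
apply: cost_dist_pinftyW => //; first by rewrite invr_ge0 ltW.
by rewrite mulr_ge0// ltW.
Qed.

Lemma boundary_infinity_push U (e : R) S p : scales_by U (fun a => a ^- 2) ->
  (forall p, 0 <= U p)%E -> 0 <= e ->
  (forall q, boundary q -> cost_dist U e (push S p) q = +oo%E) <->
  (forall q, boundary q -> cost_dist U e p q = +oo%E).
Proof.
move=> sU U0 e0; have a20 : 0 < sim_scale S ^+ 2 by rewrite exprn_gt0// sim_scale_gt0.
split => H q bq.
  have := H (push S q) ((boundary_push S q).2 bq).
  by rewrite (cost_dist_push _ _ _ _ sU U0) => /(cost_dist_pinfty _ _ U0 a20 e0).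
rewrite -(push_sim_invK S q) (cost_dist_push _ _ _ _ sU U0); apply/cost_dist_pinfty => //.
by apply: H; apply/boundary_push.
Qed.

Lemma eikonal_push S U : eikonal (fun p => U (push S p)) <-> eikonal U.
Proof.
have a20 : 0 < sim_scale S ^+ 2 by rewrite exprn_gt0// sim_scale_gt0.
split => -[c c0 UE].
  exists (c * sim_scale S ^+ 2); first by rewrite mulr_gt0.
  move=> p; rewrite -[in LHS](push_sim_invK S p) UE J_push/= exprVn invrK.
  by rewrite muleA -EFinM.
exists (c * sim_scale S ^- 2); first by rewrite mulr_gt0// invr_gt0.
by move=> p; rewrite UE J_push muleA -EFinM.
Qed.

Lemma scales_by_fisher (c : R) : scales_by (fun p => c%:E * J p)%E (fun a => a ^- 2).
Proof. by move=> S p; rewrite J_push muleCA. Qed.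

Lemma fisher_energy_ge0 (c : R) (p : P2 R n) : 0 < c -> (0 <= c%:E * J p)%E.
Proof. by move=> c0; rewrite mule_ge0 ?J_ge0// lee_fin ltW. Qed.

(** The conventions respect scaling: the values [0] and [+oo] absorb a positive factor, and at
    [x = +oo] the value [1] occurs only for [alpha = 0], where the factor is [1]. *)
Lemma epowM (k alpha : R) (x : \bar R) : 0 < k -> (0 <= x)%E ->
  epow (k%:E * x) alpha = ((k `^ alpha)%:E * epow x alpha)%E.
Proof.
move=> k0; case: x => [r| |]//=; last first.
  rewrite gt0_muley ?lte_fin//= => _.
  have [a0|] := ltP 0 alpha; first by rewrite gt0_muley// lte_fin powR_gt0.
  by case: eqVneq => [->|_ _]; rewrite ?powRr0 ?mule1 ?mule0.
rewrite lee_fin => r0; rewrite mulf_eq0 gt_eqF//=; case: ifPn => _.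
  by rewrite gt0_muley// lte_fin powR_gt0.
by rewrite powRM// ?EFinM// ltW.
Qed.

Lemma scales_by_epow (c alpha : R) :
  scales_by (fun p => c%:E * epow (J p) alpha)%E (fun a => (a ^- 2) `^ alpha).
Proof.
move=> S p; rewrite J_push epowM ?J_ge0//; first by rewrite muleCA.
by rewrite invr_gt0 exprn_gt0// sim_scale_gt0.
Qed.

(** Origin of the exponent: [a] comes from the metric speed and [a^(-alpha)] from the square root of
    [J^alpha]. *)
Lemma sqrt_powR_sqrV (a alpha : R) : 0 < a ->
  a * Num.sqrt ((a ^- 2) `^ alpha) = a `^ (1 - alpha).
Proof.
move=> a0; have -> : (a ^- 2) `^ alpha = (a `^ (- alpha)) ^+ 2.
  rewrite -[RHS]powR_mulrn ?powR_ge0// -[RHS]powRrM -[a ^- 2]powR_inv1 ?sqr_ge0//.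
  by rewrite -[a ^+ 2]powR_mulrn ?ltW// -!powRrM; congr (_ `^ _); ring.
rewrite sqrtr_sqr ger0_norm ?powR_ge0// -{1}[a]powRr1 ?ltW// -powRD//.
by rewrite (gt_eqF a0) implybT.
Qed.

Lemma cost_length_epow_push (c alpha : R) S T (gamma : R -> P2 R n) :
  cost_length (fun p => c%:E * epow (J p) alpha)%E 0 T (fun t => push S (gamma t)) =
  ((sim_scale S `^ (1 - alpha))%:E *
   cost_length (fun p => c%:E * epow (J p) alpha)%E 0 T gamma)%E.
Proof.
have a0 := sim_scale_gt0 S.
rewrite (cost_length_push0 _ _ (scales_by_epow c alpha)) ?sqrt_powR_sqrV//.
by rewrite powR_gt0// invr_gt0 exprn_gt0.
Qed.

End cost_push.

(** * Test functions and a density of finite Fisher information *)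

Section smooth_bump.
Context {R : realType}.

(* The functions [P(1/t) exp(-1/t) 1_{t > 0}] are closed under derivation. *)
Definition flat (P : {poly R}) (t : R) : R :=
  if 0 < t then P.[t^-1] * expR (- t^-1) else 0.

(** Coefficientwise, [s^(i+1) exp(-s) <= (i+1)!] by the exponential series; taking one power more
    than needed produces the decay [1/s]. *)
Lemma expRN_poly_le (P : {poly R}) : exists2 C : R, 0 <= C &
  forall s : R, 0 < s -> `|P.[s] * expR (- s)| <= C / s.
Proof.
exists (\sum_(i < size P) `|P`_i| * (i.+1)`!%:R).
  by apply: sumr_ge0 => i _; rewrite mulr_ge0.
move=> s s0; rewrite normrM (ger0_norm (expR_ge0 _)) horner_coef.
apply: (@le_trans _ _ ((\sum_(i < size P) `|P`_i| * s ^+ i) * expR (- s))).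
  apply: ler_wpM2r; first exact: expR_ge0.
  apply: le_trans (ler_norm_sum _ _ _) _; apply: ler_sum => i _.
  by rewrite normrM (ger0_norm (exprn_ge0 _ (ltW s0))).
rewrite !mulr_suml; apply: ler_sum => i _; rewrite -!mulrA.
apply: ler_wpM2l => //; rewrite ler_pdivlMr// mulrAC -exprSr expRN.
rewrite ler_pdivrMr; last exact: expR_gt0.
have f0 : 0 < (i.+1)`!%:R :> R by rewrite ltr0n fact_gt0.
rewrite -ler_pdivrMl// mulrC; apply: le_trans (expR_ge1Dxn i (ltW s0)).
by rewrite lerDr.
Qed.

Lemma flat_le (P : {poly R}) : exists2 C : R, 0 <= C & forall t, `|flat P t| <= C * `|t|.
Proof.
have [C C0 HC] := expRN_poly_le P; exists C => // t; rewrite /flat.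
case: ifPn => [t0|_]; last by rewrite normr0 mulr_ge0.
have ti0 : 0 < t^-1 by rewrite invr_gt0.
by have := HC _ ti0; rewrite invrK (gtr0_norm t0).
Qed.

(** In the variable [1/t]: the factor ['X^2] is the [t^-2] coming from the derivative of [1/t]. *)
Definition flat_deriv (P : {poly R}) : {poly R} := 'X^2 * (P - P^`()).

Lemma is_derive_flat (P : {poly R}) (t : R) :
  is_derive t (1 : R) (flat P : R -> R) (flat (flat_deriv P) t).
Proof.
have [t0|t0|->] := ltrgtP t 0.
- have E : flat (flat_deriv P) t = 0 by rewrite /flat ltNge (ltW t0).
  rewrite E; apply: (@near_eq_is_derive _ _ _ (cst 0)).
  near=> u; rewrite /flat ltNge ifN// negbK ltW//.
  by near: u; exact: lt_nbhsl.
- have E : flat (flat_deriv P) t =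
      P.[t^-1] *: (expR (- t^-1) * (- (- t ^- 2))) + expR (- t^-1) *: (P^`().[t^-1] * (- t ^- 2)).
    rewrite /flat t0 /flat_deriv hornerM hornerXn hornerD hornerN /GRing.scale/= exprVn.
    by ring.
  rewrite E; pose F u := P.[u^-1] * expR (- u^-1).
  apply: (@near_eq_is_derive _ _ _ F).
    by near=> u; rewrite /flat ifT//; near: u; exact: lt_nbhsr.
  have dV : is_derive t (1 : R) (fun u : R => u^-1) (- t ^- 2).
    have tN0 : t != 0 by rewrite gt_eqF.
    have := @is_deriveV _ id t 1 1 tN0 (is_derive_id t 1).
    by rewrite /GRing.scale/= mulr1.
  have dP : is_derive t (1 : R) (fun u : R => P.[u^-1]) (P^`().[t^-1] * (- t ^- 2)).
    exact: (@is_derive1_comp _ (horner P) (fun u => u^-1)).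
  have dN : is_derive t (1 : R) (fun u : R => - u^-1) (- (- t ^- 2)) by exact: is_deriveN.
  have dE : is_derive t (1 : R) (fun u : R => expR (- u^-1)) (expR (- t^-1) * (- (- t ^- 2))).
    exact: (@is_derive1_comp _ expR (fun u => - u^-1)).
  exact: is_deriveM.
- have -> : flat (flat_deriv P) 0 = 0 by rewrite /flat ltxx.
  (* At the origin the difference quotient is [flat P h / h = flat ('X * P) h], which is bounded by
     [C |h|]. *)
  have [C C0 HC] := flat_le ('X * P).
  have cv : (fun h : R => h^-1 *: (flat P (h *: 1 + 0) - flat P 0)) @ 0^' --> (0 : R^o).
    have bnd h : h != 0 -> `|h^-1 *: (flat P (h *: 1 + 0) - flat P 0)| <= C * `|h|.
      move=> h0; rewrite {2}/flat ltxx subr0 addr0 /GRing.scale/= mulr1.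
      have -> : h^-1 * flat P h = flat ('X * P) h.
        rewrite /flat; case: ifP => _; last by rewrite mulr0.
        by rewrite hornerM hornerX mulrA.
      exact: HC.
    have C1 : 0 < C + 1 by rewrite ltr_wpDl.
    apply/cvgrPdist_le => /= e e0; near=> h; rewrite sub0r normrN.
    have hN0 : h != 0 by near: h; exact: nbhs_dnbhs_neq.
    apply: le_trans (bnd _ hN0) _.
    apply: (@le_trans _ _ ((C + 1) * `|h|)); first by rewrite ler_wpM2r// lerDl.
    rewrite -ler_pdivlMl//.
    near: h; apply: dnbhs0_le; first by rewrite mulr_gt0 ?invr_gt0.
  by split; [apply/cvg_ex; exists (0 : R^o)|exact/cvg_lim].
Unshelve. all: by end_near. Qed.

End smooth_bump.

Section density_measure.
Context {R : realType} {n : nat}.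
Local Notation V := 'cV[R]_n.

Section integral.
Import HBNNSimple.
Local Open Scope ereal_scope.

Lemma ge0_integral_density (p : {measure set V -> \bar R}) (f : V -> R)
    (h : V -> \bar R) :
  measurable_fun setT f -> (forall x, (0 <= f x)%R) ->
  (forall A, measurable A -> p A = \int[lebesgue_cV]_(x in A) (f x)%:E) ->
  measurable_fun setT h -> (forall x, 0 <= h x) ->
  \int[p]_x h x = \int[lebesgue_cV]_x (h x * (f x)%:E).
Proof.
move=> mf f0 pf mh h0.
have mEf : measurable_fun setT (EFin \o f) by exact/measurable_EFinP.
pose h_ := nnsfun_approx measurableT mh.
have h_cvg x : (h_ k x)%:E @[k --> \oo] --> h x.
  by apply: cvg_nnsfun_approx => // y _; exact: h0.
have step k : \int[p]_x (h_ k x)%:E = \int[lebesgue_cV]_x ((h_ k x)%:E * (f x)%:E).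
  rewrite integral_nnsfun// patch_setT sintegralE.
  transitivity (\int[lebesgue_cV]_x (\sum_(r \in range (h_ k))
      (r%:E * ((f x)%:E * (\1_(h_ k @^-1` [set r]) x)%:E)))); last first.
    apply: eq_integral => x _; rewrite [in RHS](fimfunE (h_ k)) -fsumEFin// ge0_mule_fsuml.
      by apply: eq_fsbigr => r _; rewrite EFinM -muleA [X in _ * X]muleC.
    by move=> r; rewrite EFinM; exact: nnfun_muleindic_ge0.
  rewrite ge0_integral_fsum//; last 2 first.
  - move=> r; apply: measurable_funeM; apply: emeasurable_funM => //.
    exact/measurable_EFinP/measurable_indic.
  - move=> r x _; rewrite muleCA mule_ge0 ?lee_fin//.
    exact: nnfun_muleindic_ge0.
  apply: eq_fsbigr => r /[!inE] -[x _ <-].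
  rewrite ge0_integralZl//; last 3 first.
  - by apply: emeasurable_funM => //; exact/measurable_EFinP/measurable_indic.
  - by move=> y _; rewrite mule_ge0 ?lee_fin.
  - by rewrite lee_fin.
  congr (_ * _); rewrite pf// [LHS]integral_mkcond.
  apply: eq_integral => y _; rewrite epatch_indic.
  by [].
transitivity (limn (fun k => \int[p]_x (h_ k x)%:E)).
  rewrite -monotone_convergence//.
  - by apply: eq_integral => x _; apply/esym/cvg_lim => //; exact: h_cvg.
  - by move=> k; exact/measurable_EFinP/measurable_funP.
  - by move=> k x _; rewrite lee_fin.
  - by move=> x _ a b ab; rewrite lee_fin; exact/lefP/nd_nnsfun_approx.
rewrite (_ : (fun k => _) = fun k => \int[lebesgue_cV]_x ((h_ k x)%:E * (f x)%:E)); last first.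
  by apply/funext => k; exact: step.
rewrite -monotone_convergence//.
- apply: eq_integral => x _; apply/cvg_lim => //.
  by apply: cvgeZr => //; exact: h_cvg.
- move=> k; apply: emeasurable_funM => //.
  exact/measurable_EFinP/measurable_funP.
- by move=> k x _; rewrite mule_ge0 ?lee_fin.
- move=> x _ a b ab; apply: lee_wpmul2r; first by rewrite lee_fin.
  by rewrite lee_fin; exact/lefP/nd_nnsfun_approx.
Qed.

End integral.

Definition density_measure (f : V -> R) (A : set V) : \bar R :=
  (\int[lebesgue_cV]_(x in A) (f x)%:E)%E.

Section probability.
Variable f : V -> R.
Hypothesis mf : measurable_fun setT f.
Hypothesis f0 : forall x, 0 <= f x.
Hypothesis f1 : (\int[lebesgue_cV]_x (f x)%:E = 1)%E.

Let mu0 : density_measure f set0 = 0%E.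
Proof. by rewrite /density_measure integral_set0. Qed.

Let mu_ge0 A : (0 <= density_measure f A)%E.
Proof. by apply: integral_ge0 => x _; rewrite lee_fin. Qed.

Let integrablef : lebesgue_cV.-integrable setT (EFin \o f).
Proof.
apply/integrableP; split; first exact/measurable_EFinP.
by under eq_integral do rewrite /= ger0_norm//; rewrite f1 ltry.
Qed.

Let mu_sigma_additive : semi_sigma_additive (density_measure f).
Proof.
move=> /= A mA tA mUA; rewrite /density_measure/= integral_bigcup//=; last first.
  exact: (integrableS _ _ (subsetT _) integrablef).
apply: is_cvg_ereal_nneg_natsum_cond => k _ _.
by apply: integral_ge0 => /= x ?; rewrite lee_fin.
Qed.

Let mu_isMeasure := isMeasure.Build _ _ _ (density_measure f) mu0 mu_ge0 mu_sigma_additive.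
Let mu : {measure set V -> \bar R} := HB.pack_for {measure set V -> \bar R} (density_measure f) mu_isMeasure.
Let mu_setT : mu setT = 1%E. Proof. exact: f1. Qed.
Let mu_isProbability := @Measure_isProbability.Build _ _ R mu mu_setT.

Definition density_prob : probability V R :=
  HB.pack_for (probability V R) (mu : set V -> \bar R) mu mu_isProbability.

End probability.
End density_measure.

(** * Integrals of derivatives of test functions *)

Section integration_by_parts.
Context {R : realType} {n : nat}.
Local Notation V := 'cV[R]_n.
Implicit Types psi f : V -> R.

Lemma box_compact (r : R) : compact (box r : set V).
Proof.
have cI : compact `[(- r), r]%classic by exact: segment_compact.
have := @rV_compact R n (fun=> `[(- r), r]%classic) (fun=> cI).
set K := (X in compact X) => cK.
have -> : box r = (@trmx R 1 n) @` K.
  apply/seteqP; split => [x xb|_ [y yK <-]].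
    exists x^T; last by rewrite trmxK.
    by move=> i /=; rewrite mxE in_itv/= -ler_norml.
  by move=> i; rewrite mxE; have := yK i; rewrite /= in_itv/= -ler_norml.
apply: continuous_compact => //; apply: continuous_subspaceT.
apply: continuous_mxP => i j.
rewrite (_ : (fun x => _) = fun x : 'rV[R]_n => x j i).
  by move=> x; exact: coord_continuous.
by apply/funext => x; rewrite mxE.
Qed.

Lemma compact_sub_box (K : set V) : compact K -> exists2 r : R, 0 <= r & K `<=` box r.
Proof.
move=> cK; have [M M0 HM] := continuous_bounded_on cK (@continuous_sqnorm R n).
exists (M + 1); first by rewrite addr_ge0.
move=> x Kx i; have := HM _ Kx; rewrite ger0_norm ?sqnorm_ge0// => xM.
have : x i ord0 ^+ 2 <= M.
  apply: le_trans xM; rewrite /sqnorm (bigD1 i)//= lerDl sumr_ge0// => j _.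
  exact: sqr_ge0.
rewrite ler_norml => h; apply/andP; split; nra.
Qed.

Lemma sim_translate_subproof : (1%:M : 'M[R]_n)^T *m 1%:M = 1%:M.
Proof. by rewrite trmx1 mulmx1. Qed.

Definition sim_translate (v : V) : similarity R n :=
  MkSimilarity v ltr01 sim_translate_subproof.

Lemma sim_translateE v x : sim_translate v x = x + v.
Proof. by rewrite /sim_fun/= mul1mx scale1r. Qed.

Lemma integrable_indic_box (r : R) : 0 <= r ->
  lebesgue_cV.-integrable setT (fun x : V => (\1_(box r) x)%:E).
Proof.
move=> r0; have mb := @measurable_box R n r; apply/integrableP; split.
  by apply/measurable_EFinP; exact: measurable_indic.
under eq_integral do rewrite gee0_abs ?lee_fin//.
rewrite integral_indic// setIT.
exact: (eq_ind_r (fun z => (z < +oo)%E) (ltry _) (@lebesgue_cV_box R n r r0)).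
Qed.

Lemma integrable_csupport psi (K : set V) : continuous psi -> compact K ->
  (forall x, ~ K x -> psi x = 0) -> lebesgue_cV.-integrable setT (EFin \o psi).
Proof.
move=> cpsi cK psi0; have [M M0 HM] := continuous_bounded_on cK cpsi.
have [r r0 Kr] := compact_sub_box cK.
have ib : lebesgue_cV.-integrable setT (fun x : V => (M%:E * (\1_(box r) x)%:E)%E).
  by apply: integrableZl => //; exact: integrable_indic_box.
apply: le_integrable ib => //.
  by apply/measurable_EFinP; exact: measurable_fun_continuous.
move=> x _; have psiM : `|psi x| <= `|M * \1_(box r : set V) x|.
  have [Kx|nKx] := pselect (K x); last by rewrite psi0// normr0.
  by rewrite indicE mem_set ?mulr1 ?(ger0_norm M0) ?HM//; exact: Kr.
by rewrite -lee_fin in psiM.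
Qed.

Lemma continuous_loc_integrable psi : continuous psi -> loc_integrable psi.
Proof.
move=> cpsi; split; first exact: measurable_fun_continuous.
move=> K cK; have mK := compact_measurable_cV cK.
have [M M0 HM] := continuous_bounded_on cK cpsi.
have [r r0 Kr] := compact_sub_box cK.
apply/integrableP; split.
  by apply: measurable_funTS; apply/measurable_EFinP; exact: measurable_fun_continuous.
apply: (@le_lt_trans _ _ (\int[lebesgue_cV]_(x in K) (cst M%:E x))%E).
  apply: ge0_le_integral_sup => x Kx //=.
  by rewrite lee_fin HM.
rewrite integral_cst//= lte_mul_pinfty// ?lee_fin//.
apply: (@le_lt_trans _ _ (lebesgue_cV (box r : set V))).
  by apply: le_measure => //; rewrite inE//; exact: measurable_box.
by rewrite lebesgue_cV_box// ltry.
Qed.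

Lemma is_derive_line psi (x v : V) (s : R) : derivable psi (s *: v + x) v ->
  is_derive s (1 : R) (fun u : R => psi (u *: v + x)) ('D_v psi (s *: v + x)).
Proof.
move=> dpsi.
have E : (fun h : R => h^-1 *: (((fun u : R => psi (u *: v + x)) \o shift s) (h *: (1 : R))
      - psi (s *: v + x))) =
    (fun h : R => h^-1 *: ((psi \o shift (s *: v + x)) (h *: v) - psi (s *: v + x))) :> (R -> R^o).
  apply/funext => h /=; congr (_ *: (psi _ - _)).
  by rewrite [_%:A]mulr1 scalerDl addrA.
split; first by rewrite /derivable E.
by rewrite /derive E.
Qed.

(* Translation invariance makes the difference quotients of [psi] integrate
   to [0]; they are dominated by a multiple of the indicator of a box. *)
Lemma integral_partial0 psi i : test_function psi ->
  (\int[lebesgue_cV]_x (partial i psi x)%:E = 0)%E.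
Proof.
move=> tpsi; have [cpsi [K cK psi0]] := tpsi.
have c0 : continuous psi := Ck_continuous (cpsi 0%N).
have [dpsi pc] := cpsi 1%N.
pose e : V := delta_mx i ord0.
have [r r0 Kr] := compact_sub_box cK.
have cb : compact (box r : set V) by exact: box_compact.
have [M M0 HM] := continuous_bounded_on cb (pc i).
have pM x : `|partial i psi x| <= M.
  have [|nx] := pselect (box r x); first exact: HM.
  rewrite (partial_support i cK psi0) ?normr0// => Kx; exact/nx/Kr.
have ipsi := integrable_csupport c0 cK psi0.
pose q (k : nat) x := k.+1%:R * (psi (x + k.+1%:R^-1 *: e) - psi x).
have shE k : (fun x => psi (x + k.+1%:R^-1 *: e)) = psi \o sim_translate (k.+1%:R^-1 *: e).
  by apply/funext => x /=; rewrite sim_translateE.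
have ish k : lebesgue_cV.-integrable setT (EFin \o (fun x => psi (x + k.+1%:R^-1 *: e))).
  by rewrite shE; exact: (@integrable_sim _ _ (sim_translate _) (EFin \o psi) ipsi).
have iq0 k : (\int[lebesgue_cV]_x (q k x)%:E = 0)%E.
  under eq_integral do rewrite EFinM EFinB.
  rewrite integralZl//; last exact: integrableB (ish k) ipsi.
  rewrite integralB_EFin//.
  have -> : (\int[lebesgue_cV]_x (psi (x + k.+1%:R^-1 *: e))%:E =
             \int[lebesgue_cV]_x (psi x)%:E)%E.
    have := @integral_sim _ _ (sim_translate (k.+1%:R^-1 *: e)) (EFin \o psi).
    rewrite /= expr1n invr1 mul1e => <-.
      by apply: eq_integral => x _; rewrite sim_translateE.
    by apply/measurable_EFinP; exact: measurable_fun_continuous.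
  by rewrite subee ?mule0//; exact: integrable_fin_num ipsi.
have mq k : measurable_fun setT (q k).
  apply: measurable_funM => //; apply: measurable_funB; last exact: measurable_fun_continuous.
  by rewrite shE; apply: measurable_comp_sim; exact: measurable_fun_continuous.
have cvq x : q ^~ x @ \oo --> partial i psi x.
  have /cvg_ex[/= l cl] := diff_derivable (v := e) (dpsi x).
  have lE : partial i psi x = l by exact/cvg_lim.
  (* The derivative is a limit over punctured neighbourhoods; the harmonic sequence never vanishes
     and so makes it sequential. *)
  have ch : (harmonic : R^nat) @ \oo --> (0 : R)^'.
    move=> A A0; have hA : \forall m \near \oo, harmonic m != 0 :> R -> A (harmonic m).
      exact: (cvg_harmonic A0).
    rewrite nbhs_simpl/=; apply: filterS hA => m; apply.
    by rewrite /= invr_eq0 pnatr_eq0.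
  rewrite lE; have := cvg_comp _ _ ch cl; apply: cvg_trans; apply: near_eq_cvg.
  by apply: nearW => k /=; rewrite /q invrK [X in psi X - _]addrC.
(* The increment [1/(k+1)] is at most [1]: outside [box (r + 1)] both values of [psi] vanish, and
   inside the mean value theorem bounds the quotient by [M]. *)
have qM k x : `|q k x| <= M * \1_(box (r + 1)) x.
  have hk : (0 : R) < k.+1%:R^-1 by rewrite invr_gt0.
  have [xb|nxb] := pselect (box (r + 1) x); last first.
    have [j xj] : exists j, r + 1 < `|x j ord0|.
      apply: contrapT => /forallNP H; apply: nxb => j.
      by rewrite leNgt; apply/negP/H.
    have psix : psi x = 0 by apply: psi0 => /Kr /(_ j) xj'; lra.
    rewrite indicE memNset// mulr0 /q psix subr0 psi0 ?mulr0 ?normr0//.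
    move=> /Kr /(_ j); rewrite !mxE => xhj.
    have h1 : (k.+1%:R^-1 : R) <= 1 by rewrite invf_le1 ?ltr0n// ler1n.
    have d1 : `|k.+1%:R^-1 * ((j == i) && (ord0 == ord0 :> 'I_1))%:R| <= 1 :> R.
      rewrite normrM (gtr0_norm hk); apply: mulr_ile1 => //.
      by case: (_ && _); rewrite ?normr1 ?normr0.
    have := lerB_normD (x j ord0) (k.+1%:R^-1 * ((j == i) && (ord0 == ord0 :> 'I_1))%:R).
    by move=> h; lra.
  rewrite indicE mem_set// mulr1.
  have dg (s : R) : is_derive s (1 : R) (fun u : R => psi (u *: e + x)) (partial i psi (s *: e + x)).
    by apply: is_derive_line; exact: diff_derivable.
  have [|c _] := @MVT R (fun u : R => psi (u *: e + x)) _ 0 k.+1%:R^-1 hk (fun s _ => dg s).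
    apply: continuous_subspaceT => s; apply/differentiable_continuous/derivable1_diffP.
    by have [] := dg s.
  rewrite scale0r add0r subr0 => E.
  by rewrite /q [x + _]addrC E mulrCA mulfV ?pnatr_eq0// mulr1.
pose g x : \bar R := (M * \1_(box (r + 1) : set V) x)%:E.
have ig : lebesgue_cV.-integrable setT g.
  rewrite /g; under eq_fun do rewrite EFinM.
  by apply: integrableZl => //; apply: integrable_indic_box; rewrite addr_ge0.
have cq : {ae lebesgue_cV, forall x : V, setT x ->
    (fun k => (q k x)%:E) @ \oo --> (partial i psi x)%:E}.
  apply: aeW => x _; apply: cvg_EFin; first by apply: nearW.
  exact: cvq.
have qg : {ae lebesgue_cV, forall (x : V) k, setT x -> (`|(q k x)%:E| <= g x)%E}.
  by apply: aeW => x k _; rewrite lee_fin.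
have mqE k : measurable_fun setT (fun x => (q k x)%:E) by exact/measurable_EFinP.
have mp : measurable_fun setT (fun x => (partial i psi x)%:E).
  by apply/measurable_EFinP; apply: measurable_fun_continuous; exact: pc.
have [_ _] := dominated_convergence measurableT mqE mp cq ig qg.
rewrite (_ : (fun k => _) = cst 0%E); last by apply/funext => k /=; rewrite iq0.
move=> h; apply/esym; move: h; apply: cvg_unique => //; exact: cvg_cst.
Qed.

End integration_by_parts.

Section test_functions.
Context {R : realType} {n : nat}.
Local Notation V := 'cV[R]_n.
Implicit Types (f g phi psi : V -> R).

Lemma Ck_flat k (P : {poly R}) g : Ck k g -> Ck k (flat P \o g).
Proof.
have df Q t : differentiable (flat Q : R -> R) t.
  by apply/derivable1_diffP; have [] := is_derive_flat Q t.
elim: k P g => [|k IH] P g /=.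
  move=> cg x; apply: continuous_comp; first exact: cg.
  by apply/differentiable_continuous/df.
move=> /[dup] cg [dg pg]; split => [x|i]; first exact: differentiable_comp.
rewrite (_ : partial i _ = fun x => (flat (flat_deriv P) \o g) x * partial i g x).
  by apply: CkM; [apply: IH; exact: CkS|exact: pg].
apply/funext => x; rewrite /partial !deriveE//; last exact: differentiable_comp.
rewrite diff_comp//= diff1E//= derive1E.
have -> : 'D_1 (flat P) (g x) = flat (flat_deriv P) (g x) by have [_ ->] := is_derive_flat P (g x).
by rewrite /GRing.scale/= mulrC.
Qed.

Lemma Ck_sqnorm k : Ck k (@sqnorm R n).
Proof.
apply: Ck_sum => i; rewrite (_ : (fun x => _) = fun x : V => x i ord0 * x i ord0).
  by apply: CkM; exact: Ck_coord.
by apply/funext => x; rewrite expr2.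
Qed.

Lemma test_functionMl g phi : (forall k, Ck k g) -> test_function phi ->
  test_function (fun x => g x * phi x).
Proof.
move=> cg [cphi [K cK phi0]]; split => [k|]; first exact: CkM.
by exists K => // x nKx; rewrite phi0// mulr0.
Qed.

Lemma test_functionM phi psi : test_function phi -> test_function psi ->
  test_function (fun x => phi x * psi x).
Proof. by move=> [cphi _]; exact: test_functionMl. Qed.

Lemma test_function_continuous phi : test_function phi -> continuous phi.
Proof. by move=> [/(_ 0%N)]. Qed.

Lemma test_function_differentiable phi x : test_function phi -> differentiable phi x.
Proof. by move=> [/(_ 1%N) [+ _]]; exact. Qed.

Lemma test_function_integrable phi : test_function phi ->
  lebesgue_cV.-integrable setT (EFin \o phi).
Proof.
move=> tphi; have [_ [K cK phi0]] := tphi.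
exact: (integrable_csupport (test_function_continuous tphi) cK).
Qed.

Lemma test_function_partial phi i : test_function phi -> test_function (partial i phi).
Proof.
move=> tphi; have [cphi [K cK phi0]] := tphi; split => [k|].
  by have [_ /(_ i)] := cphi k.+1.
by exists K => // x nKx; exact: (partial_support i cK).
Qed.

Lemma partialM phi psi i x : differentiable phi x -> differentiable psi x ->
  partial i (fun x => phi x * psi x) x = phi x * partial i psi x + psi x * partial i phi x.
Proof. by move=> dphi dpsi; rewrite /partial deriveM//; exact: diff_derivable. Qed.

Lemma Rintegral_partialM phi psi i : test_function phi -> test_function psi ->
  \int[lebesgue_cV]_x (phi x * partial i psi x) =
  - \int[lebesgue_cV]_x (partial i phi x * psi x).
Proof.
move=> tphi tpsi; apply/eqP; rewrite -addr_eq0 -RintegralD//; last 2 first.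
- by apply/test_function_integrable/test_functionM => //; exact: test_function_partial.
- by apply/test_function_integrable/test_functionM => //; exact: test_function_partial.
have := integral_partial0 i (test_functionM tphi tpsi) => /(congr1 fine) /= E0.
apply/eqP; rewrite -{}E0 /Rintegral; congr fine; apply: eq_integral => x _; congr EFin.
by rewrite partialM ?[partial i phi x * _]mulrC//; exact: test_function_differentiable.
Qed.

Definition gradient phi (x : V) : V := \col_i partial i phi x.

Lemma weak_gradient_test phi : test_function phi -> weak_gradient phi (gradient phi).
Proof.
move=> tphi; split; first exact/continuous_loc_integrable/test_function_continuous.
move=> i; rewrite (_ : (fun x => _) = partial i phi); last first.
  by apply/funext => x; rewrite mxE.
split; first exact/continuous_loc_integrable/test_function_continuous/test_function_partial.
move=> psi tpsi; rewrite Rintegral_partialM//; congr (- _).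
by apply: eq_Rintegral => x _; rewrite mxE.
Qed.

Lemma Lfun2_test phi : test_function phi -> phi \in Lfun lebesgue_cV 2%:E.
Proof.
move=> tphi; apply/Lfun2P; split.
  by apply: measurable_fun_continuous; exact: test_function_continuous.
rewrite (_ : (fun x => _) = fun x => phi x * phi x).
  by apply: test_function_integrable; exact: test_functionM.
by apply/funext => x; rewrite expr2.
Qed.

Lemma sobolev_W12_test phi : test_function phi -> sobolev_W12 phi.
Proof.
move=> tphi; split; first exact: Lfun2_test.
exists (gradient phi); first exact: weak_gradient_test.
move=> i; rewrite (_ : (fun x => _) = partial i phi).
  exact/Lfun2_test/test_function_partial.
by apply/funext => x; rewrite mxE.
Qed.

Lemma test_function_sum (I : Type) (r : seq I) (F : I -> V -> R) :
  (forall i, test_function (F i)) -> test_function (fun x => \sum_(i <- r) F i x).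
Proof.
move=> tF; split => [k|]; first by apply: Ck_sum => i; have [] := tF i.
elim: r => [|i r [K cK F0]]; first by exists set0; [exact: compact0|move=> x _; rewrite big_nil].
have [_ [L cL FL]] := tF i; exists (L `|` K); first exact: compactU.
by move=> x /not_orP[nL nK]; rewrite big_cons FL// F0// addr0.
Qed.

(** For the square of [phi >= 0] the square root is [phi], a test function, and
    [|nabla f|^2 / f = 4 |nabla phi|^2] where [phi] does not vanish; elsewhere the quotient is [0]
    by convention. *)
Lemma fisher_sqr_fin phi : test_function phi -> (forall x, 0 <= phi x) ->
  (fisher (fun x => (phi x * phi x)%R) < +oo)%E.
Proof.
move=> tphi phi0; pose f x := phi x * phi x.
have tf : test_function f by exact: test_functionM.
have tg : test_function (fun x => 4 * \sum_i partial i phi x * partial i phi x).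
  apply: (@test_functionMl (cst 4)); first by move=> k; exact: Ck_cst.
  by apply: test_function_sum => i; apply: test_functionM; exact: test_function_partial.
apply: (@le_lt_trans _ _ (\int[lebesgue_cV]_x (sqnorm (gradient f x) / f x)%:E)%E).
  apply: ereal_inf_lbound; exists (gradient f) => //; split; last exact: weak_gradient_test.
  rewrite (_ : (fun x => _) = phi); first exact: sobolev_W12_test.
  by apply/funext => x; rewrite -expr2 sqrtr_sqr ger0_norm.
apply: (@le_lt_trans _ _ (\int[lebesgue_cV]_x
    (4 * \sum_i partial i phi x * partial i phi x)%:E)%E).
  apply: ge0_le_integral_sup => x _; rewrite lee_fin.
    by rewrite divr_ge0 ?sqnorm_ge0// mulr_ge0.
  have dphi := test_function_differentiable x tphi.
  have [p0|p0] := eqVneq (phi x) 0.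
    rewrite /f p0 mulr0 invr0 mulr0 mulr_ge0// sumr_ge0// => i _.
    by rewrite -expr2 sqr_ge0.
  rewrite ler_pdivrMr; last by rewrite /f lt_neqAle mulr_ge0// andbT eq_sym mulf_neq0.
  rewrite le_eqVlt; apply/orP; left; apply/eqP.
  rewrite mulr_sumr mulr_suml; apply: eq_bigr => i _.
  by rewrite mxE partialM// /f; ring.
have /integrableP[_] := test_function_integrable tg; apply: le_lt_trans.
by apply: le_trans (le_abse_integral _ _ _); [exact: lee_abs|by []|
  apply/measurable_EFinP; apply: measurable_fun_continuous; exact: test_function_continuous].
Qed.

End test_functions.

(** * Positivity of the Fisher information *)

Section fisher_lower_bound.
Context {R : realType} {n : nat}.
Local Notation V := 'cV[R]_n.
Implicit Types (phi f : V -> R) (p : P2 R n).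

Lemma density_ae_unique p f f' : is_density p f -> is_density p f' ->
  ae_eq lebesgue_cV setT (EFin \o f) (EFin \o f').
Proof.
move=> df df'; have [inf _] := is_density_integrable df.
have [mf' _ f'E] := df'; have [_ _ fE] := df.
apply: integral_ae_eq => //; first exact/measurable_EFinP.
by move=> E _ mE; rewrite -[LHS]fE// f'E.
Qed.

Lemma test_function_EFin_fin phi : test_function phi ->
  (\int[lebesgue_cV]_x (phi x)%:E)%E = (\int[lebesgue_cV]_x phi x)%:E.
Proof.
by move=> tphi; rewrite fineK//; apply: integrable_fin_num => //; exact: test_function_integrable.
Qed.

(** With [f = phi^2] and [A] the left side, parts give [A = - \int x_i f f_i], while expanding
    [(x_i f)_i = f + x_i f_i] gives [A = \int f^2 + \int x_i f f_i]. Adding the two yields the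
    factor [1/2]. *)
Lemma Rintegral_self_partial phi i : test_function phi ->
  \int[lebesgue_cV]_x (phi x * phi x * partial i (fun x => x i ord0 * (phi x * phi x)) x) =
  2^-1 * \int[lebesgue_cV]_x (phi x * phi x * (phi x * phi x)).
Proof.
move=> tphi; pose f x := phi x * phi x; pose c (x : V) := x i ord0.
have tf : test_function f by exact: test_functionM.
have cc k : Ck k c by exact: Ck_coord.
have tcf : test_function (fun x => c x * f x) by exact: test_functionMl.
have tff : test_function (fun x => f x * f x) by exact: test_functionM.
have tpf := test_function_partial i tf.
have tpcf := test_function_partial i tcf.
have dc x : differentiable c x by have [+ _] := cc 1%N; exact.
have pc x : partial i c x = 1.
  by rewrite /partial; have [_ ->] := derivable_coord i x (delta_mx i ord0); rewrite mxE !eqxx.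
have pcf x : partial i (fun x => c x * f x) x = c x * partial i f x + f x.
  rewrite partialM ?pc ?mulr1//; exact: test_function_differentiable.
set A := LHS; have AE : A = - \int[lebesgue_cV]_x (partial i f x * (c x * f x)).
  exact: Rintegral_partialM.
suff : A - \int[lebesgue_cV]_x (f x * f x) = - A by rewrite /f; lra.
rewrite [in RHS]AE opprK /A -RintegralB//; last 2 first.
- by apply: test_function_integrable; exact: test_functionM.
- exact: test_function_integrable.
by apply: eq_Rintegral => x _; rewrite -/(f _) pcf; ring.
Qed.

(* Testing the weak gradient against [x_i phi^2], whose support lies in
   [{phi <> 0}], avoids the vanishing of the gradient on [{f = 0}]. *)
Lemma fisher_sqr_ge phi p (i : 'I_n) : test_function phi ->
  is_density p (fun x => phi x * phi x) ->
  0 < \int[lebesgue_cV]_x (phi x * phi x * (phi x * phi x)) ->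
  (0 < J p)%E.
Proof.
move=> tphi dp; set m2 := Rintegral _ _ _ => m20.
pose f x := phi x * phi x; pose c (x : V) := x i ord0.
have tf : test_function f by exact: test_functionM.
have cc k : Ck k c by exact: Ck_coord.
pose psi x := c x * f x.
have tpsi : test_function psi by exact: test_functionMl.
have tppsi := test_function_partial i tpsi.
have f0 x : 0 <= f x by rewrite /f -expr2 sqr_ge0.
have tM : test_function (fun x => f x * (psi x * psi x)).
  by do 2! apply: test_functionM => //.
(* The summand [1] makes [M] positive, so that it can be divided by. *)
pose M := \int[lebesgue_cV]_x (f x * (psi x * psi x)) + 1.
have M0 : 0 < M.
  rewrite ltr_wpDl// Rintegral_ge0// => x _.
  by rewrite mulr_ge0// -expr2 sqr_ge0.
pose m := 2^-1 * m2; have m0 : 0 < m by rewrite mulr_gt0// invr_gt0.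
apply: (@lt_le_trans _ _ (m ^+ 2 / M)%:E).
  by rewrite lte_fin divr_gt0// exprn_gt0.
(* All competitors have to be bounded: every density [f'], which equals [f] almost everywhere, and
   every weak gradient [g] of it. *)
apply: le_ereal_inf_tmp => _ [f' df' <-].
apply: le_ereal_inf_tmp => _ [g [sf' wg] <-].
have [mf' f'0 _] := df'.
have aef : {ae lebesgue_cV, forall x : V, f' x = f x}.
  by have := density_ae_unique df' dp; apply: filterS => x /= /(_ I) [].
have [_ /(_ i) [[mgi _] /(_ psi tpsi) gpsi]] := wg.
have [_ mg] := weak_gradient_measurable wg.
have mE : m = - \int[lebesgue_cV]_x (g x i ord0 * psi x).
  rewrite -gpsi -[LHS](Rintegral_self_partial i tphi) -/f -/psi.
  rewrite /Rintegral; congr fine; apply: ae_eq_integral => //.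
  - by apply/measurable_EFinP; apply: measurable_fun_continuous;
      apply: test_function_continuous; exact: test_functionM.
  - apply/measurable_EFinP; apply: measurable_funM => //.
    by apply: measurable_fun_continuous; exact: test_function_continuous.
  - by apply: filterS aef => x fx _; rewrite /= fx.
have mpsi : measurable_fun setT psi.
  by apply: measurable_fun_continuous; exact: test_function_continuous.
(* The weight in [|g_i psi| <= (s/2) |g|^2 / f + f psi^2 / (2 s)]. With [s = M / m] the last term
   integrates to at most [m / 2], which leaves [\int |g|^2 / f >= m / s = m^2 / M]. *)
have [s s0 sE] : exists2 s, 0 < s & s = M / m by exists (M / m) => //; rewrite divr_gt0.
pose h x := s / 2 * (sqnorm (g x) / f' x); pose k x := (2 * s)^-1 * (f x * (psi x * psi x)).
have h0 x : 0 <= h x by rewrite mulr_ge0 ?divr_ge0// ?sqnorm_ge0 ?ltW.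
have k0 x : 0 <= k x.
  apply: mulr_ge0; first by rewrite invr_ge0 mulr_ge0// ltW.
  by rewrite mulr_ge0// -expr2 sqr_ge0.
have mh : measurable_fun setT (EFin \o h).
  by apply/measurable_EFinP; do 2! apply: measurable_funM => //; exact: measurable_funV.
have mk : measurable_fun setT (EFin \o k).
  apply/measurable_EFinP; apply: measurable_funM => //.
  by apply: measurable_fun_continuous; exact: test_function_continuous.
have gpsi_le : (m%:E <= \int[lebesgue_cV]_x ((EFin \o h) x + (EFin \o k) x))%E.
  have mgpsi : measurable_fun setT (EFin \o (fun x => g x i ord0 * psi x)).
    by apply/measurable_EFinP; exact: measurable_funM.
  apply: (@le_trans _ _ (\int[lebesgue_cV]_x `|(EFin \o (fun x => g x i ord0 * psi x)%R) x|)%E).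
    apply: le_trans (le_abse_integral _ _ mgpsi) => //.
    rewrite mE /Rintegral; case: (integral _ _ _) => [r| |]//=; rewrite ?oppr0 ?leey//.
    by rewrite lee_fin -normrN ler_norm.
  apply: ae_ge0_le_integral => //.
  - exact: measurableT_comp.
  - by move=> x _; rewrite adde_ge0 ?lee_fin.
  - exact: emeasurable_funD.
  apply: filterS aef => x fx _ /=; rewrite lee_fin /h /k fx.
  (* Where [f] vanishes so does [psi = x_i f], and the gradient does not enter. *)
  have [fx0|fx0] := eqVneq (f x) 0.
    by rewrite /psi fx0 !mulr0 normr0 invr0 !(mulr0, mul0r) addr0.
  have fp : 0 < f x by rewrite lt_neqAle eq_sym fx0/=.
  have gi : g x i ord0 ^+ 2 <= sqnorm (g x).
    by rewrite /sqnorm (bigD1 i)//= lerDl sumr_ge0// => j _; rewrite sqr_ge0.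
  set G := g x i ord0 in gi *; set P := psi x.
  (* AM-GM *)
  have : 0 <= (s * `|G| - f x * `|P|) ^+ 2 by rewrite sqr_ge0.
  rewrite sqrrB !exprMn !real_normK ?num_real// => amgm.
  rewrite -subr_ge0 normrM.
  rewrite (_ : _ - _ = (2 * s * f x)^-1 * (s ^+ 2 * sqnorm (g x) - s * `|G| * (f x * `|P|) *+ 2 + f x ^+ 2 * P ^+ 2)).
    apply: mulr_ge0; first by rewrite invr_ge0 ltW//; do 2! apply: mulr_gt0 => //.
    apply: le_trans amgm _; rewrite lerD2r lerD2r.
    by apply: ler_wpM2l gi; exact: sqr_ge0.
  by field; rewrite fx0 gt_eqF.
rewrite ge0_integralD// in gpsi_le; last 2 first.
- by move=> x _; exact: h0.
- by move=> x _; exact: k0.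
have kE : (\int[lebesgue_cV]_x (EFin \o k) x = ((2 * s)^-1 * (M - 1))%:E)%E.
  rewrite /M addrK /k/=; under eq_integral do rewrite EFinM.
  by rewrite integral_pZl ?invr_gt0 ?mulr_gt0// test_function_EFin_fin.
have hE : (\int[lebesgue_cV]_x (EFin \o h) x =
    (s / 2)%:E * \int[lebesgue_cV]_x (sqnorm (g x) / f' x)%:E)%E.
  rewrite /h/=; under eq_integral do rewrite EFinM.
  by rewrite integral_pZl ?divr_gt0.
rewrite kE hE in gpsi_le.
have I0 : (0 <= \int[lebesgue_cV]_x (sqnorm (g x) / f' x)%:E)%E.
  by apply: integral_ge0 => x _; rewrite lee_fin divr_ge0 ?sqnorm_ge0.
move: gpsi_le I0; set J' := (\int[_]_x (_ / _)%:E)%E; case: J' => [I | |]//; last first.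
  by move=> *; exact: leey.
rewrite -EFinM -EFinD !lee_fin => Hm I0; rewrite ler_pdivrMr//.
have H2 : m <= s / 2 * I + m / 2.
  apply: le_trans Hm _; rewrite lerD2l sE -(@ler_pM2l _ (2 * (M / m))); last first.
    by rewrite mulr_gt0// divr_gt0.
  rewrite mulVKf; last by rewrite mulf_neq0// gt_eqF// divr_gt0.
  rewrite (_ : _ * (m / 2) = M); first by rewrite gerDl lerN10.
  by field; rewrite gt_eqF.
have H3 : m / 2 <= s / 2 * I by lra.
have : m * 2 * (m / 2) <= m * 2 * (s / 2 * I) by rewrite ler_pM2l// mulr_gt0.
rewrite (_ : m * 2 * (s / 2 * I) = I * M); last by rewrite sE; field; rewrite gt_eqF.
by rewrite (_ : m * 2 * (m / 2) = m ^+ 2)//; field.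
Qed.
End fisher_lower_bound.

(** * A curve of finite nonzero length *)

Section finite_fisher_example.
Context {R : realType} {n : nat}.
Local Notation V := 'cV[R]_n.
Implicit Types (S : similarity R n) (p q : P2 R n).

(** The bump [exp(-1 / (2 - |x|^2))] supported in [|x|^2 <= 2]; the constant [2] keeps it above
    [exp(-1)] on the unit ball. *)
Definition hump (x : V) : R := (flat 1 \o (fun x => cst 2 x + -1 * sqnorm x)) x.

Lemma hump_ge0 x : 0 <= hump x.
Proof. by rewrite /hump/= /flat; case: ifP => // _; rewrite hornerC mul1r expR_ge0. Qed.

Lemma test_function_hump : test_function hump.
Proof.
split => [k|].
  apply: Ck_flat; apply: CkD; first exact: Ck_cst.
  by apply: CkM; [exact: Ck_cst|exact: Ck_sqnorm].
exists (box 2); first exact: box_compact.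
move=> x xb; rewrite /hump/= /flat ifF//; apply/negbTE; rewrite -leNgt.
have [i xi] : exists i, 2 < `|x i ord0|.
  by apply: contrapT => /forallNP H; apply: xb => i; rewrite leNgt; apply/negP/H.
have : 2 <= sqnorm x.
  rewrite /sqnorm (bigD1 i)//= -real_normK ?num_real//.
  have : 0 <= \sum_(j | j != i) x j ord0 ^+ 2 by rewrite sumr_ge0// => j _; rewrite sqr_ge0.
  by nra.
by lra.
Qed.

Lemma hump_box x : box n.+1%:R^-1 x -> expR (-1) <= hump x.
Proof.
move=> /box_sqball; rewrite /sqball/= => x1; rewrite /hump/= /flat ifT; last by lra.
rewrite hornerC mul1r ler_expR lerN2 invf_le1; lra.
Qed.

Lemma Rintegral_gt0_box (f : V -> R) (c r : R) : 0 < r -> 0 < c -> test_function f ->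
  (forall x, 0 <= f x) -> (forall x, box r x -> c <= f x) ->
  0 < \int[lebesgue_cV]_x f x.
Proof.
move=> r0 c0 tf f0 cf; rewrite -lte_fin -test_function_EFin_fin//.
have mb := @measurable_box R n r.
apply: (@lt_le_trans _ _ (\int[lebesgue_cV]_(x in box r) (cst c%:E x))%E).
  rewrite [ltRHS](integral_cst lebesgue_cV mb c%:E) mule_gt0//.
  have p0 : (0 < ((2 * r) ^+ n)%:E)%E by rewrite lte_fin exprn_gt0// mulr_gt0.
  exact: (eq_ind_r (fun z => (0 < z)%E) p0 (lebesgue_cV_box (ltW r0))).
apply: (@le_trans _ _ (\int[lebesgue_cV]_(x in box r) (f x)%:E)%E).
  by apply: ge0_le_integral_sup => x xb; rewrite lee_fin; [exact: ltW|exact: cf].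
apply: ge0_subset_integral => //; last by move=> x _; rewrite lee_fin.
apply/measurable_EFinP; apply: measurable_fun_continuous; exact: test_function_continuous.
Qed.

(** The density is the square of a multiple of [hump], normalised by [Z], so that both bounds for
    squares of test functions apply; the lower one uses a coordinate, available since [0 < n]. *)
Lemma exists_finite_fisher : (0 < n)%N ->
  exists2 p : P2 R n, (0 < J p)%E & (J p < +oo)%E.
Proof.
move=> n0; have ri : 0 < n.+1%:R^-1 :> R by rewrite invr_gt0.
have e0 : 0 < expR (-1) :> R by exact: expR_gt0.
have th := test_function_hump.
pose Z := \int[lebesgue_cV]_x (hump x * hump x).
have Z0 : 0 < Z.
  apply: (Rintegral_gt0_box ri (mulr_gt0 e0 e0)) => [|x|x /hump_box xb].
  - exact: test_functionM.
  - by rewrite mulr_ge0// hump_ge0.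
  - by rewrite ler_pM// ltW.
pose phi x := cst (Num.sqrt Z)^-1 x * hump x.
have tphi : test_function phi by apply: test_functionMl => // k; exact: Ck_cst.
have phi0 x : 0 <= phi x by rewrite mulr_ge0 ?hump_ge0// invr_ge0 sqrtr_ge0.
pose f x := phi x * phi x.
have tf : test_function f by exact: test_functionM.
have f0 x : 0 <= f x by rewrite mulr_ge0.
have mf : measurable_fun setT f.
  by apply: measurable_fun_continuous; exact: test_function_continuous.
have f1 : (\int[lebesgue_cV]_x (f x)%:E = 1)%E.
  rewrite test_function_EFin_fin//; congr EFin.
  transitivity (\int[lebesgue_cV]_x (Z^-1 * (hump x * hump x))).
    apply: eq_Rintegral => x _; rewrite /f /phi mulrACA -invfM -expr2 sqr_sqrtr//.
    exact: ltW.
  rewrite RintegralZl//; first by rewrite -/Z mulVf// gt_eqF.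
  by apply: test_function_integrable; exact: test_functionM.
pose P := density_prob mf f0 f1.
have Pmom : (\int[P]_x (sqnorm x)%:E < +oo)%E.
  rewrite (ge0_integral_density mf f0)//; last 2 first.
  - by apply/measurable_EFinP; apply: measurable_fun_continuous; exact: continuous_sqnorm.
  - by move=> x; rewrite lee_fin sqnorm_ge0.
  have tsf : test_function (fun x => sqnorm x * f x).
    by apply: test_functionMl => // k; exact: Ck_sqnorm.
  under eq_integral do rewrite -EFinM.
  by rewrite test_function_EFin_fin// ltry.
pose p : P2 R n := MkP2 Pmom.
have dp : is_density p f by split.
exists p.
  apply: (fisher_sqr_ge (Ordinal n0) tphi dp).
  pose c := (Num.sqrt Z)^-1 * expR (-1).
  have c0 : 0 < c by rewrite mulr_gt0// invr_gt0 sqrtr_gt0.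
  apply: (Rintegral_gt0_box ri (mulr_gt0 (mulr_gt0 c0 c0) (mulr_gt0 c0 c0))) => [|x|x /hump_box xb].
  - exact: test_functionM.
  - by apply: mulr_ge0; apply: mulr_ge0.
  - have cphi : c <= phi x by rewrite /c /phi ler_wpM2l// invr_ge0 sqrtr_ge0.
    have cf : c * c <= phi x * phi x by rewrite ler_pM// ltW.
    by apply: ler_pM => //; apply: mulr_ge0; exact: ltW.
apply: le_lt_trans (fisher_sqr_fin tphi phi0).
by apply: ereal_inf_lbound; exists f.
Qed.

Definition sim_dir (v : V) (t : R) : similarity R n := sim_translate (t *: v).

Lemma push_sim_dir v s t p : push (sim_dir v t) p = push (sim_dir v (t - s)) (push (sim_dir v s) p).
Proof.
apply: P2_ext; apply/funext => A; rewrite !pushE.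
congr (P2_prob p _); apply/funext => x; rewrite /preimage/= !sim_translateE.
by rewrite -addrA -scalerDl [s + _]addrC subrK.
Qed.

Lemma W2_translate p v s t : sqnorm v = 1 ->
  W2 (push (sim_dir v s) p) (push (sim_dir v t) p) = `|t - s|.
Proof.
move=> v1; rewrite (push_sim_dir v s t) W2_affine//.
under eq_integral do rewrite sim_translateE opprD addrA subrr sub0r sqnormN sqnormZ v1 mulr1.
by rewrite integral_cst// [X in (_ * X)%E]probability_setT mule1 sqrtr_sqr.
Qed.

Lemma AC2_translate p v T : sqnorm v = 1 -> AC2 T (fun t => push (sim_dir v t) p).
Proof.
move=> v1; exists (cst 1); split => //.
  under eq_integral do rewrite /= expr1n.
  by rewrite integral_cst// mul1e /= lebesgue_measure_itv/=; case: ifP => _; rewrite ?ltry.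
move=> s t s0 st tT; rewrite W2_translate//= integral_cst// mul1e /= lebesgue_measure_itv/= lte_fin.
rewrite ger0_norm ?subr_ge0//; move: st; rewrite le_eqVlt => /orP[/eqP ->|->].
  by rewrite subrr ltxx.
by rewrite -EFinB.
Qed.

Lemma metric_speed_translate p v t : sqnorm v = 1 ->
  metric_speed (fun t => push (sim_dir v t) p) t = 1.
Proof.
move=> v1; apply/cvg_lim => //; apply: (@cvg_trans _ ((fun=> 1 : R) @ (0 : R)^')).
  apply: near_eq_cvg; near=> h.
  have h0 : h != 0 by near: h; exact: nbhs_dnbhs_neq.
  by rewrite W2_translate// addrAC subrr add0r divff// normr_eq0.
exact: cvg_cst.
Unshelve. all: by end_near. Qed.

Lemma epow_fin (x : \bar R) alpha : (0 < x)%E -> (x < +oo)%E ->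
  exists2 r : R, 0 < r & epow x alpha = r%:E.
Proof.
case: x => [x| |]//; rewrite lte_fin => x0 _; exists (x `^ alpha); first exact: powR_gt0.
by rewrite /= gt_eqF.
Qed.

Lemma similarity_invariant_epow (c alpha : R) : (0 < n)%N -> 0 < c ->
  similarity_invariant_length (fun p : P2 R n => c%:E * epow (J p) alpha)%E <-> alpha = 1.
Proof.
move=> n0 c0; split => [inv|->]; last first.
  move=> S T gamma T0 AC; split; first exact: AC2_push.
  by rewrite cost_length_epow_push subrr powRr0 mul1e.
have [p Jp0 Jpoo] := exists_finite_fisher n0.
pose v : V := delta_mx (Ordinal n0) ord0.
have v1 : sqnorm v = 1.
  rewrite /sqnorm (bigD1 (Ordinal n0))//= mxE !eqxx expr1n big1 ?addr0// => i ni.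
  by rewrite mxE (negbTE ni) expr0n.
(* One dilation is enough: for the ratio [2], invariance forces [2^(1 - alpha) = 1]. *)
pose S : similarity R n := MkSimilarity (0 : V) (ltr0n R 2) sim_translate_subproof.
have [_] := inv S 1 _ ltr01 (AC2_translate p 1 v1).
rewrite cost_length_epow_push /=; set L := cost_length _ _ _ _.
have [l l0 ->] : exists2 l : R, 0 < l & L = l%:E.
  have [r r0 rE] := epow_fin alpha Jp0 Jpoo.
  (* Translates have unit speed and constant [J], so over a time interval of length [1] the length
     equals the weight. *)
  exists (Num.sqrt (2 * (c * r))); first by rewrite sqrtr_gt0 !mulr_gt0.
  rewrite /L /cost_length.
  under eq_integral do rewrite metric_speed_translate// mule1 add0e J_push/= expr1n invr1 mul1e rE -!EFinM.
  by rewrite integral_cst//= lebesgue_measure_itv/= lte_fin ltr01 oppr0 adde0 mule1.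
rewrite -EFinM => -[] /(congr1 (fun x => x / l)); rewrite mulfK ?gt_eqF// divff ?gt_eqF//.
rewrite /powR pnatr_eq0/= => /(congr1 (@ln R)); rewrite expRK ln1 => /eqP.
by rewrite mulf_eq0 subr_eq0 [X in _ || X]gt_eqF ?ln_gt0 ?ltr1n// orbF => /eqP.
Qed.

End finite_fisher_example.

(** * Location-scale leaves *)

Section line_integral.
Context {R : realType}.
Local Notation R' := (measurableTypeR R).
Local Notation leb := (@lebesgue_measure R).
Local Notation V := 'cV[R]_1.

Lemma integral_same_image d d' (T : measurableType d) (T' : measurableType d')
    (mu : {measure set T -> \bar R}) (nu : {measure set T' -> \bar R}) (f : T -> T')
    (h : T' -> \bar R) :
  measurable_fun setT f -> (forall A, measurable A -> mu (f @^-1` A) = nu A) ->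
  measurable_fun setT h ->
  (\int[mu]_x h (f x) = \int[nu]_y h y)%E.
Proof.
move=> mf E mh.
have ge0 (g : T' -> \bar R) : measurable_fun setT g -> (forall x, 0 <= g x)%E ->
    (\int[mu]_x g (f x) = \int[nu]_y g y)%E.
  move=> mg g0; have := @ge0_integral_pushforward _ _ _ _ _ _ mf mu setT g.
  move=> /(_ measurableT mg (fun x _ => g0 x)); rewrite preimage_setT => <-.
  apply: (@eq_measure_integral _ _ _ setT nu (pushforward_measure mu mf)) => A mA _.
  exact: E.
rewrite integralE [in RHS]integralE -!ge0//; last 2 first.
- exact: measurable_funeneg.
- exact: measurable_funepos.
by congr (_ - _)%E; apply: eq_integral => x _; rewrite ?funeposE ?funenegE.
Qed.

Lemma integral_opp (h : R -> \bar R) : measurable_fun [set: R'] h ->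
  (\int[leb]_x h (- x)%R = \int[leb]_x h x)%E.
Proof.
move=> mh; apply: (integral_same_image (f := -%R : R' -> R')) => //.
by move=> A mA; exact: lebesgue_measure_opp.
Qed.

Lemma lebesgue_cV1 (A : set R') : measurable A ->
  lebesgue_cV ((fun x : V => x ord0 ord0) @^-1` A) = leb A.
Proof.
move=> mA; rewrite /lebesgue_cV /pushforward/= /lebesgue_cons /pushforward.
rewrite (_ : _ @^-1` _ = A `*` setT); last first.
  apply/seteqP; split => -[x t] /=; rewrite /preimage/= mxE.
    by rewrite tnth0.
  by rewrite tnth0 => -[].
by rewrite product_measure1E//= diracT mule1.
Qed.

Lemma integral_cV1 (h : R -> \bar R) : measurable_fun [set: R'] h ->
  (\int[lebesgue_cV]_x h ((x : V) ord0 ord0) = \int[leb]_x h x)%E.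
Proof.
move=> mh; apply: integral_same_image mh; last exact: lebesgue_cV1.
by apply: (@measurable_coord R 1 _ _ id ord0); exact: measurable_id.
Qed.

End line_integral.

Section base_density.
Context {R : realType}.
Local Notation R' := (measurableTypeR R).
Local Notation leb := (@lebesgue_measure R).
Local Notation V := 'cV[R]_1.
Implicit Types (phi : R -> R) (S : similarity R 1).

Lemma reflection_subproof : ((- 1)%:M : 'M[R]_1)^T *m (- 1)%:M = 1%:M.
Proof. by rewrite tr_scalar_mx -scalar_mxM mulrNN mulr1. Qed.

(** As a similarity of ratio [1], the reflection makes invariance under [mirror] an instance of the
    push-forward rules. *)
Definition reflection : similarity R 1 := MkSimilarity 0 ltr01 reflection_subproof.

Lemma sim_fun1 S (x : V) : S x ord0 ord0 =
  sim_scale S * (sim_rot S ord0 ord0 * x ord0 ord0) + sim_shift S ord0 ord0.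
Proof. by rewrite !mxE big_ord1. Qed.

Lemma mirror_push phi : (fun x : V => mirror phi (x ord0 ord0)) =
  push_density reflection (fun x : V => phi (x ord0 ord0)).
Proof.
apply/funext => x; rewrite /push_density /mirror expr1n invr1 mul1r; congr phi.
rewrite sim_fun1/= !mxE !big_ord1 !mxE /= invr1 !mul1r mulr1n; ring.
Qed.

Lemma J0_mirror phi : J0 (mirror phi) = J0 phi.
Proof. by rewrite /J0 mirror_push fisher_push/= expr1n invr1 mul1e. Qed.

(** The first moment is dominated by the other two through [|x| <= 1 + x^2]. *)
Lemma base_density_integrable phi : base_density phi ->
  [/\ leb.-integrable setT (fun x => (phi x)%:E),
      leb.-integrable setT (fun x => (x * phi x)%:E) &
      leb.-integrable setT (fun x => (x ^+ 2 * phi x)%:E)].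
Proof.
move=> [[mphi phi0] i0 i1 i2 _].
have mid : measurable_fun [set: R'] (fun x : R' => x : R') by exact: measurable_id.
have m1 : measurable_fun [set: R'] (fun x : R' => x * phi x) by exact: measurable_funM.
have m2 : measurable_fun [set: R'] (fun x : R' => x ^+ 2 * phi x).
  by apply: measurable_funM => //; exact: measurable_funX.
have I0 : leb.-integrable setT (fun x => (phi x)%:E).
  apply/integrableP; split; first exact/measurable_EFinP.
  under eq_integral do rewrite /= ger0_norm//.
  by rewrite i0 ltry.
have I2 : leb.-integrable setT (fun x => (x ^+ 2 * phi x)%:E).
  apply/integrableP; split; first exact/measurable_EFinP.
  rewrite (eq_integral (fun x : R' => ((x : R) ^+ 2 * phi x)%:E)); first by rewrite i2 ltry.
  by move=> x _; rewrite /= ger0_norm// mulr_ge0// sqr_ge0.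
split => //; apply: (le_integrable _ _ _ (integrableD measurableT I0 I2)) => //.
  exact/measurable_EFinP.
move=> x _; rewrite -EFinD lee_fin.
have -> : phi x + x ^+ 2 * phi x = (1 + x ^+ 2) * phi x by ring.
rewrite !normrM (ger0_norm (phi0 x)) ler_wpM2r// (ger0_norm (addr_ge0 ler01 (sqr_ge0 x))).
have key (y : R) : `|y| <= 1 + y ^+ 2.
  rewrite -[y ^+ 2]real_normK ?num_real//.
  by have h1 := sqr_ge0 (`|y| - 1); have h2 := sqr_ge0 `|y|; nra.
exact: key.
Qed.

Lemma base_density_mirror phi : base_density phi -> base_density (mirror phi).
Proof.
move=> bphi; have [[mphi phi0] i0 i1 i2 i3] := bphi.
have [I0 I1 I2] := base_density_integrable bphi.
split.
- split => [|x]; last exact: phi0.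
  by apply: (measurableT_comp mphi); exact: oppr_measurable.
- by rewrite (integral_opp (h := EFin \o phi))//; exact/measurable_EFinP.
- transitivity (\int[leb]_x (fun y => - (y * phi y)%:E) (- x)%R)%E.
    by apply: eq_integral => x _; rewrite /= /mirror mulNr opprK.
  have /integrableP[m1 _] := I1.
  rewrite (integral_opp (h := fun y => - (y * phi y)%:E)%E); last exact: measurableT_comp.
  by rewrite integralN ?i1 ?oppe0//; apply: integrable_add_def.
- transitivity (\int[leb]_x (fun y => (y ^+ 2 * phi y)%:E) (- x)%R)%E.
    by apply: eq_integral => x _ /=; rewrite sqrrN.
  rewrite (integral_opp (h := fun y => (y ^+ 2 * phi y)%:E))//.
  by have /integrableP[] := I2.
- by rewrite J0_mirror.
Qed.

Lemma base_density_moment phi (a b : R) : base_density phi ->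
  (\int[leb]_x ((a * x + b) ^+ 2 * phi x)%:E = (a ^+ 2 + b ^+ 2)%:E)%E.
Proof.
move=> bphi; have [_ i0 i1 i2 _] := bphi.
have [I0 I1 I2] := base_density_integrable bphi.
transitivity (\int[leb]_x ((a ^+ 2)%:E * (x ^+ 2 * phi x)%:E +
    ((2 * a * b)%:E * (x * phi x)%:E + (b ^+ 2)%:E * (phi x)%:E)))%E.
  by apply: eq_integral => x _; rewrite -!EFinM -!EFinD; congr EFin; ring.
rewrite integralD//; last 2 first.
- exact: integrableZl.
- by apply: integrableD => //; exact: integrableZl.
rewrite integralD//; last 2 first.
- exact: integrableZl.
- exact: integrableZl.
by rewrite !integralZl// i0 i1 i2 !mule1 mule0 add0e -EFinD.
Qed.

End base_density.

Section same_measure.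
Context {R : realType} {n : nat}.
Implicit Types (p q : P2 R n).

Lemma is_density_same_measure p q f : is_density p f -> is_density q f -> same_measure p q.
Proof. by move=> [_ _ pf] [_ _ qf] A mA; rewrite pf// qf. Qed.

(** A leaf chart determines its points by densities, hence only up to [same_measure]; couplings test
    measurable sets alone and do not see the difference. *)
Lemma W2_same_measure p p' q q' : same_measure p p' -> same_measure q q' ->
  W2 p q = W2 p' q'.
Proof.
move=> pp' qq'; rewrite /W2; congr (Num.sqrt (fine (ereal_inf (image _ _)))).
by apply/seteqP; split => pi cpl A mA; have := cpl A mA; rewrite pp'// qq'.
Qed.

Lemma J_same_measure p q : same_measure p q -> J p = J q.
Proof.
move=> pq; rewrite /J; congr (ereal_inf (image _ _)).
by apply/seteqP; split => f [mf f0 fE]; split => // A mA; rewrite -fE// pq.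
Qed.

End same_measure.

Section leaf_geometry.
Context {R : realType}.
Local Notation V := 'cV[R]_1.
Implicit Types (phi : R -> R) (P : R -> R -> P2 R 1) (S : similarity R 1).

Definition sim_locscale (u v : R) (v0 : 0 < v) : similarity R 1 :=
  MkSimilarity (const_mx u) v0 sim_translate_subproof.

Lemma push_density_locscale phi u v (v0 : 0 < v) :
  push_density (sim_locscale u v0) (fun x => phi (x ord0 ord0)) = locscale phi u v.
Proof.
apply/funext => x; rewrite /push_density /locscale expr1; congr (_ * phi _).
rewrite sim_fun1 !mxE big_ord1 !mxE /= mulr1n !mul1r; field.
by rewrite gt_eqF.
Qed.

Lemma locscale01 phi : locscale phi 0 1 = fun x : V => phi (x ord0 ord0).
Proof. by apply/funext => x; rewrite /locscale invr1 mul1r subr0 mulr1. Qed.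

Lemma leaf_chart_push phi P u v (v0 : 0 < v) : leaf_chart phi P ->
  same_measure (P u v) (push (sim_locscale u v0) (P 0 1)).
Proof.
move=> chP; apply: (@is_density_same_measure _ _ _ _ (locscale phi u v)); first exact: chP.
by rewrite -(push_density_locscale _ _ v0) -locscale01; exact/is_density_push/chP.
Qed.

Lemma J_leaf phi P u v : 0 < v -> leaf_chart phi P ->
  J (P u v) = ((v ^- 2)%:E * J (P 0 1)%R)%E.
Proof. by move=> v0 chP; rewrite (J_same_measure (leaf_chart_push u v0 chP)) J_push. Qed.

(** The passage between two points of a leaf is a similarity of ratio [v' / v] with trivial
    rotation, the form to which [W2_affine] applies. *)
Lemma push_locscale_ratio u v u' v' (v0 : 0 < v) (v'0 : 0 < v') (p : P2 R 1) :
  push (sim_locscale u' v'0) p =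
  push (sim_locscale (u' - v' / v * u) (divr_gt0 v'0 v0)) (push (sim_locscale u v0) p).
Proof.
apply: P2_ext; apply/funext => A; rewrite !pushE.
congr (P2_prob p _); apply/funext => x; rewrite /preimage/=; congr (A _).
apply/colP => i; rewrite (ord1 i) !sim_fun1/= !mxE/= mulr1n; field.
by rewrite gt_eqF.
Qed.

(** In the base variable the displacement of the optimal map is [(v - v') x + (u - u')]; mean [0]
    and variance [1] turn its second moment into the Euclidean square distance. *)
Lemma W2_leaf phi P u v u' v' : base_density phi -> leaf_chart phi P -> 0 < v -> 0 < v' ->
  W2 (P u v) (P u' v') = Num.sqrt ((u - u') ^+ 2 + (v - v') ^+ 2).
Proof.
move=> bphi chP v0 v'0.
rewrite (W2_same_measure (leaf_chart_push u v0 chP) (leaf_chart_push u' v'0 chP)).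
rewrite (push_locscale_ratio u u' v0 v'0) W2_affine//; congr Num.sqrt.
have msq : measurable_fun setT (fun x : V => (sqnorm (x - sim_locscale (u' - v' / v * u) (divr_gt0 v'0 v0) x))%:E).
  exact: (measurableT_comp (@measurable_sqnormB R 1) (measurable_graph _)).
rewrite integral_push//; last by move=> x; rewrite lee_fin sqnorm_ge0.
have [mf f0 pE] := chP 0 1 ltr01.
rewrite (ge0_integral_density mf f0 pE); last 2 first.
- by apply: (@measurable_comp_sim _ _ (sim_locscale u v0) _ _ _ msq).
- by move=> x; rewrite lee_fin sqnorm_ge0.
rewrite locscale01 -[RHS]/(fine (_)%:E) [X in fine X = _](_ : _ = ((v - v') ^+ 2 + (u - u') ^+ 2)%:E).
  by rewrite /= addrC.
rewrite -(base_density_moment (v - v') (u - u') bphi) -integral_cV1; last first.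
  apply/measurable_EFinP; apply: measurable_funM; last by have [[]] := bphi.
  by apply: measurable_funX; apply: measurable_funD => //; exact: measurable_funM.
apply: eq_integral => x _; rewrite -EFinM; congr ((_ * _)%:E).
have BE (A B : V) : (A - B) ord0 ord0 = A ord0 ord0 - B ord0 ord0 by rewrite !mxE.
rewrite /sqnorm big_ord1 BE; congr (_ ^+ 2).
rewrite !sim_fun1/= !mxE/= mulr1n !mul1r; field.
by rewrite gt_eqF.
Qed.

Lemma metric_speed_leaf phi P u v a b : base_density phi -> leaf_chart phi P -> 0 < v ->
  metric_speed (fun t => P (u + t * a) (v + t * b)) 0 ^+ 2 = a ^+ 2 + b ^+ 2.
Proof.
move=> bphi chP v0; suff -> : metric_speed (fun t => P (u + t * a) (v + t * b)) 0 =
    Num.sqrt (a ^+ 2 + b ^+ 2) by rewrite sqr_sqrtr// addr_ge0// sqr_ge0.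
apply/cvg_lim => //.
apply: (@cvg_trans _ ((fun=> Num.sqrt (a ^+ 2 + b ^+ 2)) @ (0 : R)^')); last exact: cvg_cst.
apply: near_eq_cvg; near=> h.
have h0 : h != 0 by near: h; exact: nbhs_dnbhs_neq.
(* The chart is prescribed only for positive scale; this smallness keeps [v + h b] positive, and the
   quotient is then constant in [h]. *)
have hb : `|h| < v / (1 + `|b|).
  by near: h; apply: dnbhs0_lt; rewrite divr_gt0// ltr_pwDl.
have vh : 0 < v + (0 + h) * b.
  rewrite add0r; have : `|h * b| < v.
    rewrite normrM; apply: (@le_lt_trans _ _ (`|h| * (1 + `|b|))).
      by rewrite ler_wpM2l// lerDr.
    by rewrite -ltr_pdivlMr// ltr_pwDl.
  by rewrite ltr_norml => /andP[]; lra.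
rewrite (W2_leaf _ _ bphi chP)//; last by rewrite mul0r addr0.
rewrite [X in _ = Num.sqrt X / _](_ : _ = h ^+ 2 * (a ^+ 2 + b ^+ 2)); last by ring.
by rewrite sqrtrM ?sqr_ge0// sqrtr_sqr mulrAC divff ?mul1r// normr_eq0.
Unshelve. all: by end_near. Qed.

Lemma cost_form_leaf phi P (c : R) a b u v : base_density phi -> leaf_chart phi P ->
  0 < c -> 0 < v ->
  cost_form (fun p => c%:E * J p)%E 0 P a b u v =
  (a ^+ 2 + b ^+ 2) * (2 * c * fine (J (P 0 1))) / v ^+ 2.
Proof.
move=> bphi chP c0 v0; rewrite /cost_form (metric_speed_leaf u a b bphi chP v0).
rewrite add0e (J_leaf _ v0 chP) fine_pM// fine_pM ?invr_gt0 ?exprn_gt0//.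
by field; rewrite gt_eqF.
Qed.

End leaf_geometry.

(** * Gauss curvature of the half-plane metric *)

Section half_plane_curvature.
Context {R : realType}.
Implicit Types f g E F G : R -> R -> R.

Lemma det3E (a b c d e f g h i : R) : det3 a b c d e f g h i =
  a * (e * i - f * h) - b * (d * i - f * g) + c * (d * h - e * g).
Proof.
rewrite /det3 (expand_det_row _ ord0) !big_ord_recl big_ord0 /cofactor.
rewrite !(expand_det_row _ ord0) !big_ord_recl !big_ord0 /cofactor !det_mx11 !mxE/=.
by rewrite /bump/=; ring.
Qed.

(** Metric coefficients are known only on the upper half-plane; it is open in [v] and contains whole
    horizontal lines, so both partial derivatives respect this equality. *)
Definition eq_upper f g := forall u v, 0 < v -> f u v = g u v.

Lemma eq_upper_dv f g : eq_upper f g -> eq_upper (dv f) (dv g).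
Proof.
move=> fg u v v0; rewrite /dv !derive1E; apply: near_eq_derive.
near=> s; apply: fg; near: s; exact: lt_nbhsr.
Unshelve. all: by end_near.
Qed.

Lemma eq_upper_du f g : eq_upper f g -> eq_upper (du f) (du g).
Proof.
by move=> fg u v v0; rewrite /du; congr (derive1 _ u); apply/funext => s; exact: fg.
Qed.

Lemma dv_upper (k : R) m : eq_upper (dv (fun _ v => k / v ^+ m)) (fun _ v => - (m%:R * k) / v ^+ m.+1).
Proof.
move=> u v v0; rewrite /dv derive1E.
have vN0 : v != 0 by rewrite gt_eqF.
have dV : is_derive v (1 : R) (fun s : R => s^-1) (- v ^- 2).
  have := @is_deriveV _ id v 1 1 vN0 (is_derive_id v 1).
  by rewrite /GRing.scale/= mulr1.
have [_ ] := is_deriveZ k (is_deriveX m dV).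
rewrite (_ : k \*: _ = fun s => k / s ^+ m).
  move=> ->; rewrite /GRing.scale/=; case: m => [|m]; first by rewrite !mul0r mulr0 oppr0 mul0r.
  rewrite /= exprVn !exprS; have : v ^+ m != 0 by rewrite expf_neq0.
  by set w := v ^+ m => wN0; field; rewrite wN0 vN0.
apply/funext => s /=; congr (_ * _); rewrite -exprVn; elim: m => // m IH.
by rewrite [RHS]exprS -IH exprS.
Qed.

Lemma brioschi_half_plane (k : R) E F G : eq_upper E (fun _ v => k / v ^+ 2) ->
  eq_upper F (fun _ _ => 0) -> eq_upper G (fun _ v => k / v ^+ 2) ->
  forall u v, 0 < v -> brioschi E F G u v = - k^-1.
Proof.
move=> EE FE GE u v v0.
have du0 f (h : R -> R) : eq_upper f (fun _ v => h v) -> eq_upper (du f) (fun _ _ => 0).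
  move=> /eq_upper_du fE a b b0; rewrite fE// /du derive1E.
  by rewrite (_ : (fun s => _) = cst (h b))// derive_cst.
have dvE f c m : eq_upper f (fun _ v => c / v ^+ m) ->
    eq_upper (dv f) (fun _ v => - (m%:R * c) / v ^+ m.+1).
  by move=> /eq_upper_dv fE a b b0; rewrite fE// dv_upper.
have dvF : eq_upper (dv F) (fun _ _ => 0).
  move=> a b b0; rewrite (eq_upper_dv FE)// /dv derive1E.
  by rewrite (_ : (fun s => _) = cst 0)// derive_cst.
have EuE := du0 _ _ EE; have GuE := du0 _ _ GE; have FuE := du0 _ _ FE.
have EvE := dvE _ _ _ EE; have GvE := dvE _ _ _ GE.
have EvvE := dvE _ _ _ EvE; have FvuE := du0 _ (cst 0) dvF.
have GuuE := du0 _ (cst 0) GuE.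
rewrite /brioschi !det3E EvvE// FvuE// GuuE// EuE// FuE// EvE// dvF// GuE// EE// FE// GvE// GE//.
have vN0 : v != 0 by rewrite gt_eqF.
(* In the degenerate case both sides are [0], by the convention [0^-1 = 0]. *)
have [->|k0] := eqVneq k 0; first by rewrite !(mul0r, mulr0, oppr0, invr0, subrr, expr0n).
by field; rewrite k0 vN0.
Qed.

Lemma gauss_curvature_leaf phi P (c : R) u v : base_density phi -> leaf_chart phi P ->
  0 < c -> 0 < v ->
  gauss_curvature (fun p => c%:E * J p)%E 0 P u v = - (2 * c * fine (J (P 0 1)))^-1.
Proof.
move=> bphi chP c0 v0; set k := 2 * c * _.
have cE a b : eq_upper (cost_form (fun p => c%:E * J p)%E 0 P a b)
    (fun _ v => (a ^+ 2 + b ^+ 2) * k / v ^+ 2).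
  by move=> s t t0; rewrite (cost_form_leaf _ _ _ bphi chP).
(* The mixed coefficient, obtained by polarisation, vanishes since the form at [(1, 1)] is the sum
   of those at [(1, 0)] and [(0, 1)]. *)
apply: brioschi_half_plane => // s t t0; rewrite !cE//; field.
all: by rewrite gt_eqF.
Qed.

End half_plane_curvature.

Section leaf_similarity.
Context {R : realType}.
Local Notation V := 'cV[R]_1.
Implicit Types (phi : R -> R) (P : R -> R -> P2 R 1) (S : similarity R 1).

(** The cost form itself is invariant: the squared speed gains [a^2] and [J] gains [a^-2]. *)
Lemma gauss_curvature_push S (c : R) P :
  gauss_curvature (fun p => c%:E * J p)%E 0 (fun m s => push S (P m s)) =
  gauss_curvature (fun p => c%:E * J p)%E 0 P.
Proof.
have a0 := sim_scale_gt0 S.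
rewrite /gauss_curvature (_ : cost_form _ 0 (fun m s => _) = cost_form (fun p => c%:E * J p)%E 0 P)//.
do 4! apply/funext => ?; rewrite /cost_form metric_speed_push J_push !add0e.
rewrite muleCA fine_pM ?invr_gt0 ?exprn_gt0// exprMn.
by field; rewrite gt_eqF.
Qed.

Definition reflected S : bool := sim_rot S ord0 ord0 == -1.

Definition leaf_image S phi : R -> R := if reflected S then mirror phi else phi.

Lemma sim_rot1 S : sim_rot S = (-1) ^+ reflected S *: 1%:M.
Proof.
have /matrixP/(_ ord0 ord0) := sim_rot_orth S; rewrite !mxE big_ord1 !mxE/= mulr1n.
rewrite -expr2 => /eqP; rewrite sqrf_eq1 => r1.
apply/matrixP => i j; rewrite (ord1 i) (ord1 j) !mxE/= mulr1n mulr1 /reflected.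
case: eqP => [->//|rN]; rewrite expr0.
by move: r1 => /orP[/eqP //|/eqP /rN].
Qed.

(** A reflecting [S] flips the sign of the location, and the remaining sign inside the base function
    is absorbed by [mirror]. *)
Lemma push_density_leaf S phi u v : 0 < v ->
  push_density S (locscale phi u v) =
  locscale (leaf_image S phi) (sim_scale S * ((-1) ^+ reflected S * u) + sim_shift S ord0 ord0)
    (sim_scale S * v).
Proof.
move=> v0; have aN0 := sim_scale_neq0 S; have vN0 : v != 0 by rewrite gt_eqF.
apply/funext => x; rewrite /push_density /locscale expr1 mulrA -invfM; congr (_ * _).
have -> : sim_inv S x ord0 ord0 =
    (-1) ^+ reflected S * ((x ord0 ord0 - sim_shift S ord0 ord0) / sim_scale S).
  rewrite sim_fun1/= !mxE big_ord1 !mxE sim_rot1 !mxE/= mulr1n; field.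
  exact: aN0.
rewrite /leaf_image /mirror; case: reflected; rewrite ?expr1 ?expr0; congr phi;
  by field; rewrite aN0 vN0.
Qed.

Lemma leaf_push S phi : push S @` leaf phi = leaf (leaf_image S phi).
Proof.
have a0 := sim_scale_gt0 S; have aN0 := sim_scale_neq0 S.
apply/seteqP; split => [_ [p [u [v [v0 dp]]] <-]|q [u [v [v0 dq]]]].
  exists (sim_scale S * ((-1) ^+ reflected S * u) + sim_shift S ord0 ord0), (sim_scale S * v).
  split; first exact: mulr_gt0.
  by rewrite -push_density_leaf//; exact: is_density_push.
(* The leaf coordinates of the preimage come from solving the affine relations of
   [push_density_leaf] for [u] and [v]. *)
exists (push (sim_inv S) q); last exact: push_sim_invK.
exists ((-1) ^+ reflected S * ((u - sim_shift S ord0 ord0) / sim_scale S)), (v / sim_scale S).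
split; first exact: divr_gt0.
rewrite -[locscale _ _ _](push_densityK S); apply: is_density_pushV.
rewrite push_sim_invK push_density_leaf ?divr_gt0//.
rewrite mulrA -signr_addb addbb expr0 mul1r [sim_scale S * (_ / _)]mulrC divfK// subrK.
by rewrite [sim_scale S * _]mulrC divfK.
Qed.

Lemma mirror_gaussian : mirror (@gaussian R) = gaussian.
Proof.
apply/funext => x; rewrite /mirror /gaussian normal_pdfE ?oner_eq0//.
by apply: (congr1 (fun z => normal_peak 1 * expR (- z / (1 ^+ 2 *+ 2)))); rewrite !subr0 sqrrN.
Qed.

Lemma leaf_image_gaussian S : leaf_image S (@gaussian R) = gaussian.
Proof. by rewrite /leaf_image mirror_gaussian if_same. Qed.

(** The standardised points of the two charts are the same measure or reflections of each other, and
    the reflection has ratio [1]. *)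
Lemma J_leaf_image S phi P P' : leaf_chart phi P -> leaf_chart (leaf_image S phi) P' ->
  J (P' 0 1) = J (P 0 1).
Proof.
move=> chP chP'; have dP := chP 0 1 ltr01; have := chP' 0 1 ltr01.
rewrite /leaf_image; case: reflected => dP'; last first.
  exact: J_same_measure (is_density_same_measure dP' dP).
have <- : J (push reflection (P 0 1)) = J (P 0 1) by rewrite J_push/= expr1n invr1 mul1e.
apply: J_same_measure; apply: (is_density_same_measure dP').
by rewrite locscale01 mirror_push; apply: is_density_push; rewrite -locscale01.
Qed.

End leaf_similarity.

Theorem proposition4p26 (R : realType) :
  (forall (n : nat) (S : similarity R n), (0 < n)%N ->
    let a := sim_scale S in
    (* (i) *)
    [/\ forall p : P2 R n, H (push S p) = (H p + (n%:R * ln a)%:E)%E,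
        forall p : P2 R n, J (push S p) = ((a ^- 2)%:E * J p)%E &
        forall p q : P2 R n, W2 (push S p) (push S q) = a * W2 p q] /\
    (* (ii), every dimension *)
    (forall c : R, 0 < c ->
      let U : P2 R n -> \bar R := fun p => (c%:E * J p)%E in
      [/\ forall p, U (push S p) = ((a ^- 2)%:E * U p)%E,
          forall (e T : R) (gamma : R -> P2 R n), 0 <= e -> 0 < T -> AC2 T gamma ->
            cost_length U e T (fun t => push S (gamma t)) =
            cost_length U (a ^+ 2 * e) T gamma,
          forall (e : R) (p q : P2 R n), 0 <= e ->
            cost_dist U e (push S p) (push S q) =
            cost_dist U (a ^+ 2 * e) p q &
          forall p q, cost_dist U 0 (push S p) (push S q) = cost_dist U 0 p q]
      /\
      [/\ forall p, boundary (push S p) <-> boundary p,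
          forall (e : R) (p : P2 R n), 0 <= e ->
            (forall q, boundary q -> cost_dist U e (push S p) q = +oo%E) <->
            (forall q, boundary q -> cost_dist U e p q = +oo%E) &
          forall e : R, 0 <= e ->
            boundary_at_infinity
              (fun p q => cost_dist U e (push S p) (push S q)) <->
            boundary_at_infinity (cost_dist U e)]) /\
    (forall U : P2 R n -> \bar R, eikonal (fun p => U (push S p)) <-> eikonal U)
    /\
    (* (iii) *)
    (forall c alpha : R, 0 < c ->
      let U : P2 R n -> \bar R := fun p => (c%:E * epow (J p) alpha)%E in
      (forall (T : R) (gamma : R -> P2 R n), 0 < T -> AC2 T gamma ->
         cost_length U 0 T (fun t => push S (gamma t)) =
         ((a `^ (1 - alpha))%:E * cost_length U 0 T gamma)%E) /\
      (similarity_invariant_length U <-> alpha = 1))) /\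
  (* (ii), location-scale leaves *)
  (forall S : similarity R 1,
    exists reflected : bool,
      sim_rot S = (-1) ^+ reflected *: 1%:M /\
      let image (phi : R -> R) := if reflected then mirror phi else phi in
      [/\ forall phi : R -> R, base_density phi -> push S @` leaf phi = leaf (image phi),
          forall phi : R -> R, base_density phi ->
            base_density (mirror phi) /\ J0 (mirror phi) = J0 phi :> \bar R &
          forall c : R, 0 < c ->
            let U : P2 R 1 -> \bar R := fun p => (c%:E * J p)%E in
            [/\ forall (phi : R -> R) P, base_density phi -> leaf_chart phi P ->
                  forall mu sigma : R, 0 < sigma ->
                    gauss_curvature U 0 (fun m s => push S (P m s)) mu sigma =
                    gauss_curvature U 0 P mu sigma,
                forall (phi : R -> R) P P', base_density phi -> leaf_chart phi P ->
                  leaf_chart (image phi) P' ->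
                  forall mu sigma mu' sigma' : R, 0 < sigma -> 0 < sigma' ->
                    same_measure (push S (P mu sigma)) (P' mu' sigma') ->
                    gauss_curvature U 0 P' mu' sigma' =
                    gauss_curvature U 0 P mu sigma,
                hyperbolic_leaves U (push S) <-> hyperbolic_leaves U id,
                push S @` leaf gaussian = leaf gaussian &
                gaussian_extremal U (push S) <-> gaussian_extremal U id]]).
Proof.
split=> [n S n0 a|S].
  split; first by split=> *; [exact: H_push|exact: J_push|exact: W2_push].
  split.
    move=> c c0 U; have U0 p : (0 <= U p)%E by exact: fisher_energy_ge0.
    have sU : scales_by U (fun a => a ^- 2) by exact: scales_by_fisher.
    split; split.
    - by move=> p; exact: sU.
    - by move=> e T gamma _ _ _; exact: cost_length_push.
    - by move=> e p q _; exact: cost_dist_push.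
    - by move=> p q; rewrite (cost_dist_push _ _ _ _ sU U0) mulr0.
    - exact: boundary_push.
    - by move=> e p e0; exact: boundary_infinity_push.
    (* The pushed distance is the one at energy [a^2 e], and a positive factor in the energy does
       not affect infinite distance. *)
    - move=> e e0; split=> H p q bp bq; have := H p q bp bq;
        by rewrite (cost_dist_push _ _ _ _ sU U0) cost_dist_pinfty// exprn_gt0 ?sim_scale_gt0.
  split; first exact: eikonal_push.
  move=> c alpha c0 U; split; first by move=> T gamma _ _; exact: cost_length_epow_push.
  exact: similarity_invariant_epow.
exists (reflected S); split; first exact: sim_rot1.
split; first by move=> phi _; exact: leaf_push.
  by move=> phi bphi; split; [exact: base_density_mirror|exact: J0_mirror].
move=> c c0 U; have KE := gauss_curvature_push S c.
split.
- by move=> phi P _ _ u v _; rewrite KE.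
(* Both curvatures are constant along their leaves and depend only on [J] at the standardised point,
   which the two leaves share. *)
- move=> phi P P' bphi chP chP' u v u' v' v0 v'0 _.
  have bphi' : base_density (leaf_image S phi).
    by rewrite /leaf_image; case: reflected => //; exact: base_density_mirror.
  rewrite (gauss_curvature_leaf _ bphi chP c0 v0) (gauss_curvature_leaf _ bphi' chP' c0 v'0).
  by rewrite (J_leaf_image chP chP').
- by split=> H phi P bphi chP u v v0; have := H phi P bphi chP u v v0; rewrite KE.
- by rewrite leaf_push leaf_image_gaussian.
- split=> H phi P Pg bphi chP chPg u v u' v' v0 v'0;
    by have := H phi P Pg bphi chP chPg u v u' v' v0 v'0; rewrite !KE.
Qed.
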